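(* Assume that for each $i=1,2,3,4$: (a) there exist $L_i>0$ and a positive function $\kappa_i$ on $E_i$ of at most polynomial growth such that $|a_i(x)-a_i(y)|\le L_i|x-y|$, $|c_i(x,z)-c_i(y,z)|\le \kappa_i(z)|x-y|$ and $|c_i(x,z)|\le\kappa_i(z)(1+|x|)$ for all $x,y\in\mathbb{R}^{d_i}$, $z\in E_i$; (b) $a_i\in C^4_{\uparrow}(\mathbb{R}^{d_i})$; (c) there exist $\bar r_i>0$ and $K_i>0$ such that $f_i(z)\mathbf{1}_{\{|z|\le \bar r_i\}}\le K_i|z|^{1-d_i}$, and $\int|z|^Lf_i(z)dz<\infty$ for all $L\ge1$; (d) for some $c_{i,0}>0$, $\inf_x|c_i(x,z)|\ge c_{i,0}|z|$ for all $z$ near the origin. Assume that the prior density $\pi_m$ is continuous and bounded on $\bar\Theta_m$ with $\pi_m(\theta_{m,0})>0$, and that there exists a constant $\chi>0$ such that $\mathbf{Y}_m(\theta_m)\le-\chi|\theta_m-\theta_{m,0}|^2$ for all $\theta_m\in\Theta_m$. Then, as $n\to\infty$, $$\frac1n\log\int_{\Theta_m}\exp\{\mathbf{H}_{m,n}(\theta_m)\}\pi_m(\theta_m)d\theta_m=\frac1n\mathbf{H}_{m,n}(\hat\theta_{m,n})-\frac{q_m}{2n}\log n+O_p\Bigl(\frac1n\Bigr).$$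
   Context: True model. $(\Omega,\mathcal F,(\mathcal F_t)_{t\ge0},\mathbf P)$ is a filtered probability space. $p_1,p_2,k_1\le p_1,k_2\le p_2,r_1,\dots,r_4$ are positive integers, $p=p_1+p_2$, $(d_1,d_2,d_3,d_4)=(k_1,p_1,p_2,k_2)$, $E_i=\mathbb{R}^{d_i}\setminus\{0\}$. For $i=1,2,3,4$, $W_i$ is an $r_i$-dimensional standard $(\mathcal F_t)$-Wiener process and $\mu_i(dt,dz)$ is a Poisson random measure on $\mathbb{R}_+\times E_i$ with compensator $f_i(z)\,dz\,dt$, $f_i=\lambda_{i,0}F_i$, $\lambda_{i,0}>0$, $F_i$ a probability density. For every $t\ge0$, the $\sigma$-algebras $\mathcal F_t$, $\sigma(W_{i,u}-W_{i,t};u\ge t)$ $(i=1,\dots,4)$ and $\sigma(\mu_i(A\cap((t,\infty)\times E_i));A\subset\mathbb{R}_+\times E_i\text{ Borel})$ $(i=1,\dots,4)$ are independent. The latent càdlàg $(\mathcal F_t)$-adapted processes $Y_1=\xi$, $Y_2=\delta$, $Y_3=\varepsilon$, $Y_4=\zeta$ ($Y_i$ is $\mathbb{R}^{d_i}$-valued) solve $$dY_{i,t}=a_i(Y_{i,t-})dt+\mathbf S_{i,0}dW_{i,t}+\int_{E_i}c_i(Y_{i,t-},z)\mu_i(dt,dz),\quad Y_{i,0}=x_{i,0},$$ with Borel functions $a_i:\mathbb{R}^{d_i}\to\mathbb{R}^{d_i}$, $c_i:\mathbb{R}^{d_i}\times E_i\to\mathbb{R}^{d_i}$, constant matrices $\mathbf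 S_{i,0}\in\mathbb{R}^{d_i\times r_i}$ and non-random $x_{i,0}$. The observed process is $X_t=(X_{1,t}^\top,X_{2,t}^\top)^\top\in\mathbb{R}^p$, $X_{1,t}=\mathbf\Lambda_{1,0}\xi_t+\delta_t$, $X_{2,t}=\mathbf\Lambda_{2,0}\eta_t+\varepsilon_t$, $\eta_t=\mathbf B_0\eta_t+\mathbf\Gamma_0\xi_t+\zeta_t$, where $\mathbf\Lambda_{1,0}\in\mathbb{R}^{p_1\times k_1}$, $\mathbf\Lambda_{2,0}\in\mathbb{R}^{p_2\times k_2}$ have full column rank, $\mathbf\Gamma_0\in\mathbb{R}^{k_2\times k_1}$, $\mathbf B_0\in\mathbb{R}^{k_2\times k_2}$ has zero diagonal and $\mathbf\Psi_0=\mathbb I_{k_2}-\mathbf B_0$ is non-singular. With $\mathbf\Sigma_{\xi\xi,0}=\mathbf S_{1,0}\mathbf S_{1,0}^\top$, $\mathbf\Sigma_{\delta\delta,0}=\mathbf S_{2,0}\mathbf S_{2,0}^\top$, $\mathbf\Sigma_{\varepsilon\varepsilon,0}=\mathbf S_{3,0}\mathbf S_{3,0}^\top$, $\mathbf\Sigma_{\zeta\zeta,0}=\mathbf S_{4,0}\mathbf S_{4,0}^\top$, let $\mathbf\Sigma_0$ be the symmetric $p\times p$ matrix with blocks $\mathbf\Sigma_0^{11}=\mathbf\Lambda_{1,0}\mathbf\Sigma_{\xi\xi,0}\mathbf\Lambda_{1,0}^\top+\mathbf\Sigma_{\delta\delta,0}$, $\mathbf\Sigma_0^{12}=\mathbf\Lambda_{1,0}\mathbf\Sigma_{\xi\xi,0}\mathbf\Gamma_0^\top\mathbf\Psi_0^{-1\top}\mathbf\Lambda_{2,0}^\top$,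 $\mathbf\Sigma_0^{22}=\mathbf\Lambda_{2,0}\mathbf\Psi_0^{-1}(\mathbf\Gamma_0\mathbf\Sigma_{\xi\xi,0}\mathbf\Gamma_0^\top+\mathbf\Sigma_{\zeta\zeta,0})\mathbf\Psi_0^{-1\top}\mathbf\Lambda_{2,0}^\top+\mathbf\Sigma_{\varepsilon\varepsilon,0}$, assumed positive definite. The data are $X_{t_i^n}$, $t_i^n=ih_n$, $i=0,\dots,n$, with $T=nh_n$ fixed; $\Delta_i^nX=X_{t_i^n}-X_{t_{i-1}^n}$. Parametric Model $m$. $\Theta_m\subset\mathbb{R}^{q_m}$ is a bounded open convex set; $\theta_m\in\Theta_m$ consists of the unknown entries of the loading and volatility matrices. Model $m$ is the same system with $\mathbf\Lambda_{1,0},\mathbf\Lambda_{2,0},\mathbf\Gamma_0,\mathbf B_0,\mathbf S_{i,0}$ replaced by matrices $\mathbf\Lambda_{1,m}^\theta,\mathbf\Lambda_{2,m}^\theta,\mathbf\Gamma_m^\theta,\mathbf B_m^\theta,\mathbf S_{i,m}^\theta$ depending on $\theta_m$ ($\mathbf\Lambda_{1,m}^\theta,\mathbf\Lambda_{2,m}^\theta$ of full column rank, $\mathbf B_m^\theta$ with zero diagonal, $\mathbf\Psi_m^\theta=\mathbb I-\mathbf B_m^\theta$ non-singular). With $\mathbf\Sigma_{\xi\xi,m}^\theta=\mathbf S_{1,m}^\theta\mathbf S_{1,m}^{\theta\top}$, $\mathbf\Sigma_{\delta\delta,m}^\theta=\mathbf S_{2,m}^\theta\mathbf S_{2,m}^{\theta\top}$,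 $\mathbf\Sigma_{\varepsilon\varepsilon,m}^\theta=\mathbf S_{3,m}^\theta\mathbf S_{3,m}^{\theta\top}$, $\mathbf\Sigma_{\zeta\zeta,m}^\theta=\mathbf S_{4,m}^\theta\mathbf S_{4,m}^{\theta\top}$, $\mathbf\Sigma_m(\theta_m)$ is the symmetric $p\times p$ matrix with blocks $\mathbf\Sigma_m^{11}(\theta_m)=\mathbf\Lambda_{1,m}^\theta\mathbf\Sigma_{\xi\xi,m}^\theta\mathbf\Lambda_{1,m}^{\theta\top}+\mathbf\Sigma_{\delta\delta,m}^\theta$, $\mathbf\Sigma_m^{12}(\theta_m)=\mathbf\Lambda_{1,m}^\theta\mathbf\Sigma_{\xi\xi,m}^\theta\mathbf\Gamma_m^{\theta\top}\mathbf\Psi_m^{\theta-1\top}\mathbf\Lambda_{2,m}^{\theta\top}$, $\mathbf\Sigma_m^{22}(\theta_m)=\mathbf\Lambda_{2,m}^\theta\mathbf\Psi_m^{\theta-1}(\mathbf\Gamma_m^\theta\mathbf\Sigma_{\xi\xi,m}^\theta\mathbf\Gamma_m^{\theta\top}+\mathbf\Sigma_{\zeta\zeta,m}^\theta)\mathbf\Psi_m^{\theta-1\top}\mathbf\Lambda_{2,m}^{\theta\top}+\mathbf\Sigma_{\varepsilon\varepsilon,m}^\theta$; it is positive definite for all $\theta_m\in\bar\Theta_m$. There exists $\theta_{m,0}\in\Theta_m$ with $\mathbf\Sigma_0=\mathbf\Sigma_m(\theta_{m,0})$. With $D>0$ and $\rho\in[1/3,1/2)$, $$\mathbf H_{m,n}(\theta_m)=-\frac1{2h_n}\sum_{i=1}^n(\Delta_i^nX)^\top\mathbf\Sigma_m(\theta_m)^{-1}(\Delta_i^nX)\mathbf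 1_{\{|\Delta_i^nX|\le Dh_n^\rho\}}-\frac12\sum_{i=1}^n\log\det\mathbf\Sigma_m(\theta_m)\mathbf 1_{\{|\Delta_i^nX|\le Dh_n^\rho\}},$$ which is three times continuously differentiable in $\theta_m$ with derivatives up to order three extending continuously to $\partial\Theta_m$. The estimator $\hat\theta_{m,n}\in\bar\Theta_m$ satisfies $\mathbf H_{m,n}(\hat\theta_{m,n})=\sup_{\theta_m\in\bar\Theta_m}\mathbf H_{m,n}(\theta_m)$. Further $\mathbf H_m(\theta_m)=-\frac12\mathrm{tr}\{\mathbf\Sigma_m(\theta_m)^{-1}\mathbf\Sigma_m(\theta_{m,0})\}-\frac12\log\det\mathbf\Sigma_m(\theta_m)$ and $\mathbf Y_m(\theta_m)=\mathbf H_m(\theta_m)-\mathbf H_m(\theta_{m,0})$. $\pi_m$ is the prior density of Model $m$ on $\Theta_m$. Notation: $|M|=\sqrt{\mathrm{tr}(MM^\top)}$ for vectors and matrices; $C^k_\uparrow(\mathbb{R}^d)$ is the set of functions on $\mathbb{R}^d$ continuously differentiable up to order $k$ whose derivatives are of polynomial growth. *)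

(* Defs.v *)
From HB Require Import structures.
From mathcomp Require Import all_boot all_order all_algebra.
From mathcomp Require Import all_classical all_reals all_analysis.
From mathcomp Require Import measurable_realfun.

Set Implicit Arguments.
Unset Strict Implicit.
Unset Printing Implicit Defensive.

Import Order.TTheory GRing.Theory Num.Theory numFieldNormedType.Exports.

Local Open Scope classical_set_scope.
Local Open Scope ring_scope.

Definition sigma_family d (V : measurableType d) (T I : Type) (D : set I)
    (X : I -> T -> V) : set (set T) :=
  <<s \bigcup_(i in D) preimage_set_system setT (X i) measurable >>.

Definition sigma_of d (V : measurableType d) (T : Type) (X : T -> V) :
    set (set T) :=
  preimage_set_system setT X measurable.

(* Matrices carry the product sigma-algebra, generated by the entries; for real
   entries it is the Borel sigma-algebra. *)
Section matrix_measurable.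
Context {R : realType} {m n : nat}.

Let mx_measurable : set (set 'M[R]_(m, n)) :=
  sigma_family setT (fun (ij : 'I_m * 'I_n) (A : 'M[R]_(m, n)) => A ij.1 ij.2).

Let mx_measurable0 : mx_measurable set0.
Proof. exact: sigma_algebra0. Qed.

Let mx_measurableC A : mx_measurable A -> mx_measurable (~` A).
Proof. exact: sigma_algebraC. Qed.

Let mx_measurable_bigcup (F : (set _)^nat) :
  (forall i, mx_measurable (F i)) -> mx_measurable (\bigcup_i F i).
Proof. exact: sigma_algebra_bigcup. Qed.

HB.instance Definition _ := @isMeasurable.Build default_measure_display
  'M[R]_(m, n) mx_measurable mx_measurable0 mx_measurableC mx_measurable_bigcup.

Lemma measurable_mx_entry (i : 'I_m) (j : 'I_n) :
  measurable_fun [set: 'M[R]_(m, n)] (fun A : 'M[R]_(m, n) => A i j).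
Proof.
move=> _ B mB; rewrite setTI; apply: sub_sigma_algebra.
by exists (i, j) => //; exists B => //; rewrite setTI.
Qed.

Lemma measurable_fun_mxP d (T : measurableType d) (f : T -> 'M[R]_(m, n)) :
  (forall i j, measurable_fun setT (fun x => f x i j)) -> measurable_fun setT f.
Proof.
move=> mf; apply: measurability; first by rewrite /measurable/=.
move=> _ [_ [[i j] _ [B mB <-]] <-].
by have := mf i j measurableT B mB; rewrite !setTI.
Qed.

End matrix_measurable.

Section lebesgue_vector.
Context {R : realType}.

Definition cons_col n (xv : R * 'cV[R]_n) : 'cV[R]_n.+1 :=
  col_mx (const_mx xv.1 : 'cV[R]_1) xv.2.

Definition uncons_col n (v : 'cV[R]_n.+1) : R * 'cV[R]_n :=
  (v ord0 ord0, dsubmx (v : 'cV[R]_(1 + n))).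

Lemma cons_colK n : cancel (@cons_col n) (@uncons_col n).
Proof.
move=> [x v]; rewrite /cons_col /uncons_col col_mxKd; congr pair.
have -> : (ord0 : 'I_n.+1) = lshift n (ord0 : 'I_1) by exact: val_inj.
by rewrite (@col_mxEu _ 1 n) mxE.
Qed.

Lemma uncons_colK n : cancel (@uncons_col n) (@cons_col n).
Proof.
move=> v; rewrite /cons_col /uncons_col /= -[RHS](@vsubmxK _ 1 n).
congr (@col_mx _ 1 n 1 _ _); apply/matrixP => i j.
by rewrite !mxE !ord1; congr (v _ _); exact: val_inj.
Qed.

Lemma measurable_cons_col n : measurable_fun setT (@cons_col n).
Proof.
apply: measurable_fun_mxP => i j; case: (@split_ordP 1 n i) => k ->.
  under eq_fun do rewrite (@col_mxEu _ 1 n) mxE; exact: measurable_fst.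
under eq_fun do rewrite (@col_mxEd _ 1 n).
exact: (measurableT_comp (measurable_mx_entry k j) measurable_snd).
Qed.

Lemma measurable_uncons_col n : measurable_fun setT (@uncons_col n).
Proof.
apply: measurable_fun_pair; first exact: measurable_mx_entry.
apply: measurable_fun_mxP => i j; under eq_fun do rewrite mxE.
exact: measurable_mx_entry.
Qed.

Section lebesgue_cons.
Context {n : nat} (nu : {sigma_finite_measure set 'cV[R]_n -> \bar R}).

Definition lebesgue_cons : set 'cV[R]_n.+1 -> \bar R :=
  pushforward (lebesgue_measure \x nu)%E (@cons_col n).

Let lebesgue_cons0 : lebesgue_cons set0 = 0%E.
Proof. by rewrite /lebesgue_cons /pushforward preimage_set0 measure0. Qed.

Let lebesgue_cons_ge0 A : (0 <= lebesgue_cons A)%E.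
Proof. by rewrite /lebesgue_cons /pushforward; exact: measure_ge0. Qed.

Let lebesgue_cons_sigma_additive : semi_sigma_additive lebesgue_cons.
Proof.
have mg (A : set 'cV[R]_n.+1) :
    measurable A -> measurable (@cons_col n @^-1` A).
  by move=> mA; rewrite -[X in measurable X]setTI; exact: measurable_cons_col.
move=> F mF tF mUF; rewrite /lebesgue_cons /pushforward preimage_bigcup.
apply: measure_semi_sigma_additive.
- by move=> k; exact: mg.
- apply/trivIsetP => /= i j _ _ ij; rewrite -preimage_setI.
  by move/trivIsetP : tF => /(_ _ _ _ _ ij) ->//; rewrite preimage_set0.
- by rewrite -preimage_bigcup; exact: mg.
Qed.

HB.instance Definition _ := isMeasure.Build _ _ _ lebesgue_cons
  lebesgue_cons0 lebesgue_cons_ge0 lebesgue_cons_sigma_additive.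

Let lebesgue_cons_sigma_finite : sigma_finite setT lebesgue_cons.
Proof.
have /sigma_finiteP[F [TF ndF Foo]] := sigma_finiteT (@lebesgue_measure R).
have /sigma_finiteP[G [TG ndG Goo]] := sigma_finiteT nu.
exists (fun k => @uncons_col n @^-1` (F k `*` G k)).
  rewrite predeqE => v; split=> // _.
  have [i _ Fi] : (\bigcup_k F k) (@uncons_col n v).1 by rewrite -TF.
  have [j _ Gj] : (\bigcup_k G k) (@uncons_col n v).2 by rewrite -TG.
  exists (maxn i j) => //; split => /=.
    by move: Fi; exact/subsetPset/ndF/leq_maxl.
  by move: Gj; exact/subsetPset/ndG/leq_maxr.
move=> k; have [mF Fk] := Foo k; have [mG Gk] := Goo k; split.
  rewrite -[X in measurable X]setTI; apply: measurable_uncons_col => //.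
  exact: measurableX.
rewrite /lebesgue_cons /pushforward -comp_preimage.
rewrite (_ : _ \o _ = id); last by apply/funext => x; exact: cons_colK.
by rewrite preimage_id product_measure1E// lte_mul_pinfty// ge0_fin_numE.
Qed.

HB.instance Definition _ := Measure_isSigmaFinite.Build _ _ _ lebesgue_cons
  lebesgue_cons_sigma_finite.

End lebesgue_cons.

(* n-dimensional Lebesgue measure, as the iterated product of lebesgue_measure *)
Fixpoint lebesgue_col n : {sigma_finite_measure set 'cV[R]_n -> \bar R} :=
  if n is n'.+1 then lebesgue_cons (lebesgue_col n') else \d_(0 : 'cV[R]_0).

End lebesgue_vector.

(* The library norm on matrices is the maximum norm; this is the Euclidean
   (Frobenius) one. *)
Definition fnorm {R : realType} {m n} (A : 'M[R]_(m, n)) : R :=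
  Num.sqrt (\tr (A *m A^T)).

Definition posdefmx {R : realType} {n} (A : 'M[R]_n) : Prop :=
  A^T = A /\ forall x : 'cV[R]_n, x != 0 -> 0 < (x^T *m A *m x) ord0 ord0.

Definition punctured {R : realType} {n} : set 'cV[R]_n := [set z | z != 0].

Definition poly_growth {R : realType} {n} (D : set 'cV[R]_n) (g : 'cV[R]_n -> R)
  : Prop :=
  exists C : R, exists k : nat, forall z, D z -> `|g z| <= C * (1 + fnorm z) ^+ k.

(* iterated partial derivative in the coordinate directions listed in s *)
Definition pderiv {R : realType} {n} (g : 'cV[R]_n -> R) (s : seq 'I_n) :
    'cV[R]_n -> R :=
  foldr (fun j h x => 'D_(delta_mx j ord0) h x) g s.

Definition Ck_on {R : realType} {n} (U : set 'cV[R]_n) (k : nat)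
    (g : 'cV[R]_n -> R) : Prop :=
  forall (s : seq 'I_n) (x : 'cV[R]_n), U x ->
    ((size s <= k)%N -> {for x, continuous (pderiv g s)}) /\
    ((size s < k)%N ->
       forall j, derivable (pderiv g s) x (delta_mx j ord0 : 'cV[R]_n)).

Definition Ck_up {R : realType} {n} (k : nat) (g : 'cV[R]_n -> R) : Prop :=
  Ck_on setT k g /\
  forall s : seq 'I_n, (size s <= k)%N -> poly_growth setT (pderiv g s).

(* g is C^k on U, is continuous on the closure of U, and its derivatives of
   order at most k extend continuously to the closure *)
Definition Ck_closure {R : realType} {n} (U : set 'cV[R]_n) (k : nat)
    (g : 'cV[R]_n -> R) : Prop :=
  [/\ Ck_on U k g, {within closure U, continuous g} &
   forall s : seq 'I_n, (size s <= k)%N ->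
     exists2 e : 'cV[R]_n -> R, {within closure U, continuous e} &
       forall x, U x -> e x = pderiv g s x].

Section probability.
Context {R : realType} d (Omega : measurableType d) (P : probability Omega R).

Definition mutual_independence (I : finType) (G : I -> set (set Omega)) : Prop :=
  forall (J : {set I}) (E : I -> set Omega),
    (forall i, i \in J -> G i (E i)) ->
    P (\bigcap_(i in [set` J]) E i) = (\prod_(i in J) P (E i))%E.

(* Z_n = O_p(b_n) as n tends to infinity *)
Definition bounded_in_probability (Z : nat -> Omega -> R) (b : nat -> R) : Prop :=
  forall eps : R, 0 < eps -> exists2 M : R, 0 < M &
    \forall n \near \oo,
      (P [set w | (M * `|b n| < `|Z n w|)%R] <= eps%:E)%E.

(* time runs through [0, +oo[; values at negative times are irrelevant *)
Definition filtration (F : R -> set (set Omega)) : Prop :=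
  (forall t, 0 <= t -> sigma_algebra setT (F t) /\ F t `<=` measurable) /\
  (forall s t, 0 <= s <= t -> F s `<=` F t).

Definition adapted (F : R -> set (set Omega)) n (Y : R -> Omega -> 'cV[R]_n) :=
  forall t, 0 <= t -> sigma_of (Y t) `<=` F t.

Definition cadlag n (y : R -> 'cV[R]_n) : Prop :=
  (forall t, 0 <= t -> y u @[u --> t^'+] --> y t) /\
  (forall t, 0 < t -> cvg (y u @[u --> t^'-])).

Definition left_limit n (y : R -> 'cV[R]_n) (t : R) : 'cV[R]_n :=
  lim (y u @[u --> t^'-]).

(* increments over [s, t] are independent of F_s with law N(0, (t - s) I_r) *)
Record wiener_process (F : R -> set (set Omega)) r
    (W : R -> Omega -> 'cV[R]_r) : Prop := WienerProcess {
  wiener_start : {ae P, forall w, W 0 w = 0} ;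
  wiener_adapted : adapted F W ;
  wiener_continuous :
    {ae P, forall w, {within `[0, +oo[, continuous (fun t => W t w)}} ;
  wiener_increment : forall s t, 0 <= s < t ->
    forall (A : set Omega) (B : 'I_r -> set R),
    F s A -> (forall j, measurable (B j)) ->
    (P (A `&` [set w | forall j, B j ((W t w - W s w) j ord0)%R]) =
     P A * \prod_(j < r) normal_prob 0%R (Num.sqrt (t - s)%R) (B j))%E }.

(* f(z) dz dt on [0, +oo[ x (R^n \ {0}), extended by zero *)
Definition intensity n (f : 'cV[R]_n -> R) (A : set (R * 'cV[R]_n)) : \bar R :=
  (\int[lebesgue_measure \x lebesgue_col n]_(tz in
     A `&` (`[0%R, +oo[ `*` punctured)) (f tz.2)%:E)%E.

Record poisson_random_measure n (mu : R.-ker Omega ~> (R * 'cV[R]_n)%type)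
    (f : 'cV[R]_n -> R) : Prop := PoissonRandomMeasure {
  prm_support : forall w, mu w (~` (`[0, +oo[ `*` punctured)) = 0%E ;
  prm_integer : forall w A, measurable A ->
    mu w A = +oo%E \/ exists k : nat, mu w A = k%:R%:E ;
  prm_law : forall A, measurable A -> (intensity f A < +oo)%E ->
    forall k : nat, P [set w | mu w A = k%:R%:E] =
      (expR (- fine (intensity f A)) * fine (intensity f A) ^+ k / k`!%:R)%:E ;
  prm_law_infty : forall A, measurable A -> intensity f A = +oo%E ->
    P [set w | mu w A = +oo%E] = 1%E ;
  prm_independent : forall k (A : 'I_k -> set (R * 'cV[R]_n)),
    (forall j, measurable (A j)) -> trivIset setT A ->
    mutual_independence (fun j => sigma_of (fun w => mu w (A j))) }.

(* F_t, sigma(W_{i,u} - W_{i,t} ; u >= t) and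
   sigma(mu_i(A) ; A a Borel subset of ]t, +oo[ x (R^{n_i} \ {0})) *)
Definition driving_sigma (F : R -> set (set Omega)) (I : finType)
    (n r : I -> nat) (W : forall i, R -> Omega -> 'cV[R]_(r i))
    (mu : forall i, R.-ker Omega ~> (R * 'cV[R]_(n i))%type) (t : R)
    (o : option (I + I)) : set (set Omega) :=
  match o with
  | None => F t
  | Some (inl i) => sigma_family [set u | t <= u] (fun u w => W i u w - W i t w)
  | Some (inr i) => sigma_family measurable
      (fun (A : set (R * 'cV[R]_(n i))) w =>
         mu i w (A `&` (`]t, +oo[ `*` punctured)))
  end.

(* Y_t = x0 + int_0^t a(Y_{s-}) ds + S W_t
       + int_0^t int c(Y_{s-}, z) mu(ds, dz)   for all t >= 0, a.s. *)
Record solves_jump_sde n r (a : 'cV[R]_n -> 'cV[R]_n) (S : 'M[R]_(n, r))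
    (c : 'cV[R]_n -> 'cV[R]_n -> 'cV[R]_n) (x0 : 'cV[R]_n)
    (W : R -> Omega -> 'cV[R]_r) (mu : R.-ker Omega ~> (R * 'cV[R]_n)%type)
    (Y : R -> Omega -> 'cV[R]_n) : Prop := SolvesJumpSde {
  sde_start : {ae P, forall w, Y 0 w = x0} ;
  sde_integrable : {ae P, forall w, forall t, 0 <= t -> forall j : 'I_n,
    lebesgue_measure.-integrable `]0, t]
      (fun s => (a (left_limit (Y ^~ w) s) j ord0)%:E) /\
    (mu w).-integrable (`]0, t] `*` punctured)
      (fun sz => (c (left_limit (Y ^~ w) sz.1) sz.2 j ord0)%:E)} ;
  sde_equation : {ae P, forall w, forall t, 0 <= t -> forall j : 'I_n,
    Y t w j ord0 = x0 j ord0
      + \int[lebesgue_measure]_(s in `]0, t]) a (left_limit (Y ^~ w) s) j ord0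
      + (S *m W t w) j ord0
      + \int[mu w]_(sz in `]0, t] `*` punctured)
          c (left_limit (Y ^~ w) sz.1) sz.2 j ord0} }.

End probability.

Definition prob_density {R : realType} {n} (D : set 'cV[R]_n)
    (g : 'cV[R]_n -> R) : Prop :=
  [/\ measurable_fun D g, forall z, D z -> 0 <= g z &
      (\int[lebesgue_col n]_(z in D) (g z)%:E = 1)%E].

Definition latent_xi : 'I_4 := @Ordinal 4 0 isT.
Definition latent_delta : 'I_4 := @Ordinal 4 1 isT.
Definition latent_eps : 'I_4 := @Ordinal 4 2 isT.
Definition latent_zeta : 'I_4 := @Ordinal 4 3 isT.

Definition latent_dim (k1 p1 p2 k2 : nat) (i : 'I_4) : nat :=
  nth 0 [:: k1; p1; p2; k2] i.

Section structural_equation_model.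
Context {R : realType} {k1 p1 p2 k2 : nat} {r : 'I_4 -> nat}.

Record sem_matrices : Type := SemMatrices {
  sem_Lambda1 : 'M[R]_(p1, k1) ;
  sem_Lambda2 : 'M[R]_(p2, k2) ;
  sem_Gamma : 'M[R]_(k2, k1) ;
  sem_B : 'M[R]_k2 ;
  sem_S : forall i : 'I_4, 'M[R]_(latent_dim k1 p1 p2 k2 i, r i) }.

Definition sem_Psi (M : sem_matrices) : 'M[R]_k2 := 1%:M - sem_B M.

Definition sem_admissible (M : sem_matrices) : Prop :=
  [/\ \rank (sem_Lambda1 M) = k1, \rank (sem_Lambda2 M) = k2,
      forall j, sem_B M j j = 0 & sem_Psi M \in unitmx].

Definition sem_vol (M : sem_matrices) (i : 'I_4) :
    'M[R]_(latent_dim k1 p1 p2 k2 i) := sem_S M i *m (sem_S M i)^T.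

Definition sem_Sigma (M : sem_matrices) : 'M[R]_(p1 + p2) :=
  let L1 := sem_Lambda1 M in
  let L2 := sem_Lambda2 M in
  let G := sem_Gamma M in
  let Pi := invmx (sem_Psi M) in
  let Sxi : 'M[R]_k1 := sem_vol M latent_xi in
  let Sdelta : 'M[R]_p1 := sem_vol M latent_delta in
  let Seps : 'M[R]_p2 := sem_vol M latent_eps in
  let Szeta : 'M[R]_k2 := sem_vol M latent_zeta in
  let S11 := L1 *m Sxi *m L1^T + Sdelta in
  let S12 := L1 *m Sxi *m G^T *m Pi^T *m L2^T in
  let S22 := L2 *m Pi *m (G *m Sxi *m G^T + Szeta) *m Pi^T *m L2^T + Seps in
  block_mx S11 S12 S12^T S22.

End structural_equation_model.
Arguments sem_matrices : clear implicits.

Record jump_diffusion_conditions {R : realType} {n : nat}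
    (a : 'cV[R]_n -> 'cV[R]_n) (c : 'cV[R]_n -> 'cV[R]_n -> 'cV[R]_n)
    (f : 'cV[R]_n -> R) : Prop := JumpDiffusionConditions {
  jdc_lipschitz : exists (L : R) (kappa : 'cV[R]_n -> R),
    [/\ 0 < L, (forall z, punctured z -> 0 < kappa z), poly_growth punctured kappa,
        (forall x y, fnorm (a x - a y) <= L * fnorm (x - y)) &
        forall x y z, punctured z ->
          fnorm (c x z - c y z) <= kappa z * fnorm (x - y) /\
          fnorm (c x z) <= kappa z * (1 + fnorm x)] ;
  jdc_smooth : forall j : 'I_n, Ck_up 4 (fun x => a x j ord0) ;
  jdc_density : exists rbar K : R, [/\ 0 < rbar, 0 < K &
    forall z, punctured z ->
      f z * \1_[set y : 'cV[R]_n | fnorm y <= rbar] z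
        <= K * fnorm z `^ (1 - n%:R)] ;
  jdc_moments : forall l : R, 1 <= l ->
    (\int[lebesgue_col n]_(z in punctured) (fnorm z `^ l * f z)%:E < +oo)%E ;
  jdc_lower : exists2 c0 : R, 0 < c0 &
    \forall z \near (0 : 'cV[R]_n)^',
      c0 * fnorm z <= inf (range (fun x => fnorm (c x z))) }.

Section quasi_likelihood.
Context {R : realType} {p q : nat}.

(* indicator that the increment is not attributed to a jump *)
Definition small_increment (D rho h : R) (x : 'cV[R]_p) : R :=
  \1_[set y : 'cV[R]_p | fnorm y <= D * h `^ rho] x.

(* the increment between the observation times i T / n and (i + 1) T / n *)
Definition increment (T : R) (x : R -> 'cV[R]_p) (n i : nat) : 'cV[R]_p :=
  x (i.+1%:R * (T / n%:R)) - x (i%:R * (T / n%:R)).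

Definition quasi_loglik (D rho T : R) (Sigma : 'cV[R]_q -> 'M[R]_p)
    (x : R -> 'cV[R]_p) (n : nat) (theta : 'cV[R]_q) : R :=
  let h := T / n%:R in
  let dx := increment T x n in
  - (2 * h)^-1 * (\sum_(i < n)
      ((dx i)^T *m invmx (Sigma theta) *m dx i) ord0 ord0 *
        small_increment D rho h (dx i))
  - 2^-1 * (\sum_(i < n)
      ln (\det (Sigma theta)) * small_increment D rho h (dx i)).

Definition limit_loglik (Sigma : 'cV[R]_q -> 'M[R]_p) (theta0 theta : 'cV[R]_q)
  : R :=
  - 2^-1 * \tr (invmx (Sigma theta) *m Sigma theta0)
  - 2^-1 * ln (\det (Sigma theta)).

End quasi_likelihood.

(* Main.v *)
(* The quasi-log-likelihood depends on the data linearly, through a finite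
   dimensional statistic: the truncated quadratic variation divided by the step,
   and the number of small increments.  Divided by n, this statistic converges in
   probability to (Sigma_0, 1): only finitely many observation intervals contain
   a jump, and on the others an increment is a Gaussian vector plus a drift term
   whose squared norms sum to o(1).
   Smoothness in theta is only known for the realisations of H_n, so they and
   their limit are written in a finite basis (g_k) of such realisations.  Once the
   coefficients divided by n are close to those of the limit, a deterministic
   Laplace expansion, uniform in the coefficients, applies: symmetric second
   differences of the g_k show that H_n / n is uniformly concave near theta_0, and
   identifiability excludes the rest of the parameter space. *)

Require Import Defs.
From HB Require Import structures.
From mathcomp Require Import all_boot all_order all_algebra.
From mathcomp Require Import all_classical all_reals all_analysis.
From mathcomp Require Import measurable_realfun.
From mathcomp Require Import lra ring.

Set Implicit Arguments.
Unset Strict Implicit.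
Unset Printing Implicit Defensive.

Import Order.TTheory GRing.Theory Num.Theory numFieldNormedType.Exports.

Local Open Scope classical_set_scope.
Local Open Scope ring_scope.

(** * Lebesgue measure on column vectors *)

(** An error O(1/n) after division by n leaves room for any fixed factor, so two-sided bounds of the
    integral suffice and no Hessian at the estimator appears. From above, a parabola dominates the
    exponent on all of [Theta] and leaves a Gaussian integral; from below, a cube of half-side
    [1 / sqrt n] around the estimator is enough. The prior enters through its bounds only.

    In the probabilistic half the squared truncation level has order [h ^ (2 rho)] with [rho < 1/2],
    so [h] is negligible against it and cutting the Gaussian part has a vanishing effect. Young's
    inequality with a small weight separates Gaussian part and drift; the weight multiplies a
    quadratic variation bounded in probability, so it can tend to zero last. The drift is known to
    be integrable in time along each path, and absolute continuity of the integral makes its squared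
    increments negligible.

    Measurability shapes the last step: the estimator is an arbitrary maximiser, so its likelihood
    is replaced by the supremum, a continuous function of the statistic. *)

Section matrix_borel.
Context {R : realType} {m n : nat}.

Let cell (k : nat) (z : 'M[int]_(m, n)) : set 'M[R]_(m, n) :=
  [set A | forall i j, Num.floor (k.+1%:R * A i j) = z i j].

Let measurable_cell k z : measurable (cell k z).
Proof.
have -> : cell k z = \bigcap_(ij in [set: 'I_m * 'I_n])
    ((fun A : 'M[R]_(m, n) => A ij.1 ij.2) @^-1`
      [set x | Num.floor (k.+1%:R * x) = z ij.1 ij.2]).
  apply/seteqP; split => A /=; first by move=> + [i j] _ /=; exact.
  by move=> + i j; move=> /(_ (i, j) I).
apply: fin_bigcap_measurable => //= -[i j] _ /=.
rewrite -[X in measurable X]setTI; apply: measurable_mx_entry => //.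
have -> : [set x : R | Num.floor (k.+1%:R * x) = z i j] =
   `[(z i j)%:~R / k.+1%:R, (z i j + 1)%:~R / k.+1%:R[%classic.
  apply/seteqP; split => x /=; rewrite in_itv/= ler_pdivrMr// ltr_pdivlMr//.
    by rewrite mulrC => <-; rewrite Num.Theory.floor_le_tmp Num.Theory.floorD1_gt.
  by rewrite mulrC => /andP[h1 h2]; apply: floor_def; rewrite h1.
exact: measurable_itv.
Qed.

(** The sigma-algebra comes from the entries, so an open set has to be exhausted countably: the grid
    cells of mesh [1 / k.+1] contained in [U], over all [k], cover it, and each family of cells is
    indexed by integer matrices. *)
Lemma open_measurable_mx (U : set 'M[R]_(m, n)) : open U -> measurable U.
Proof.
move=> oU.
have -> : U = \bigcup_k \bigcup_(z in [set z | cell k z `<=` U]) cell k z.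
  apply/seteqP; split => [A UA|A [k _ [z /= + Az]]]; last exact.
  have /nbhs_ballP[e /= e0 eU] : nbhs A U by exact: open_nbhs_nbhs.
  have [k ke] : exists k : nat, k.+1%:R^-1 < e.
    by have [k] := ltr_add_invr e0; rewrite add0r; exists k.
  exists k => //; exists (\matrix_(i, j) Num.floor (k.+1%:R * A i j)); last first.
    by move=> i j; rewrite mxE.
  move=> B /= AB; apply: eU; split => // i j; rewrite /ball/=.
  apply: le_lt_trans ke; have /esym := AB i j; rewrite mxE => fl.
  have k0 : 0 < k.+1%:R :> R by [].
  rewrite -(ler_pM2l k0) mulfV ?gt_eqF// -[X in X * _](ger0_norm (ltW k0)).
  rewrite -normrM mulrBr.
  have := Num.Theory.floor_le_tmp (k.+1%:R * A i j).
  have := Num.Theory.floorD1_gt (k.+1%:R * A i j).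
  have := Num.Theory.floor_le_tmp (k.+1%:R * B i j).
  have := Num.Theory.floorD1_gt (k.+1%:R * B i j).
  rewrite fl intrD; set u := _ * A i j; set v := _ * B i j.
  by move=> *; rewrite ler_norml; apply/andP; split; lra.
apply: bigcup_measurable => k _.
rewrite bigcup_mkcond; apply: countable_bigcupT_measurable; first exact: countableP.
by move=> z; case: ifP.
Qed.

Lemma open_continuous_measurable_mx (U : set 'M[R]_(m, n)) (f : 'M[R]_(m, n) -> R) :
  open U -> {in U, continuous f} -> measurable_fun U f.
Proof.
move=> oU cf; apply: (measurability _ (RGenOpens.measurableE R)).
move=> _ [_ [a [b ->] <-]]; apply: open_measurable_mx.
rewrite openE => x [Ux fx]; apply: filterI; first exact: open_nbhs_nbhs.
apply: (cf x); first exact: mem_set.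
by apply: open_nbhs_nbhs; split => //; exact: interval_open.
Qed.

End matrix_borel.

(** * Volumes of cubes and Gaussian integrals in n dimensions *)

Section lebesgue_col_theory.
Context {R : realType}.

Lemma lebesgue_colS n : (lebesgue_col n.+1 : set 'cV[R]_n.+1 -> \bar R) =
  pushforward (lebesgue_measure \x lebesgue_col n)%E (@cons_col R n).
Proof. by []. Qed.

Lemma ge0_integral_lebesgue_colS n (f : 'cV[R]_n.+1 -> \bar R) :
  measurable_fun setT f -> (forall x, (0 <= f x)%E) ->
  (\int[lebesgue_col n.+1]_x f x =
   \int[lebesgue_measure]_x \int[lebesgue_col n]_v f (cons_col (x, v)))%E.
Proof.
move=> mf f0; rewrite lebesgue_colS.
have mc : measurable_fun setT
    (@cons_col R n : measurableTypeR R * 'cV[R]_n -> 'cV[R]_n.+1).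
  exact: (@measurable_cons_col R n).
rewrite (ge0_integral_pushforward mc _ measurableT mf); last by move=> *; exact: f0.
rewrite preimage_setT.
rewrite (fubini_tonelli1 (f \o @cons_col R n : measurableTypeR R * 'cV[R]_n -> _))//=.
exact: measurableT_comp.
Qed.

(** Balls are those of the maximum norm, that is, cubes of side [2 * e], which makes the volume a
    plain power. In dimension 0 the measure is a Dirac mass and the power is 1. *)
Lemma lebesgue_col_ball n (c : 'cV[R]_n) (e : R) : 0 < e ->
  lebesgue_col n (ball c e) = ((2 * e) ^+ n)%:E.
Proof.
move=> e0; elim: n c => [|n IH] c.
  rewrite expr0 /= diracE mem_set//; rewrite (_ : c = 0); first exact: ballxx.
  by apply/matrixP => -[].
rewrite lebesgue_colS /pushforward.
have -> : @cons_col R n @^-1` ball c e =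
    ball ((uncons_col c).1) e `*` ball ((uncons_col c).2) e.
  apply/seteqP; split => -[x v] /=.
    move=> [_ h]; split; rewrite /ball/=.
      have := h ord0 ord0; rewrite /cons_col.
      rewrite [X in ball _ _ (_ X ord0)](_ : ord0 = lshift n (ord0 : 'I_1)); last exact: val_inj.
      by rewrite (@col_mxEu _ 1 n) mxE.
    split => // i j; have := h (rshift 1 i) j.
    by rewrite /cons_col (@col_mxEd _ 1 n) !mxE.
  move=> [/= xe [_ ve]]; split => // i j; rewrite /cons_col.
  case: (@split_ordP 1 n i) => k ->.
    rewrite (@col_mxEu _ 1 n) mxE (ord1 k) (ord1 j).
    by have -> : @lshift 1 n ord0 = ord0 :> 'I_n.+1 by exact: val_inj.
  rewrite (@col_mxEd _ 1 n); have := ve k j; rewrite mxE.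
  by [].
rewrite product_measure1E//; last 2 first.
  by apply: open_measurable; exact: ball_open.
  by apply: open_measurable_mx; exact: ball_open.
rewrite IH exprS EFinM; congr (_ * _)%E.
by rewrite mulr_natl; exact: (lebesgue_measure_ball _ (ltW e0)).
Qed.

Lemma integral_gauss (a m : R) : 0 < a ->
  (\int[lebesgue_measure]_x (expR (- (a * (x - m) ^+ 2)))%:E
   = (Num.sqrt (pi / a))%:E)%E.
Proof.
(* The standard deviation for which [a = 1 / (2 s^2)]: the integrand is then the normal density with
   mean [m], divided by its peak. *)
move=> a0; pose s := Num.sqrt (2 * a)^-1.
have s0 : s != 0 by rewrite gt_eqF// sqrtr_gt0 invr_gt0 mulr_gt0.
have s2 : s ^+ 2 = (2 * a)^-1 by rewrite sqr_sqrtr// invr_ge0 mulr_ge0// ltW.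
have pk := normal_peak_gt0 s0.
have -> : (Num.sqrt (pi / a))%:E = ((normal_peak s)^-1%:E * 1)%E.
  rewrite mule1 /normal_peak invrK s2; congr (Num.sqrt _)%:E.
  by rewrite -mulr_natr; field; rewrite gt_eqF.
rewrite -(integral_normal_pdf m s) -ge0_integralZl//=; last 3 first.
- by apply/measurable_EFinP; exact: measurable_normal_pdf.
- by move=> x _; rewrite lee_fin normal_pdf_ge0.
- by rewrite lee_fin invr_ge0 ltW.
apply: eq_integral => x _; rewrite normal_pdfE// -EFinM mulKf ?gt_eqF//.
rewrite /normal_fun s2; congr (expR _)%:E.
by rewrite -mulr_natr; field; rewrite gt_eqF.
Qed.

Let measurable_gauss_col n (a : R) (c : 'cV[R]_n) : measurable_fun setT
  (fun x : 'cV[R]_n => (expR (- (a * \sum_i (x i ord0 - c i ord0) ^+ 2)))%:E).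
Proof.
apply/measurable_EFinP; apply: measurableT_comp => //.
apply: measurableT_comp => //; apply: measurable_funM => //.
apply: measurable_sum => i; apply: measurable_funX; apply: measurable_funB => //.
exact: measurable_mx_entry.
Qed.

Lemma integral_gauss_col n (a : R) (c : 'cV[R]_n) : 0 < a ->
  (\int[lebesgue_col n]_x
     (expR (- (a * \sum_i (x i ord0 - c i ord0) ^+ 2)))%:E
   = (Num.sqrt (pi / a) ^+ n)%:E)%E.
Proof.
move=> a0; elim: n c => [|n IH] c.
  rewrite /= integral_dirac//; last exact: measurable_gauss_col.
  by rewrite diracT mul1e big_ord0 mulr0 oppr0 expR0 expr0.
rewrite ge0_integral_lebesgue_colS//.
transitivity (\int[lebesgue_measure]_x ((expR (- (a * (x - c ord0 ord0) ^+ 2)))%:E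
   * (Num.sqrt (pi / a) ^+ n)%:E))%E.
  apply: eq_integral => x _; rewrite -(IH (dsubmx (c : 'cV_(1 + n)))).
  rewrite -ge0_integralZl//; last exact: measurable_gauss_col.
  apply: eq_integral => v _; rewrite -EFinM -expRD -opprD -mulrDr.
  congr (expR (- (a * _)))%:E.
  rewrite big_ord_recl; congr (_ ^+ 2 + _).
    congr (_ - _).
    have -> : ord0 = @lshift 1 n ord0 :> 'I_n.+1 by exact: val_inj.
    by rewrite /cons_col (@col_mxEu _ 1 n) mxE.
  apply: eq_bigr => i _; rewrite [dsubmx _ _ _]mxE.
  have -> : lift ord0 i = @rshift 1 n i :> 'I_n.+1 by exact: val_inj.
  by rewrite /cons_col (@col_mxEd _ 1 n).
rewrite ge0_integralZr//=; last first.
  apply/measurable_EFinP; apply: measurableT_comp => //.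
  apply: measurableT_comp => //; apply: measurable_funM => //.
  by apply: measurable_funX; exact: measurable_funB.
by rewrite integral_gauss// -EFinM -exprS.
Qed.

End lebesgue_col_theory.

(** * Laplace expansion *)

Section line_derivative.
Context {R : realType} {V : normedModType R}.
Implicit Types (f : V -> R) (x v : V).

Lemma is_derive_line f x v (t : R) : derivable f (x + t *: v) v ->
  is_derive t 1 (fun s : R => f (x + s *: v)) ('D_v f (x + t *: v)).
Proof.
have E : (fun h : R => h^-1 *: (((fun s : R => f (x + s *: v)) \o shift t) (h *: 1) -
    f (x + t *: v))) =
  (fun h : R => h^-1 *: ((f \o shift (x + t *: v)) (h *: v) - f (x + t *: v))).
  apply/funext => h /=; congr (_ *: (f _ - _)).
  by rewrite scalerDl [h *: 1]mulr1 addrCA.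
by move=> df; split; rewrite /derivable /derive E.
Qed.

Lemma MVT_line f x v (d e : R) :
  (forall s, 0 <= s <= 1 -> derivable f (x + (s * d) *: v) v /\
     `|'D_v f (x + (s * d) *: v)| <= e) ->
  `|f (x + d *: v) - f x| <= e * `|d|.
Proof.
have [->|dn0] := eqVneq d 0.
  by rewrite scale0r addr0 subrr normr0 mulr0.
move=> H.
have H' (t : R) : 0 <= t / d <= 1 -> derivable f (x + t *: v) v /\
    `|'D_v f (x + t *: v)| <= e by move=> /H; rewrite divfK.
have D (t : R) : 0 <= t / d <= 1 -> is_derive t 1 (fun s : R => f (x + s *: v))
    ('D_v f (x + t *: v)) by move=> /H'[df _]; exact: is_derive_line.
have C (a b : R) : (forall t, t \in `[a, b] -> 0 <= t / d <= 1) ->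
    {within `[a, b], continuous (fun s : R => f (x + s *: v))}.
  move=> ab; apply: derivable_within_continuous => t /ab /D dt.
  exact: ex_derive.
have fx : f x = f (x + 0 *: v) by rewrite scale0r addr0.
have [d0|d0] := leP 0 d.
  have ab t : t \in `[0, d] -> 0 <= t / d <= 1.
    rewrite in_itv/= => /andP[t0 td]; rewrite divr_ge0//= ler_pdivrMr ?mul1r//.
    by rewrite lt_def dn0.
  have [c cd] := MVT_segment d0
    (fun t td => D t (ab _ (subset_itv_oo_cc td))) (C _ _ ab).
  rewrite fx => ->; rewrite subr0 normrM ler_wpM2r//.
  exact: (H' _ (ab _ cd)).2.
have ab t : t \in `[d, 0] -> 0 <= t / d <= 1.
  rewrite in_itv/= => /andP[td t0]; rewrite -mulrNN -invrN divr_ge0 ?oppr_ge0 ?(ltW d0)//=.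
  by rewrite ler_pdivrMr ?oppr_gt0// mul1r lerN2.
have [c cd] := MVT_segment (ltW d0)
  (fun t td => D t (ab _ (subset_itv_oo_cc td))) (C _ _ ab).
rewrite fx distrC => ->; rewrite sub0r normrM normrN ler_wpM2r//.
exact: (H' _ (ab _ cd)).2.
Qed.

End line_derivative.

Section column_calculus.
Context {R : realType} {q : nat}.
Implicit Types (f : 'cV[R]_q -> R) (x y c v : 'cV[R]_q).

Lemma norm_mx_entry {m n} (x : 'M[R]_(m, n)) i j : `|x i j| <= `|x|.
Proof.
rewrite [leRHS]/Num.norm /= mx_normrE.
by apply: (le_bigmax _ (fun ij : 'I_m * 'I_n => `|x ij.1 ij.2|) (i, j)).
Qed.

Lemma ball_mxP {m n} (c x : 'M[R]_(m, n)) e : 0 < e ->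
  (forall i j, `|c i j - x i j| < e) -> ball c e x.
Proof. by move=> e0 h; split. Qed.

(** Mean value inequality along an edge path: [z k] has its first [k] coordinates from [y] and the
    others from [x]. A ball of the maximum norm is a box, so the whole path stays inside. On each
    edge the linear term [a k] is subtracted first, which leaves a derivative of size at most
    [e]. *)
Lemma partials_increment f c (r e : R) (a : 'I_q -> R) :
  (forall x j, ball c r x -> derivable f x (delta_mx j ord0) /\
     `|'D_(delta_mx j ord0) f x - a j| <= e) ->
  forall x y, ball c r x -> ball c r y ->
  `|f y - f x - \sum_j a j * (y j ord0 - x j ord0)| <=
     e * \sum_j `|y j ord0 - x j ord0|.
Proof.
move=> H x y bx by_; have r0 : 0 < r by case: bx.
pose z (k : nat) : 'cV[R]_q := \col_i (if (i < k)%N then y i ord0 else x i ord0).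
have z0 : z 0%N = x by apply/matrixP => i j; rewrite mxE ltn0 (ord1 j).
have zq : z q = y by apply/matrixP => i j; rewrite mxE ltn_ord (ord1 j).
have zS (k : 'I_q) : z k.+1 = z k + (y k ord0 - x k ord0) *: delta_mx k ord0.
  apply/matrixP => i j; rewrite !mxE !ord1 eqxx andbT ltnS leq_eqVlt.
  have [->|ik] := eqVneq i k; first by rewrite eqxx ltnn mulr1 addrC subrK.
  by rewrite (negbTE ik : (i == k :> nat) = false)/= mulr0 addr0.
have -> : f y - f x = \sum_(k < q) (f (z k.+1) - f (z k)).
  rewrite -(big_mkord predT (fun k => f (z k.+1) - f (z k))).
  by rewrite telescope_sumr// z0 zq.
rewrite -sumrB; apply: (le_trans (ler_norm_sum _ _ _)).
rewrite mulr_sumr; apply: ler_sum => k _.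
pose g (w : 'cV[R]_q) := f w - a k * w k ord0.
have -> : f (z k.+1) - f (z k) - a k * (y k ord0 - x k ord0) = g (z k.+1) - g (z k).
  rewrite /g zS !mxE !eqxx ltnn mulr1; lra.
have dk w : derivable (fun w : 'cV[R]_q => a k * w k ord0) w (delta_mx k ord0) /\
    'D_(delta_mx k ord0) (fun w : 'cV[R]_q => a k * w k ord0) w = a k.
  have cv : (fun h : R => h^-1 *: (((fun w : 'cV[R]_q => a k * w k ord0) \o shift w)
      (h *: (delta_mx k ord0 : 'cV[R]_q)) - a k * w k ord0)) @ 0^' --> a k.
    apply: cvg_near_cst; near=> h; rewrite /= !mxE !eqxx mulr1 -mulrBr addrK.
    rewrite [LHS]mulrCA mulVf ?mulr1//.
    by near: h; exact: nbhs_dnbhs_neq.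
  by split; [apply/cvg_ex; exists (a k)|exact/cvg_lim].
rewrite zS; apply: MVT_line => s /andP[s0 s1].
have bz : ball c r (z k + (s * (y k ord0 - x k ord0)) *: delta_mx k ord0).
  apply: ball_mxP => // i j; rewrite !mxE !ord1 eqxx andbT.
  have [->|ik] := eqVneq i k; last first.
    rewrite mulr0 addr0; case: ifP => _; [exact: by_.2|exact: bx.2].
  rewrite ltnn mulr1.
  have := (bx.2 k ord0); have := (by_.2 k ord0); rewrite /ball/= => yr xr.
  rewrite (_ : _ - _ = (1 - s) * (c k ord0 - x k ord0) + s * (c k ord0 - y k ord0)); last by lra.
  apply: (le_lt_trans (ler_normD _ _)).
  rewrite !normrM (ger0_norm s0) ger0_norm ?subr_ge0//.
  have [->|sn0] := eqVneq s 0; first by rewrite subr0 mul1r mul0r addr0.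
  have {}s0 : 0 < s by rewrite lt_def sn0.
  rewrite [ltRHS](_ : r = (1 - s) * r + s * r); last by lra.
  by rewrite ler_ltD ?ltr_pM2l// ler_wpM2l ?subr_ge0// ltW.
have [df D] := H _ k bz; have [dl Dl] := dk (z k + (s * (y k ord0 - x k ord0)) *: delta_mx k ord0).
by split; [exact: derivableB|rewrite deriveB// Dl].
Unshelve. all: by end_near.
Qed.

End column_calculus.

Section second_difference.
Context {R : realType} {q : nat}.
Implicit Types (f : 'cV[R]_q -> R) (x y c v : 'cV[R]_q).

(** [Ck_on] provides derivatives in coordinate directions only; continuity of the partial
    derivatives at [c] upgrades them to every direction [v]. *)
Lemma is_derive_partials f c v :
  (\forall x \near c, forall j, derivable f x (delta_mx j ord0)) ->
  (forall j, {for c, continuous (fun x => 'D_(delta_mx j ord0) f x)}) ->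
  is_derive c v f (\sum_j 'D_(delta_mx j ord0) f c * v j ord0).
Proof.
move=> fd cd; set L := \sum_j _.
suff cv : (fun h : R => h^-1 *: ((f \o shift c) (h *: v) - f c)) @ 0^' --> L.
  by split; [apply/cvg_ex; exists L|exact/cvg_lim].
apply/cvgrPdist_le => e e0.
pose s := \sum_j `|v j ord0|.
have s0 : 0 < 1 + s by rewrite ltr_pwDl// sumr_ge0.
pose e' := e / (1 + s).
have e'0 : 0 < e' by rewrite divr_gt0.
have : \forall x \near c, forall j, derivable f x (delta_mx j ord0) /\
    `|'D_(delta_mx j ord0) f x - 'D_(delta_mx j ord0) f c| <= e'.
  have : \forall x \near c, forall j,
    `|'D_(delta_mx j ord0) f x - 'D_(delta_mx j ord0) f c| <= e'.
    apply: (@filter_forall _ _ (fun j x => `|'D_(delta_mx j ord0) f x -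
      'D_(delta_mx j ord0) f c| <= e') (nbhs c)) => j.
    have /cvgrPdist_le/(_ _ e'0) := cd j.
    by apply: filterS => x; rewrite distrC.
  by apply: filterS2 fd => x h1 h2 j; split; [exact: h1|exact: h2].
move=> /nbhs_ballP[r /= r0 cr].
have P := partials_increment (fun x j h => cr x h j) (ballxx c r0).
near=> h.
have h0 : h != 0 by near: h; exact: nbhs_dnbhs_neq.
have bh : ball c r (c + h *: v).
  rewrite mx_norm_ball /ball_/= opprD addrA subrr sub0r normrN normrZ.
  have hd : `|h| < r / (1 + `|v|).
    near: h; apply: (@dnbhs0_lt R R); by rewrite divr_gt0// ltr_pwDl.
  apply: (@le_lt_trans _ _ (`|h| * (1 + `|v|))); first by rewrite ler_wpM2l// ler_wpDl.
  by rewrite -ltr_pdivlMr// ltr_pwDl.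
have := P _ bh; rewrite /= (addrC c) => {}P.
have {}P : `|f (h *: v + c) - f c - h * L| <= e' * (`|h| * s).
  have -> : h * L =
      \sum_j 'D_(delta_mx j ord0) f c * ((h *: v + c) j ord0 - c j ord0).
    by rewrite mulr_sumr; apply: eq_bigr => j _; rewrite !mxE addrK mulrCA.
  suff -> : `|h| * s = \sum_j `|(h *: v + c) j ord0 - c j ord0| by [].
  by rewrite mulr_sumr; apply: eq_bigr => j _; rewrite !mxE addrK normrM.
rewrite -(ler_pM2l (_ : 0 < `|h|)) ?normr_gt0// -normrM mulrBr distrC.
rewrite [h * (_ *: _)]mulrA divff// mul1r; apply: (le_trans P).
rewrite mulrCA ler_wpM2l// /e' mulrAC ler_pdivrMr// ler_wpM2l ?(ltW e0)//.
by rewrite ler_wpDl.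
Unshelve. all: by end_near.
Qed.

(** Apply the mean value theorem on [0, 1] to [k t = f (y + t x) + f (y - t x) - Q t^2]. Its
    derivative compares first partials at two points [2 t x] apart, which [partials_increment]
    controls; the tolerance [e / 2] on the second partials compensates this factor 2. The bound is
    uniform in the centre [y], and no symmetry of mixed partials is required. *)
Lemma second_difference f (U : set 'cV[R]_q) c (e : R) :
  open U -> U c -> Ck_on U 2 f -> 0 < e ->
  exists2 r, 0 < r & forall y x, `|y - c| < r -> `|x| < r ->
    `|f (y + x) + f (y - x) - 2 * f y -
      \sum_j (\sum_i pderiv f [:: i; j] c * x i ord0) * x j ord0|
    <= e * (\sum_j `|x j ord0|) ^+ 2.
Proof.
move=> oU Uc Cf e0.
have e20 : 0 < e / 2 by rewrite divr_gt0.
have : \forall x \near c, U x /\ forall ij : 'I_q * 'I_q,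
    `|pderiv f [:: ij.1; ij.2] x - pderiv f [:: ij.1; ij.2] c| <= e / 2.
  apply: filterI; first exact: open_nbhs_nbhs.
  apply: (@filter_forall _ _ (fun (ij : 'I_q * 'I_q) x =>
    `|pderiv f [:: ij.1; ij.2] x - pderiv f [:: ij.1; ij.2] c| <= e / 2) (nbhs c)) => -[i j] /=.
  have [/(_ isT)/cvgrPdist_le/(_ _ e20) h _] := Cf [:: i; j] c Uc.
  by near=> x; rewrite distrC; near: x.
move=> /nbhs_ballP[r /= r0 cr].
exists (r / 2); first by rewrite divr_gt0.
move=> y x yc xr.
have inb z (t : R) : `|z| = `|x| -> `|t| <= 1 -> ball c r (y + t *: z).
  move=> zx t1; rewrite mx_norm_ball /ball_/= opprD addrA.
  apply: (le_lt_trans (ler_normD _ _)); rewrite normrN normrZ zx.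
  rewrite (_ : r = r / 2 + r / 2); last by lra.
  rewrite distrC ltrD//; apply: le_lt_trans xr.
  by rewrite ler_piMl.
have dU x' j : U x' -> derivable f x' (delta_mx j ord0).
  by move=> Ux; exact: ((Cf [::] x' Ux).2 isT j).
have dl z (t : R) : `|z| = `|x| -> `|t| <= 1 ->
    is_derive t 1 (fun s : R => f (y + s *: z))
      (\sum_j pderiv f [:: j] (y + t *: z) * z j ord0).
  move=> zx t1.
  suff D : is_derive (y + t *: z) z f
      (\sum_j pderiv f [:: j] (y + t *: z) * z j ord0).
    by rewrite -[X in is_derive _ _ _ X](@derive_val _ _ _ _ _ _ _ D);
      apply: is_derive_line; exact: ex_derive.
  apply: is_derive_partials.
    have : nbhs (y + t *: z) U.
      by apply: open_nbhs_nbhs; split => //; exact: (cr _ (inb _ _ zx t1)).1.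
    by apply: filterS => x' Ux j; exact: dU.
  move=> j; exact: ((Cf [:: j] _ (cr _ (inb _ _ zx t1)).1).1 isT).
pose Q := \sum_j (\sum_i pderiv f [:: i; j] c * x i ord0) * x j ord0.
pose N := \sum_j `|x j ord0|.
pose k (t : R) := f (y + t *: x) + f (y + t *: (- x)) - Q * t ^+ 2.
pose dk (t : R) := \sum_j pderiv f [:: j] (y + t *: x) * x j ord0
   + \sum_j pderiv f [:: j] (y + t *: (- x)) * (- x) j ord0 - Q * (2 * t).
have kd (t : R) : `|t| <= 1 -> is_derive t 1 k (dk t).
  move=> t1; have d1 := dl x t erefl t1; have d2 := dl _ t (normrN x) t1.
  have d3 : is_derive t 1 (fun s : R => Q * s ^+ 2) (Q * (2 * t)).
    apply: is_derive_eq; rewrite /GRing.scale/=; ring.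
  exact: is_deriveB.
have kb (t : R) : 0 <= t <= 1 -> `|dk t| <= e * N ^+ 2.
  move=> /andP[t0 t1]; have tn : `|t| <= 1 by rewrite ger0_norm.
  have -> : dk t = \sum_j (pderiv f [:: j] (y + t *: x) -
     pderiv f [:: j] (y + t *: (- x)) - \sum_i pderiv f [:: i; j] c *
      ((y + t *: x) i ord0 - (y + t *: (- x)) i ord0)) * x j ord0.
    rewrite /dk /Q mulr_suml -big_split/= -sumrB; apply: eq_bigr => j _.
    rewrite mxE mulrN -mulrBl [X in _ - X = _]mulrAC -mulrBl; congr ((_ - _) * _).
    by rewrite mulr_suml; apply: eq_bigr => i _; rewrite !mxE; lra.
  apply: (le_trans (ler_norm_sum _ _ _)).
  rewrite expr2 mulrA [leRHS]mulr_sumr; apply: ler_sum => j _.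
  rewrite normrM ler_wpM2r//.
  apply: (@le_trans _ _ (e / 2 * \sum_i
      `|(y + t *: x) i ord0 - (y + t *: (- x)) i ord0|)).
    apply: (partials_increment (c := c) (r := r)).
    - move=> x' i bx; have [Ux h] := cr _ bx; split; last exact: (h (i, j)).
      exact: ((Cf [:: j] x' Ux).2 isT i).
    - by apply: inb; rewrite ?normrN.
    - exact: inb.
  rewrite -mulrA ler_wpM2l ?(ltW e0)// /N !mulr_sumr; apply: ler_sum => i _.
  rewrite !mxE (_ : _ - _ = 2 * (t * x i ord0)); last by lra.
  by rewrite !normrM (ger0_norm t0) ger0_norm// mulKf// ler_piMl.
have t01 (t : R) : t \in `[0, 1] -> `|t| <= 1.
  by rewrite in_itv/= => /andP[t0 t1]; rewrite ger0_norm.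
have kc : {within `[0, 1], continuous k}.
  by apply: derivable_within_continuous => t /t01/kd dt; exact: ex_derive.
have [c' c'01] := @MVT_segment R k dk 0 1 ler01
  (fun t td => kd t (t01 _ (subset_itv_oo_cc td))) kc.
rewrite subr0 mulr1 /k !scale1r !scale0r addr0 expr1n mulr1 expr0n mulr0 subr0.
move=> E; rewrite (_ : _ - _ = dk c'); last by rewrite -E -/Q; lra.
by apply: kb; move: c'01; rewrite in_itv.
Unshelve. all: by end_near.
Qed.

End second_difference.

Section compact_column.
Context {R : realType}.

Lemma mx_norm_le {m n} (x : 'M[R]_(m, n)) (e : R) : 0 <= e ->
  (forall i j, `|x i j| <= e) -> `|x| <= e.
Proof.
move=> e0 h; rewrite [leLHS]/Num.norm /= mx_normrE.
by apply/bigmax_le => // -[i j] _; exact: h.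
Qed.

Lemma norm_trmx {m n} (x : 'M[R]_(m, n)) : `|x^T| = `|x|.
Proof.
apply/eqP; rewrite eq_le; apply/andP; split; apply: mx_norm_le => // i j.
  by rewrite mxE; exact: norm_mx_entry.
by rewrite (_ : x i j = x^T j i) ?mxE//; have := norm_mx_entry x^T j i; rewrite mxE.
Qed.

Lemma continuous_trmx {m n} : continuous (@trmx R m n).
Proof.
move=> x; apply/(@cvgrPdist_le R 'M[R]_(n, m) _ (nbhs x)) => e e0.
apply/nbhs_ballP; exists e => // y; rewrite mx_norm_ball /ball_/= => xy.
by rewrite -linearB/= norm_trmx ltW.
Qed.

Lemma bounded_closed_compact_col {n} (A : set 'cV[R]_n) :
  bounded_set A -> closed A -> compact A.
Proof.
move=> [M [Mr bA]] cA.
have -> : A = trmx @` [set w : 'rV[R]_n | A w^T].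
  apply/seteqP; split => [x Ax|x [w /= Aw <-//]].
  by exists x^T; rewrite /= trmxK.
apply: continuous_compact; first exact/continuous_subspaceT/continuous_trmx.
apply: bounded_closed_compact.
  by exists M; split=> // e /bA h w /= Aw; rewrite -norm_trmx; exact: h.
by apply: preimage_closed => // w _; exact: continuous_trmx.
Qed.

End compact_column.

(** * Uniform concavity of combinations of the [g k] near [t0] *)

Section laplace_maximum.
Context {R : realType} {q K : nat}.
Variables (Theta : set 'cV[R]_q) (g : 'I_K -> 'cV[R]_q -> R).
Implicit Types (x y t : 'cV[R]_q) (u v : 'I_K -> R).

Definition mix u t := \sum_k u k * g k t.

Lemma exists_uniform_radius (I : finType) (P : I -> R -> Prop) :
  (forall i r r', 0 < r' -> r' <= r -> P i r -> P i r') ->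
  (forall i, exists2 r, 0 < r & P i r) -> exists2 r, 0 < r & forall i, P i r.
Proof.
move=> dP /(_ _)/cid2-/all_sig2[r r0 Pr].
exists (\big[Num.min/1]_i r i) => [|i].
  by elim/big_ind : _ => // a b a0 b0; rewrite lt_min a0.
apply: dP (Pr i); last exact: bigmin_le_cond.
by elim/big_ind : _ => // a b a0 b0; rewrite lt_min a0.
Qed.

Lemma second_difference_norm (f : 'cV[R]_q -> R) (c : 'cV[R]_q) (e : R) :
  open Theta -> Theta c -> Ck_on Theta 2 f -> 0 < e ->
  exists2 r, 0 < r & forall y x, `|y - c| < r -> `|x| < r ->
    `|f (y + x) + f (y - x) - 2 * f y -
      \sum_j (\sum_i pderiv f [:: i; j] c * x i ord0) * x j ord0|
    <= e * `|x| ^+ 2.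
Proof.
(* The sum of the entries is at most [q] times the maximum norm; the added 1 keeps the divisor
   positive when [q = 0]. *)
move=> oT Tc Cf e0; have q0 : 0 < q%:R ^+ 2 + 1 :> R by rewrite ltr_wpDl// sqr_ge0.
have [r r0 H] := second_difference oT Tc Cf (divr_gt0 e0 q0).
exists r => // y x yc xr; apply: (le_trans (H _ _ yc xr)).
have : (\sum_j `|x j ord0|) <= q%:R * `|x|.
  rewrite mulr_natl -[X in _ *+ X]card_ord -sumr_const; apply: ler_sum => j _.
  exact: norm_mx_entry.
move=> h; rewrite mulrAC ler_pdivrMr// -mulrA ler_wpM2l ?(ltW e0)//.
apply: (@le_trans _ _ ((q%:R * `|x|) ^+ 2)).
  by rewrite ler_sqr// nnegrE ?sumr_ge0// mulr_ge0.
by rewrite exprMn mulrDr mulr1 mulrC lerDl sqr_ge0.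
Qed.

Lemma mix_near u v (G delta : R) t : (forall k, `|g k t| <= G) ->
  (forall k, `|u k - v k| <= delta) -> `|mix u t - mix v t| <= delta * (K%:R * G).
Proof.
move=> gG uv; rewrite /mix -sumrB; apply: (le_trans (ler_norm_sum _ _ _)).
rewrite mulrCA mulr_natl -[X in _ *+ X]card_ord -sumr_const; apply: ler_sum => k _.
by rewrite -mulrBl normrM ler_pM.
Qed.

Hypotheses (oT : open Theta) (bT : bounded_set Theta).
Hypotheses (gC2 : forall k, Ck_on Theta 2 (g k))
  (gC : forall k, {within closure Theta, continuous (g k)}).

Lemma closure_compact : compact (closure Theta).
Proof.
apply: bounded_closed_compact_col; last exact: closed_closure.
have [M [Mr bM]] := bT; exists M; split => // e Me t clt.
have d0 : 0 < (e - M) / 2 by rewrite divr_gt0// subr_gt0.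
have [s [Ts bs]] := clt _ (nbhsx_ballx t _ d0).
have := bM ((e + M) / 2) _ s Ts; rewrite mx_norm_ball /ball_/= in bs.
move=> /(_ _)/= h; rewrite -[t](subrK s); apply: (le_trans (ler_normD _ _)).
have {}h : `|s| <= (e + M) / 2 by apply: h; lra.
lra.
Qed.

Lemma closure_bounded : exists G, forall k t, closure Theta t -> `|g k t| <= G.
Proof.
have cpt := closure_compact.
have H (k : 'I_K) : exists G, forall t, closure Theta t -> `|g k t| <= G.
  have [M [_ /(_ (M + 1))]] := compact_bounded (continuous_compact (@gC k) cpt).
  move=> h; exists (M + 1) => t ct; apply: h; first by rewrite ltrDl.
  by exists t.
have {H}[G HG] := choice H; exists (\big[Num.max/0]_k G k) => k t ct.
by apply: (le_trans (HG k t ct)); exact: le_bigmax.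
Qed.

Variables (v : 'I_K -> R) (t0 : 'cV[R]_q) (chi : R).
Hypotheses (T0 : Theta t0) (chi0 : 0 < chi)
  (ident : forall t, Theta t -> mix v t - mix v t0 <= - chi * `|t - t0| ^+ 2).

Let dif (f : 'cV[R]_q -> R) y x := f (y + x) + f (y - x) - 2 * f y.

Let dif_mix u y x : dif (mix u) y x = \sum_k u k * dif (g k) y x.
Proof.
rewrite /dif /mix mulr_sumr -big_split/= -sumrB; apply: eq_bigr => k _; lra.
Qed.

(** At [t0] itself, [ident] at both points [t0 + x] and [t0 - x] gives a second difference of at
    most [- 2 chi |x|^2]. Moving the centre from [t0] to [y] costs at most [chi |x|^2], and
    replacing [v] by [u] at most [chi / 2 |x|^2]; what remains is [- chi / 2 |x|^2]. *)
Lemma mix_second_difference : exists2 r, 0 < r & exists2 delta, 0 < delta &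
  exists2 C, 0 <= C & forall u, (forall k, `|u k - v k| <= delta) ->
  forall y x, `|y - t0| < r -> `|x| < r ->
  - C * `|x| ^+ 2 <= dif (mix u) y x <= - (chi / 2) * `|x| ^+ 2.
Proof.
pose a k i j := pderiv (g k) [:: i; j] t0.
pose Q k x := \sum_j (\sum_i a k i j * x i ord0) * x j ord0.
pose V := \sum_k `|v k|.
have V0 : 0 <= V by exact: sumr_ge0.
(* Chosen so that [2 * e * V <= chi]: both [dif (g k) y x] and [dif (g k) t0 x] lie within [e |x|^2]
   of the same quadratic form. *)
pose e := chi / (2 * V + 1).
have e0 : 0 < e by rewrite divr_gt0// ltr_wpDl// mulr_ge0.
have [r r0 Hr] : exists2 r, 0 < r & forall k, forall y x, `|y - t0| < r -> `|x| < r ->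
    `|dif (g k) y x - Q k x| <= e * `|x| ^+ 2.
  apply: exists_uniform_radius => [k r r' r'0 rr' H y x yr xr|k].
    by apply: H; exact: lt_le_trans rr'.
  exact: second_difference_norm.
have [r1 /= r10 r1T] : exists2 r1, 0 < r1 & ball t0 r1 `<=` Theta.
  by apply/nbhs_ballP; exact: open_nbhs_nbhs.
pose A := \sum_k (\sum_j \sum_i `|a k i j| + e).
have A0 k : 0 <= \sum_j \sum_i `|a k i j| + e.
  by rewrite addr_ge0 ?(ltW e0)//; apply: sumr_ge0 => j _; exact: sumr_ge0.
have QA k x : `|Q k x| <= (\sum_j \sum_i `|a k i j|) * `|x| ^+ 2.
  rewrite mulr_suml; apply: (le_trans (ler_norm_sum _ _ _)); apply: ler_sum => j _.
  rewrite !mulr_suml; apply: (le_trans (ler_norm_sum _ _ _)); apply: ler_sum => i _.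
  rewrite -mulrA !normrM ler_wpM2l// expr2 ler_pM//; exact: norm_mx_entry.
have difA k y x : `|y - t0| < r -> `|x| < r ->
    `|dif (g k) y x| <= A * `|x| ^+ 2.
  move=> yr xr; apply: (@le_trans _ _ ((\sum_j \sum_i `|a k i j| + e) * `|x| ^+ 2)).
    rewrite mulrDl -[dif _ _ _](subrK (Q k x)) addrC.
    by apply: (le_trans (ler_normD _ _)); rewrite lerD//; exact: Hr.
  rewrite ler_wpM2r ?sqr_ge0// /A (bigD1 k)//= lerDl; exact: sumr_ge0.
pose rr := Num.min r r1.
exists rr; first by rewrite lt_min r0.
have A1 : 0 <= A by exact: sumr_ge0.
(* Chosen so that [K] changes of coefficients, each weighted by at most [A |x|^2], cost at most
   [chi / 2 |x|^2]. *)
pose delta := chi / 2 / (K%:R * A + 1).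
have d0 : 0 < delta by rewrite !divr_gt0// ltr_wpDl// mulr_ge0.
exists delta => //; exists (\sum_k (`|v k| + delta) * A).
  by apply: sumr_ge0 => k _; rewrite mulr_ge0 ?addr_ge0 ?(ltW d0).
move=> u uv y x; rewrite !lt_min => /andP[yr yr1] /andP[xr xr1].
apply/andP; split.
  have : `|dif (mix u) y x| <= (\sum_k (`|v k| + delta) * A) * `|x| ^+ 2.
    rewrite dif_mix mulr_suml; apply: (le_trans (ler_norm_sum _ _ _)).
    apply: ler_sum => k _; rewrite normrM -mulrA ler_pM//; last exact: difA.
    by rewrite -[u k](subrK (v k)) addrC (le_trans (ler_normD _ _))// lerD.
  by rewrite ler_norml mulNr => /andP[].
have difv : dif (mix v) y x <= - chi * `|x| ^+ 2.
  have z0 : `|t0 - t0| < r by rewrite subrr normr0.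
  have : dif (mix v) t0 x <= - chi * `|x| ^+ 2 + - chi * `|x| ^+ 2.
    have h1 : Theta (t0 + x).
      by apply: r1T; rewrite mx_norm_ball /ball_/= opprD addrA subrr sub0r normrN.
    have h2 : Theta (t0 - x).
      by apply: r1T; rewrite mx_norm_ball /ball_/= opprB addrCA subrr addr0.
    have := ident h1; have := ident h2.
    rewrite addrAC subrr sub0r normrN (addrAC t0) subrr add0r /dif; lra.
  suff : `|dif (mix v) y x - dif (mix v) t0 x| <= chi * `|x| ^+ 2.
    rewrite ler_norml => /andP[_]; lra.
  rewrite !dif_mix -sumrB; apply: (le_trans (ler_norm_sum _ _ _)).
  apply: (@le_trans _ _ (\sum_k `|v k| * (2 * e * `|x| ^+ 2))).
    apply: ler_sum => k _; rewrite -mulrBr normrM ler_wpM2l//.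
    rewrite (_ : _ - _ = (dif (g k) y x - Q k x) - (dif (g k) t0 x - Q k x)); last by lra.
    apply: (le_trans (ler_normB _ _)).
    by have := Hr k _ _ yr xr; have := Hr k _ _ z0 xr; lra.
  have Ve : V * (2 * e) <= chi.
    rewrite mulrA mulrA ler_pdivrMr ?ltr_wpDl ?mulr_ge0//.
    by rewrite mulrC ler_wpM2l ?(ltW chi0)// mulrC lerDl.
  rewrite -mulr_suml [leLHS](_ : _ = V * (2 * e) * `|x| ^+ 2); last by rewrite !mulrA.
  by apply: ler_wpM2r; rewrite ?sqr_ge0.
have : `|dif (mix u) y x - dif (mix v) y x| <= chi / 2 * `|x| ^+ 2.
  rewrite !dif_mix -sumrB; apply: (le_trans (ler_norm_sum _ _ _)).
  apply: (@le_trans _ _ (\sum_(k < K) delta * (A * `|x| ^+ 2))).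
    by apply: ler_sum => k _; rewrite -mulrBl normrM ler_pM//; exact: difA.
  have KA : delta * (K%:R * A) <= chi / 2.
    rewrite /delta mulrAC ler_pdivrMr ?ltr_wpDl ?mulr_ge0//.
    by rewrite ler_wpM2l ?lerDl// divr_ge0// ltW.
  rewrite [leLHS](_ : _ = delta * (K%:R * A) * `|x| ^+ 2); last first.
    by rewrite sumr_const card_ord -[LHS]mulr_natl; ring.
  by apply: ler_wpM2r; first exact: sqr_ge0.
rewrite ler_norml => /andP[_]; lra.
Qed.

End laplace_maximum.

Lemma cvg_sumr {R : numFieldType} {T I : Type} (r : seq I) (F : set_system T)
    (f : I -> T -> R) (l : I -> R) : Filter F ->
  (forall i, f i @ F --> l i) ->
  (fun x => \sum_(i <- r) f i x) @ F --> \sum_(i <- r) l i.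
Proof.
move=> FF fl; elim: r => [|i r IH].
  by under eq_fun do rewrite big_nil; rewrite big_nil; exact: cvg_cst.
by under eq_fun do rewrite big_cons; rewrite big_cons; exact: cvgD.
Qed.

Section laplace_quadratic.
Context {R : realType} {q K : nat}.
Variables (Theta : set 'cV[R]_q) (g : 'I_K -> 'cV[R]_q -> R).
Implicit Types (x y t : 'cV[R]_q).
Hypotheses (oT : open Theta) (bT : bounded_set Theta).
Hypotheses (gC2 : forall k, Ck_on Theta 2 (g k))
  (gC : forall k, {within closure Theta, continuous (g k)}).
Variables (v : 'I_K -> R) (t0 : 'cV[R]_q) (chi : R).
Hypotheses (T0 : Theta t0) (chi0 : 0 < chi)
  (ident : forall t, Theta t -> mix g v t - mix g v t0 <= - chi * `|t - t0| ^+ 2).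

Lemma mix_continuous (u : 'I_K -> R) :
  {within closure Theta, continuous (mix g u)}.
Proof.
apply/subspace_continuousP => x cx.
apply: cvg_sumr => k; apply: cvgM; first exact: cvg_cst.
by have /subspace_continuousP := @gC k; exact.
Qed.

(** [ident] concerns the open set only. A boundary point is approximated by some [s] in [Theta]
    still at distance [r / 2] from [t0]; this gives a gap [chi (r / 2)^2], half of which is spent on
    the continuity error. *)
Lemma closure_separated r t : 0 < r -> closure Theta t -> r <= `|t - t0| ->
  mix g v t - mix g v t0 <= - (chi * r ^+ 2 / 8).
Proof.
move=> r0 ct rt.
have /subspace_continuousP/(_ _ ct)/cvgrPdist_lt := @mix_continuous v.
have e0 : 0 < chi * r ^+ 2 / 8 by rewrite divr_gt0// mulr_gt0// exprn_gt0.
move=> /(_ _ e0); rewrite near_withinE => nt.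
have r20 : 0 < r / 2 by rewrite divr_gt0.
have [s [Ts []]] := ct _ (filterI nt (nbhsx_ballx t _ r20)).
move=> /(_ (subset_closure Ts)); rewrite mx_norm_ball /ball_/= => ms ts.
have st0 : r / 2 <= `|s - t0|.
  have : `|t - t0| <= `|t - s| + `|s - t0|.
    by apply: le_trans (ler_normD _ _); rewrite addrA subrK.
  lra.
have : chi * (r / 2) ^+ 2 <= chi * `|s - t0| ^+ 2.
  rewrite ler_wpM2l ?(ltW chi0)//.
  by rewrite ler_sqr// nnegrE// ltW.
have -> : chi * (r / 2) ^+ 2 = 2 * (chi * r ^+ 2 / 8) by field.
have := ident Ts; move: ms; rewrite ltr_norml => /andP[_ ms].
have {}ms : mix g v t - mix g v s < chi * r ^+ 2 / 8 := ms.
lra.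
Qed.

(* Strong concavity at the maximiser comes from the midpoint of t and th, and the
   lower bound from the symmetric pair th + x, th - x: no derivative at th is needed. *)
Lemma mix_quadratic r0 : 0 < r0 ->
  exists2 r, 0 < r <= r0 & exists2 delta, 0 < delta &
  exists2 c, 0 < c & exists2 C, 0 <= C &
  forall u, (forall k, `|u k - v k| <= delta) ->
  forall th, closure Theta th ->
  (forall t, closure Theta t -> mix g u t <= mix g u th) ->
  [/\ `|th - t0| < r,
      forall t, Theta t -> mix g u t <= mix g u th - c * `|t - th| ^+ 2 &
      forall x, `|x| < r -> Theta (th + x) /\
         mix g u th - C * `|x| ^+ 2 <= mix g u (th + x)].
Proof.
move=> r00.
have [G gG] := closure_bounded bT gC.
have [r1 r10 [d1 d10 [C C0 H]]] := mix_second_difference oT gC2 T0 chi0 ident.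
have [r2 /= r20 r2T] : exists2 r, 0 < r & ball t0 r `<=` Theta.
  by apply/nbhs_ballP; exact: open_nbhs_nbhs.
have [B B0 TB] : exists2 B, 0 < B & forall t, closure Theta t -> `|t| <= B.
  have [M [Mr bM]] := compact_bounded (closure_compact bT).
  exists (`|M| + 1); first by rewrite ltr_wpDl.
  by apply: bM; rewrite ltr_pwDr// ler_norm.
(* The factor 4 leaves room for the midpoint, within [2 r] of [t0], and for a half-difference
   shorter than [3 r / 2]. *)
pose r := Num.min r0 (Num.min r1 r2) / 4.
have rp : 0 < r by rewrite divr_gt0// !lt_min r00 r10.
have rE : 4 * r = Num.min r0 (Num.min r1 r2) by rewrite /r; field.
have : 4 * r <= 4 * r by [].
rewrite {2}rE !le_min => /and3P[rr0 rr1 rr2].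
exists r; first by rewrite rp; lra.
have KG0 : 0 <= K%:R * `|G| by rewrite mulr_ge0.
have chir : 0 < chi * r ^+ 2 by rewrite mulr_gt0// exprn_gt0.
(* Passing between [u] and [v] costs [eta] at each of two points, hence [chi r^2 / 16], less than
   the gap [chi r^2 / 8] of [closure_separated]. So the maximiser cannot be at distance [r] or
   more. *)
pose eta := chi * r ^+ 2 / 32.
have etaE : eta = chi * r ^+ 2 / 32 by [].
have eta0 : 0 < eta by rewrite divr_gt0.
pose d2 := eta / (K%:R * `|G| + 1).
have d20 : 0 < d2 by rewrite divr_gt0// ltr_wpDl.
exists (Num.min d1 d2); first by rewrite lt_min d10.
(* The first bound serves points near [t0], through the midpoint; the second one serves far points,
   where [|t - th| <= 2 B] makes [c |t - th|^2] at most [chi r^2]. *)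
pose c := Num.min (chi / 8) (chi * r ^+ 2 / (4 * B ^+ 2)).
have c0 : 0 < c by rewrite lt_min !divr_gt0// mulr_gt0// exprn_gt0.
exists c => //.
exists C => // u uv th cth thmax.
have uv1 k : `|u k - v k| <= d1 by rewrite (le_trans (uv k))// ge_min lexx.
have uv2 k : `|u k - v k| <= d2 by rewrite (le_trans (uv k))// ge_min lexx orbT.
have ct0 : closure Theta t0 by exact: subset_closure.
have near t : closure Theta t -> `|mix g u t - mix g v t| <= eta.
  move=> ct; have gG' k : `|g k t| <= `|G| by rewrite (le_trans (gG k t ct))// ler_norm.
  apply: (le_trans (mix_near gG' uv2)).
  rewrite /d2 mulrAC ler_pdivrMr ?ltr_wpDl// ler_wpM2l ?(ltW eta0)//.
  by rewrite lerDl.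
have n0 := near _ ct0; have nth := near _ cth.
have th0 : `|th - t0| < r.
  rewrite ltNge; apply/negP => rth.
  have := closure_separated rp cth rth; have := thmax _ ct0.
  move: n0 nth; rewrite !ler_norml => /andP[? ?] /andP[? ?].
  lra.
split => // [t Tt|x xr].
  (* Near [t0] the second difference at the midpoint of [t] and [th] applies, with the maximality of
     [th] bounding the middle value. Farther away [ident] alone gives a drop of [4 chi r^2], more
     than enough. *)
  have [tt0|tt0] := ltP (`|t - t0|) (2 * r).
    pose x := 2^-1 *: (t - th); pose y := th + x.
    have xn : `|x| = `|t - th| / 2.
      by rewrite normrZ ger0_norm ?invr_ge0// mulrC.
    have tth : `|t - th| < 3 * r.
      have : `|t - th| <= `|t - t0| + `|th - t0|.
        by rewrite (distrC th); apply: le_trans (ler_normD _ _); rewrite addrA subrK.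
      lra.
    have yt0 : `|y - t0| < 2 * r.
      have -> : y - t0 = 2^-1 *: ((t - t0) + (th - t0)).
        by apply/matrixP => i j; rewrite !mxE; lra.
      rewrite normrZ ger0_norm ?invr_ge0//.
      have := ler_normD (t - t0) (th - t0).
      by rewrite mulrC ltr_pdivrMr//; lra.
    have yp : y + x = t.
      by apply/matrixP => i j; rewrite !mxE; lra.
    have ym : y - x = th by rewrite /y addrK.
    have Ty : Theta y.
      by apply: r2T; rewrite mx_norm_ball /ball_/= distrC; lra.
    have [||_] := andP (H u uv1 y x _ _); [lra|lra|].
    rewrite yp ym xn; have := thmax _ (subset_closure Ty).
    have : c * `|t - th| ^+ 2 <= chi / 8 * `|t - th| ^+ 2.
      by apply: ler_wpM2r; [exact: sqr_ge0|rewrite ge_min lexx].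
    have -> : chi / 8 * `|t - th| ^+ 2 = chi / 2 * (`|t - th| / 2) ^+ 2 by field.
    lra.
  have : chi * (2 * r) ^+ 2 <= chi * `|t - t0| ^+ 2.
    by rewrite ler_wpM2l ?(ltW chi0)// ler_sqr// nnegrE// mulr_ge0// ltW.
  have -> : chi * (2 * r) ^+ 2 = 4 * (chi * r ^+ 2) by ring.
  have := ident Tt; have := thmax _ ct0.
  have nt := near _ (subset_closure Tt).
  move: n0 nt; rewrite !ler_norml => /andP[? ?] /andP[? ?].
  have : c * `|t - th| ^+ 2 <= chi * r ^+ 2.
    apply: (@le_trans _ _ (chi * r ^+ 2 / (4 * B ^+ 2) * (4 * B ^+ 2))); last first.
      by rewrite divfK// mulf_neq0// expf_neq0// gt_eqF.
    apply: ler_pM; rewrite ?sqr_ge0 ?ge_min ?lexx ?orbT//.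
      exact: ltW.
    have -> : 4 * B ^+ 2 = (B + B) ^+ 2 by ring.
    rewrite ler_sqr ?nnegrE ?addr_ge0 ?(ltW B0)//.
    apply: (le_trans (ler_normB _ _)); apply: lerD; last exact: TB.
    exact/TB/subset_closure.
  lra.
have bx (z : 'cV[R]_q) : `|z| < r -> Theta (th + z).
  move=> zr; apply: r2T; rewrite mx_norm_ball /ball_/= distrC addrAC.
  have := ler_normD (th - t0) z; lra.
split; first exact: bx.
have [||] := andP (H u uv1 th x _ _); [lra|lra|].
have : Theta (th - x) by apply: bx; rewrite normrN.
move=> /subset_closure/thmax; lra.
Qed.

End laplace_quadratic.

(** * Two-sided bounds for the Laplace integral *)

Section laplace_integral.
Context {R : realType} {q K : nat}.
Variables (Theta : set 'cV[R]_q) (g : 'I_K -> 'cV[R]_q -> R).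
Hypotheses (oT : open Theta) (bT : bounded_set Theta).
Hypotheses (gC2 : forall k, Ck_on Theta 2 (g k))
  (gC : forall k, {within closure Theta, continuous (g k)}).
Variables (v : 'I_K -> R) (t0 : 'cV[R]_q) (chi : R).
Hypotheses (T0 : Theta t0) (chi0 : 0 < chi)
  (ident : forall t, Theta t -> mix g v t - mix g v t0 <= - chi * `|t - t0| ^+ 2).
Variable prior : 'cV[R]_q -> R.
Hypotheses (prior_density : prob_density Theta prior)
  (prior_continuous : {within closure Theta, continuous prior})
  (prior_bounded : exists C, forall t, closure Theta t -> `|prior t| <= C)
  (prior0 : 0 < prior t0).

Lemma measurable_mix u : measurable_fun Theta (mix g u).
Proof.
rewrite /mix; apply: measurable_sum => k; apply: measurable_funM => //.
apply: open_continuous_measurable_mx => // t; rewrite inE => Tt.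
exact: ((@gC2 k [::] t Tt).1 isT).
Qed.

Lemma measurable_integrand u (a : R) :
  measurable_fun Theta (fun t => (expR (a * mix g u t) * prior t)%:E).
Proof.
apply/measurable_EFinP; apply: measurable_funM; last by case: prior_density.
apply: measurableT_comp => //; apply: measurable_funM => //.
exact: measurable_mix.
Qed.

Lemma prior_near : exists2 r, 0 < r &
  forall t, `|t - t0| < r -> Theta t /\ prior t0 / 2 <= prior t.
Proof.
have /subspace_continuousP/(_ _ (subset_closure T0))/cvgrPdist_lt := prior_continuous.
have p0 : 0 < prior t0 / 2 by rewrite divr_gt0.
move=> /(_ _ p0); rewrite near_withinE => nt.
have /nbhs_ballP[r /= r0 rT] : \forall t \near t0, Theta t /\
    (closure Theta t -> `|from_subspace (closure Theta) prior t0 -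
      from_subspace (closure Theta) prior t| < prior t0 / 2).
  by apply: filterI => //; exact: open_nbhs_nbhs.
exists r => // t tr.
have [|Tt /(_ (subset_closure Tt)) h] := rT t.
  by rewrite mx_norm_ball /ball_/= distrC.
split => //.
have {}h : `|prior t0 - prior t| < prior t0 / 2 := h.
by move: h; rewrite ltr_norml => /andP[_]; lra.
Qed.

(** The lower bound keeps only the cube of half-side [1 / sqrt n] around [th], where the exponent
    drops by at most [C]; the upper bound integrates the dominating Gaussian over the whole space.
    The threshold on [n] depends neither on [u] nor on [th], as needed for random coefficients. *)
Lemma laplace_integral_bounds : exists2 delta, 0 < delta & exists k1 k2 : R, [/\ 0 < k1, 0 < k2 &
  \forall n \near \oo, forall u, (forall k, `|u k - v k| <= delta) ->
  forall th, closure Theta th ->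
  (forall t, closure Theta t -> mix g u t <= mix g u th) ->
  ((k1 * expR (n%:R * mix g u th) / Num.sqrt n%:R ^+ q)%:E <=
    \int[lebesgue_col q]_(t in Theta) (expR (n%:R * mix g u t) * prior t)%:E
   <= (k2 * expR (n%:R * mix g u th) / Num.sqrt n%:R ^+ q)%:E)%E].
Proof.
have [r' r'0 pr] := prior_near.
have r'20 : 0 < r' / 2 by rewrite divr_gt0.
have [r /andP[r0 rr'] [delta delta0 [c c0 [C C0 H]]]] :=
  mix_quadratic oT bT gC2 gC T0 chi0 ident r'20.
have [Cp Cp0 pCp] : exists2 Cp, 0 < Cp & forall t, Theta t -> prior t <= Cp.
  have [Cp h] := prior_bounded; exists (`|Cp| + 1); first by rewrite ltr_wpDl.
  move=> t /subset_closure/h; rewrite ler_norml => /andP[_] /le_trans; apply.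
  by rewrite (le_trans (ler_norm _))// lerDl.
have p_ge0 t : Theta t -> 0 <= prior t by case: prior_density => _ h _; exact: h.
exists delta => //.
(* Lower bound of the prior near [t0], worst loss of the exponent, and the volume [(2 / sqrt n) ^ q]
   of the cube up to its power of [n]. *)
exists (prior t0 / 2 * expR (- C) * 2 ^+ q).
exists (Cp * Num.sqrt (pi * q.+1%:R / c) ^+ q).
split.
- by rewrite !mulr_gt0 ?expR_gt0 ?exprn_gt0 ?divr_gt0.
- by rewrite mulr_gt0// exprn_gt0// sqrtr_gt0 divr_gt0// mulr_gt0// pi_gt0.
near=> n => u uv th cth thmax.
have n0 : 0 < n%:R :> R by rewrite ltr0n; near: n; exact: nbhs_infty_gt.
have sn0 : 0 < Num.sqrt n%:R :> R by rewrite sqrtr_gt0.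
have mTheta := open_measurable_mx oT.
have [th0 up lo] := H u uv th cth thmax.
set m := mix g u th.
apply/andP; split.
  pose s := (Num.sqrt n%:R)^-1 : R.
  have s0 : 0 < s by rewrite invr_gt0.
  have sr : s < r.
    rewrite /s -[ltRHS]invrK ltf_pV2 ?posrE ?invr_gt0//.
    rewrite -(ger0_norm (ltW (_ : 0 < r^-1))) ?invr_gt0// -sqrtr_sqr ltr_sqrt//.
    near: n; exact: nbhs_infty_gtr.
  have s2 : s ^+ 2 = n%:R^-1 by rewrite exprVn sqr_sqrtr// ltW.
  have -> : (prior t0 / 2 * expR (- C) * 2 ^+ q * expR (n%:R * m) / Num.sqrt n%:R ^+ q)%:E
      = (\int[lebesgue_col q]_(t in ball th s) (expR (n%:R * m - C) * (prior t0 / 2))%:E)%E.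
    rewrite integral_cst; last by apply: open_measurable_mx; exact: ball_open.
    rewrite [X in (_ * X)%E](_ : _ = ((2 * s) ^+ q)%:E); last exact: lebesgue_col_ball.
    rewrite -EFinM; congr EFin.
    rewrite expRD exprMn exprVn; ring.
  have bT' t : ball th s t -> Theta t /\ prior t0 / 2 <= prior t /\
      m - C * s ^+ 2 <= mix g u t.
    rewrite mx_norm_ball /ball_/= distrC => ts.
    have [] := lo (t - th) (lt_trans ts sr); rewrite addrC subrK => Tt h.
    have [] := pr t _.
      have := ler_normD (t - th) (th - t0); rewrite addrA subrK; lra.
    split => //; split => //; apply: le_trans h; rewrite lerD2l lerN2.
    by rewrite ler_wpM2l// ler_sqr ?nnegrE ?(ltW s0)// ltW.
  apply: (@le_trans _ _ (\int[lebesgue_col q]_(t in ball th s)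
      (expR (n%:R * mix g u t) * prior t)%:E)%E).
    apply: ge0_le_integral => //.
    - by apply: open_measurable_mx; exact: ball_open.
    - by move=> t _; rewrite lee_fin mulr_ge0 ?expR_ge0// divr_ge0// ltW.
    - apply: measurable_funS (measurable_integrand u n%:R) => // t /bT'[].
      by [].
    - move=> t /bT'[Tt [pt mt]]; rewrite lee_fin ler_pM ?expR_ge0 ?divr_ge0 ?(ltW prior0)//.
      rewrite ler_expR; have := ler_wpM2l (ltW n0) mt; rewrite s2.
      by rewrite mulrBr mulrCA divff ?gt_eqF// mulr1.
  apply: ge0_subset_integral => //.
  - by apply: open_measurable_mx; exact: ball_open.
  - exact: measurable_integrand.
  - by move=> t /p_ge0 ?; rewrite lee_fin mulr_ge0 ?expR_ge0.
  - by move=> t /bT'[].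
(* The quadratic bound is in the maximum norm while the Gaussian integral factorises in the
   Euclidean one, and the sum of squares is at most [q] times the squared maximum norm. Using [q.+1]
   keeps the divisor positive when [q = 0]. *)
have a0 : 0 < n%:R * c / q.+1%:R by rewrite divr_gt0// mulr_gt0.
pose h (t : 'cV[R]_q) := (expR (- (n%:R * c / q.+1%:R * \sum_i (t i ord0 - th i ord0) ^+ 2)))%:E.
have mh : measurable_fun setT h.
  apply/measurable_EFinP; apply: measurableT_comp => //.
  apply: measurableT_comp => //; apply: measurable_funM => //.
  apply: measurable_sum => i; apply: measurable_funX; apply: measurable_funB => //.
  exact: measurable_mx_entry.
have E : (\int[lebesgue_col q]_t ((Cp * expR (n%:R * m))%:E * h t) =
   (Cp * Num.sqrt (pi * q.+1%:R / c) ^+ q * expR (n%:R * m) / Num.sqrt n%:R ^+ q)%:E)%E.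
  rewrite ge0_integralZl//; last first.
  - by rewrite lee_fin mulr_ge0 ?expR_ge0// ltW.
  - by move=> t _; rewrite lee_fin expR_ge0.
  rewrite integral_gauss_col// -EFinM; congr EFin.
  have -> : pi / (n%:R * c / q.+1%:R) = pi * q.+1%:R / c / n%:R.
    by field; rewrite ?gt_eqF//=.
  rewrite sqrtrM; last by rewrite divr_ge0 ?mulr_ge0 ?pi_ge0// ltW.
  rewrite sqrtrV; last exact: ltW.
  rewrite exprMn exprVn; ring.
rewrite -E.
apply: (@le_trans _ _ (\int[lebesgue_col q]_(t in Theta) ((Cp * expR (n%:R * m))%:E * h t))%E).
  apply: ge0_le_integral => //.
  - by move=> t /p_ge0 ?; rewrite lee_fin mulr_ge0 ?expR_ge0.
  - exact: measurable_integrand.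
  - by apply: measurable_funTS; exact: measurable_funeM.
  - move=> t Tt; rewrite /h -EFinM lee_fin -[leRHS]mulrA -expRD [leLHS]mulrC.
    apply: ler_pM; rewrite ?p_ge0 ?pCp ?expR_ge0 ?ler_expR//.
    have sq : \sum_i (t i ord0 - th i ord0) ^+ 2 <= q.+1%:R * `|t - th| ^+ 2.
      apply: (@le_trans _ _ (\sum_(i < q) `|t - th| ^+ 2)).
        apply: ler_sum => i _; rewrite -real_normK ?num_real//.
        rewrite ler_sqr ?nnegrE//; have := norm_mx_entry (t - th) i ord0.
        by rewrite !mxE.
      rewrite sumr_const card_ord -[leLHS]mulr_natl; apply: ler_wpM2r.
        exact: sqr_ge0.
      by rewrite ler_nat.
    have : n%:R * c / q.+1%:R * \sum_i (t i ord0 - th i ord0) ^+ 2 <=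
        n%:R * (c * `|t - th| ^+ 2).
      apply: (le_trans (ler_wpM2l (ltW a0) sq)).
      by rewrite [leLHS]mulrA divfK ?gt_eqF// [leRHS]mulrA.
    have := ler_wpM2l (ltW n0) (up t Tt); rewrite -/m [leRHS]mulrBr => /le_trans + h2; apply.
    by rewrite lerD2l lerN2.
apply: ge0_subset_integral => //.
- exact: measurable_funeM.
- by move=> t _; rewrite -EFinM lee_fin mulr_ge0 ?mulr_ge0 ?expR_ge0// ltW.
Unshelve. all: by end_near.
Qed.

End laplace_integral.

Section laplace_expansion.
Context {R : realType} {q K : nat}.
Variables (Theta : set 'cV[R]_q) (g : 'I_K -> 'cV[R]_q -> R).
Hypotheses (oT : open Theta) (bT : bounded_set Theta).
Hypotheses (gC2 : forall k, Ck_on Theta 2 (g k))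
  (gC : forall k, {within closure Theta, continuous (g k)}).
Variables (v : 'I_K -> R) (t0 : 'cV[R]_q) (chi : R).
Hypotheses (T0 : Theta t0) (chi0 : 0 < chi)
  (ident : forall t, Theta t -> mix g v t - mix g v t0 <= - chi * `|t - t0| ^+ 2).
Variable prior : 'cV[R]_q -> R.
Hypotheses (prior_density : prob_density Theta prior)
  (prior_continuous : {within closure Theta, continuous prior})
  (prior_bounded : exists C, forall t, closure Theta t -> `|prior t| <= C)
  (prior0 : 0 < prior t0).

(** Logarithms of the two bounds: [sqrt n ^ q] contributes [q / 2 * ln n], and the constants [k1],
    [k2] do not depend on [n], so they become O(1/n) after division. *)
Lemma laplace_expansion : exists2 delta, 0 < delta & exists2 M : R, 0 < M &
  \forall n \near \oo, forall u, (forall k, `|u k - v k| <= delta) ->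
  forall th, closure Theta th ->
  (forall t, closure Theta t -> mix g u t <= mix g u th) ->
  `|n%:R^-1 * ln (\int[lebesgue_col q]_(t in Theta)
        (expR (n%:R * mix g u t) * prior t))
    - (n%:R^-1 * (n%:R * mix g u th) - q%:R / (2 * n%:R) * ln n%:R)|
  <= M * n%:R^-1.
Proof.
have [delta delta0 [k1 [k2 [k10 k20 H]]]] := laplace_integral_bounds oT bT gC2 gC
  T0 chi0 ident prior_density prior_continuous prior_bounded prior0.
exists delta => //; exists (`|ln k1| + `|ln k2| + 1); first by rewrite ltr_wpDl// addr_ge0.
near=> n => u uv th cth thmax.
have n0 : 0 < n%:R :> R by rewrite ltr0n; near: n; exact: nbhs_infty_gt.
have : forall u, (forall k, `|u k - v k| <= delta) ->
  forall th, closure Theta th ->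
  (forall t, closure Theta t -> mix g u t <= mix g u th) ->
  ((k1 * expR (n%:R * mix g u th) / Num.sqrt n%:R ^+ q)%:E <=
    \int[lebesgue_col q]_(t in Theta) (expR (n%:R * mix g u t) * prior t)%:E
   <= (k2 * expR (n%:R * mix g u th) / Num.sqrt n%:R ^+ q)%:E)%E by near: n.
move=> /(_ u uv th cth thmax) /andP[]; rewrite /Rintegral.
set m := mix g u th.
(* [Rintegral] is the finite part of an extended integral, with a default value at infinity; the two
   bounds exclude both infinite values. *)
case: (\int[_]_(_ in _) _)%E => [I||]; rewrite ?leeNy_eq//= !lee_fin => lo hi.
have s0 : 0 < Num.sqrt n%:R :> R by rewrite sqrtr_gt0.
have lk k : 0 < k -> 0 < k * expR (n%:R * m) / Num.sqrt n%:R ^+ q /\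
    ln (k * expR (n%:R * m) / Num.sqrt n%:R ^+ q) =
    ln k + n%:R * m - q%:R / 2 * ln n%:R.
  move=> k0; split; first by rewrite divr_gt0 ?mulr_gt0 ?expR_gt0 ?exprn_gt0.
  rewrite ln_div ?posrE ?mulr_gt0 ?expR_gt0 ?exprn_gt0// lnM ?posrE ?expR_gt0//.
  rewrite expRK lnXn//; congr (_ - _).
  rewrite -{2}(@sqr_sqrtr _ n%:R) ?(ltW n0)// lnXn// -[LHS]mulr_natl -[ln _ *+ 2]mulr_natl.
  by field.
have [e1 l1] := lk _ k10; have [e2 l2] := lk _ k20.
have I0 : 0 < I by exact: lt_le_trans lo.
have : ln k1 + n%:R * m - q%:R / 2 * ln n%:R <= ln I by rewrite -l1 ler_ln.
have : ln I <= ln k2 + n%:R * m - q%:R / 2 * ln n%:R by rewrite -l2 ler_ln.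
move=> h2 h1; rewrite mulrC.
rewrite (_ : _ - _ = (ln I - (n%:R * m - q%:R / 2 * ln n%:R)) * n%:R^-1); last first.
  by field; rewrite gt_eqF.
rewrite normrM (ger0_norm (ltW (_ : 0 < n%:R^-1))) ?invr_gt0//.
rewrite ler_pM2r ?invr_gt0//.
have := ler_norm (ln k2); have := ler_norm (- ln k1); rewrite normrN => a1 a2.
have b1 := normr_ge0 (ln k1); have b2 := normr_ge0 (ln k2).
by rewrite ler_norml; apply/andP; split; lra.
Unshelve. all: by end_near.
Qed.

End laplace_expansion.

Section laplace_lipschitz.
Context {R : realType} {q K : nat}.
Variables (Theta : set 'cV[R]_q) (g : 'I_K -> 'cV[R]_q -> R).
Hypotheses (oT : open Theta) (bT : bounded_set Theta).
Hypotheses (gC2 : forall k, Ck_on Theta 2 (g k))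
  (gC : forall k, {within closure Theta, continuous (g k)}).
Variable prior : 'cV[R]_q -> R.
Hypotheses (prior_density : prob_density Theta prior).

(** A change of the coefficients by at most [e] multiplies the integrand by at most [expR (e * L)].
    This serves to make the logarithm a continuous, hence measurable, function of the coefficients;
    the reverse inequality follows by exchanging [c] and [c']. *)
Lemma log_integral_lipschitz : exists2 L, 0 <= L & forall (c c' : 'I_K -> R) e,
  (forall k, `|c k - c' k| <= e) ->
  ln (\int[lebesgue_col q]_(t in Theta) (expR (mix g c t) * prior t)) <=
  ln (\int[lebesgue_col q]_(t in Theta) (expR (mix g c' t) * prior t)) + e * L.
Proof.
have [G gG] := closure_bounded bT gC.
exists (K%:R * `|G|); first by rewrite mulr_ge0.
move=> c c' e cc'.
have gG' k t : closure Theta t -> `|g k t| <= `|G|.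
  by move=> ct; rewrite (le_trans (gG k t ct))// ler_norm.
have mTheta := open_measurable_mx oT.
have [mp p0 p1] := prior_density.
have mI b := measurable_integrand oT gC2 prior_density b 1.
have mE b : (fun t => (expR (1 * mix g b t) * prior t)%:E) =
     (fun t => (expR (mix g b t) * prior t)%:E).
  by apply/funext => t; rewrite mul1r.
have {mE}mI b : measurable_fun Theta (fun t => (expR (mix g b t) * prior t)%:E).
  by have := mI b; rewrite mE.
have mpE : measurable_fun Theta (fun t => (prior t)%:E) by exact/measurable_EFinP.
have bnd b : exists2 B, 0 <= B & forall t, closure Theta t -> `|mix g b t| <= B.
  exists ((\sum_k `|b k|) * `|G|); first by rewrite mulr_ge0// sumr_ge0.
  move=> t ct; apply: (le_trans (ler_norm_sum _ _ _)); rewrite mulr_suml.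
  by apply: ler_sum => k _; rewrite normrM ler_wpM2l//; exact: gG'.
have intE b : exists2 I, 0 < I &
   (\int[lebesgue_col q]_(t in Theta) (expR (mix g b t) * prior t)%:E = I%:E)%E.
  have [B B0 bB] := bnd b.
  have h1 : ((expR (- B))%:E <=
      \int[lebesgue_col q]_(t in Theta) (expR (mix g b t) * prior t)%:E)%E.
    rewrite -[leLHS]mule1 -p1 -ge0_integralZl ?lee_fin ?expR_ge0//.
    apply: ge0_le_integral => //.
    - by move=> t /p0 ?; rewrite -EFinM lee_fin mulr_ge0 ?expR_ge0.
    - by apply: measurable_funeM.
    - move=> t Tt; rewrite -EFinM lee_fin ler_wpM2r ?p0// ler_expR.
      by have := bB _ (subset_closure Tt); rewrite ler_norml => /andP[].
  have h2 : (\int[lebesgue_col q]_(t in Theta) (expR (mix g b t) * prior t)%:E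
      <= (expR B)%:E)%E.
    rewrite -[leRHS]mule1 -p1 -ge0_integralZl ?lee_fin ?expR_ge0//.
    apply: ge0_le_integral => //.
    - by move=> t /p0 ?; rewrite lee_fin mulr_ge0 ?expR_ge0.
    - by apply: measurable_funeM.
    - move=> t Tt; rewrite -EFinM lee_fin ler_wpM2r ?p0// ler_expR.
      by have := bB _ (subset_closure Tt); rewrite ler_norml => /andP[].
  move: h1 h2; case: (\int[_]_(_ in _) _)%E => [I||]//; rewrite !lee_fin => h1 _.
  by exists I => //; apply: lt_le_trans h1; exact: expR_gt0.
rewrite /Rintegral; have [I I0 IE] := intE c; have [I' I'0 IE'] := intE c'.
rewrite IE IE' /= -[X in _ + X]expRK -lnM ?posrE ?expR_gt0// ler_ln ?posrE ?mulr_gt0 ?expR_gt0//.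
rewrite -lee_fin EFinM -IE -IE' muleC -ge0_integralZl ?lee_fin ?expR_ge0//; last first.
  by move=> t /p0 ?; rewrite lee_fin mulr_ge0 ?expR_ge0.
apply: ge0_le_integral => //.
- by move=> t /p0 ?; rewrite lee_fin mulr_ge0 ?expR_ge0.
- by apply: measurable_funeM.
move=> t Tt; rewrite -EFinM lee_fin mulrA -expRD ler_wpM2r ?p0// ler_expR.
have := mix_near (fun k => gG' k t (subset_closure Tt)) cc'.
by rewrite ler_norml => /andP[_]; lra.
Qed.

End laplace_lipschitz.

(** * Gaussian increments and convergence in probability *)

Section integral_density.
Context d (T : measurableType d) {R : realType}.
Variables (mu nu : {measure set T -> \bar R}) (h : T -> \bar R).
Hypotheses (mh : measurable_fun setT h) (h0 : forall x, (0 <= h x)%E)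
  (hfin : forall x, h x \is a fin_num).
Hypothesis nuE : forall A, measurable A -> nu A = (\int[mu]_(x in A) h x)%E.

Import HBNNSimple.

Let density_nnsfun (f : {nnsfun T >-> R}) :
  (\int[nu]_x (f x)%:E = \int[mu]_x ((f x)%:E * h x))%E.
Proof.
under [LHS]eq_integral do rewrite fimfunE -fsumEFin//.
rewrite [LHS]ge0_integral_fsum//; last 2 first.
  - by move=> r; exact/measurable_EFinP/measurableT_comp.
  - by move=> n x _; rewrite EFinM nnfun_muleindic_ge0.
under [RHS]eq_integral.
  move=> x _; rewrite muleC fimfunE -fsumEFin// ge0_mule_fsumr; last first.
    by move=> r; rewrite EFinM nnfun_muleindic_ge0.
  over.
rewrite [RHS]ge0_integral_fsum//; last 2 first.
  - move=> r; apply: emeasurable_funM => //.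
    exact/measurable_EFinP/measurableT_comp.
  - by move=> n x _; rewrite EFinM mule_ge0// nnfun_muleindic_ge0.
apply: eq_fsbigr => r _.
rewrite integralZl_indic_nnsfun//= integral_indic// setIT nuE//.
have [r0|r0] := leP 0 r; last first.
  have -> : f @^-1` [set r] = set0 by apply: preimage_nnfun0.
  rewrite integral_set0 mule0; apply/esym/integral0_eq => x _.
  by rewrite indic0 mulr0 mule0.
rewrite integral_mkcond -ge0_integralZl//; last 2 first.
- by apply/(measurable_restrictT _ _).1 => //; exact: measurable_funTS.
- by move=> x _; exact: erestrict_ge0.
apply: eq_integral => x _; rewrite patchE EFinM muleCA -/(_ * _)%E; congr (_ * _)%E.
by rewrite indicE; case: ifPn => _; rewrite ?mule1 ?mule0.
Qed.

Lemma ge0_integral_density (f : T -> \bar R) :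
  measurable_fun setT f -> (forall x, 0 <= f x)%E ->
  (\int[nu]_x f x = \int[mu]_x (f x * h x))%E.
Proof.
move=> mf f0.
pose f_ := nnsfun_approx measurableT mf.
have fE x : limn (EFin \o f_ ^~ x) = f x.
  by apply/cvg_lim => //; exact: cvg_nnsfun_approx.
transitivity (lim (\int[nu]_x (f_ n x)%:E @[n --> \oo])%E).
  rewrite -monotone_convergence//=.
  - by apply: eq_integral => x _; rewrite -fE.
  - by move=> n; exact/measurable_EFinP/measurable_funTS.
  - by move=> n ? _; rewrite lee_fin.
  - by move=> ? _ ? ? mn; rewrite lee_fin; exact/lefP/nd_nnsfun_approx.
transitivity (lim (\int[mu]_x ((f_ n x)%:E * h x) @[n --> \oo])%E).
  by apply: congr_lim; apply/funext => n; exact: density_nnsfun.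
rewrite -monotone_convergence//=.
- apply: eq_integral => x _; apply/cvg_lim => //.
  by apply: cvgeMr => //; exact: cvg_nnsfun_approx.
- by move=> n; apply: emeasurable_funM => //; exact/measurable_EFinP/measurable_funTS.
- by move=> n x _; rewrite mule_ge0// lee_fin.
- move=> x _ a b ab; apply: lee_wpmul2r => //.
  by rewrite lee_fin; exact/lefP/nd_nnsfun_approx.
Qed.

End integral_density.

Section normal_moments.
Context {R : realType}.
Variable s : R.
Hypothesis s0 : 0 < s.
Local Notation nu := (normal_prob 0 s).

Let sn0 : s != 0. Proof. by rewrite gt_eqF. Qed.

Let ge0_integral_normal (f : R -> R) : measurable_fun setT f ->
  (forall x, 0 <= f x) -> (\int[nu]_x (f x)%:E =
  \int[lebesgue_measure]_x (f x * normal_pdf 0 s x)%:E)%E.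
Proof.
move=> mf f0.
rewrite (@ge0_integral_density _ _ R lebesgue_measure nu
    (fun x => (normal_pdf 0 s x)%:E))//.
- by apply/measurable_EFinP; exact: measurable_normal_pdf.
- by move=> x; rewrite lee_fin normal_pdf_ge0.
- exact: (measurable_EFinP _ _).2 mf.
Qed.

(** Laplace transform of the squared variable, by completing the Gaussian exponent to
    [a = e + 1 / (2 s^2)]. Negative [e] are allowed down to [- 1 / (2 s^2)]: the fourth moment uses
    a negative value, the second moment small positive ones. *)
Lemma integral_normal_expR_sqr (e : R) : 0 < 1 + 2 * e * s ^+ 2 ->
  (\int[nu]_x (expR (- (e * x ^+ 2)))%:E =
   ((Num.sqrt (1 + 2 * e * s ^+ 2))^-1)%:E)%E.
Proof.
move=> e1; have s2 : 0 < s ^+ 2 by rewrite exprn_gt0.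
pose a := e + (2 * s ^+ 2)^-1.
have aE : a = (1 + 2 * e * s ^+ 2) / (2 * s ^+ 2) by rewrite /a; field.
have a0 : 0 < a by rewrite aE divr_gt0// mulr_gt0.
rewrite ge0_integral_normal; last 2 first.
- apply: measurableT_comp => //; apply: measurableT_comp => //.
  by apply: measurable_funM => //; exact: measurable_funX.
- by move=> x; exact: expR_ge0.
transitivity (\int[lebesgue_measure]_x
    ((normal_peak s)%:E * (expR (- (a * (x - 0) ^+ 2)))%:E))%E.
  apply: eq_integral => x _; rewrite normal_pdfE// -EFinM mulrCA -expRD.
  by congr (_ * expR _)%:E; rewrite /a -mulr_natr; field.
rewrite ge0_integralZl ?lee_fin ?normal_peak_ge0//; last first.
  apply/measurable_EFinP; apply: measurableT_comp => //; apply: measurableT_comp => //.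
  by apply: measurable_funM => //; apply: measurable_funX; exact: measurable_funB.
rewrite integral_gauss// -EFinM; congr EFin.
have pk0 : 0 <= s ^+ 2 * pi *+ 2 by rewrite mulrn_wge0// mulr_ge0 ?pi_ge0// ltW.
rewrite /normal_peak -(sqrtrV pk0) -(sqrtrV (ltW e1)) -sqrtrM ?invr_ge0//.
congr Num.sqrt; rewrite aE -mulr_natr.
move: (pi_gt0 R) {pk0}; move: (pi : R) => p p0; field.
by rewrite sn0 !gt_eqF.
Qed.

Lemma integral_normal_expR (t : R) :
  (\int[nu]_x (expR (t * x))%:E = (expR (t ^+ 2 * s ^+ 2 / 2))%:E)%E.
Proof.
rewrite ge0_integral_normal; last 2 first.
- by apply: measurableT_comp => //; exact: measurable_funM.
- by move=> x; exact: expR_ge0.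
rewrite -[RHS]mule1 -(integral_normal_pdf (t * s ^+ 2) s).
rewrite -ge0_integralZl ?lee_fin ?expR_ge0//; last 2 first.
- by apply/measurable_EFinP; exact: measurable_normal_pdf.
- by move=> x _; rewrite lee_fin normal_pdf_ge0.
apply: eq_integral => x _; rewrite !normal_pdfE// -EFinM mulrCA [in RHS]mulrCA -!expRD.
by congr (_ * expR _)%:E; rewrite -mulr_natr; field.
Qed.

Lemma integral_normal_expr4 :
  (\int[nu]_x (x ^+ 4)%:E <= (64 * s ^+ 4)%:E)%E.
Proof.
have s2 : 0 < s ^+ 2 by rewrite exprn_gt0.
(* Half of the critical value, so the transform equals [sqrt 2]. With [y = x^2 / (4 s^2)], the bound
   [y^2 / 2 <= expR y] gives [x^4 <= 32 s^4 expR y], and [32 sqrt 2 <= 64]. The crude constant is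
   sufficient later. *)
pose e : R := - (4 * s ^+ 2)^-1.
have eE : 1 + 2 * e * s ^+ 2 = 2^-1 by rewrite /e; field.
have := @integral_normal_expR_sqr e; rewrite eE => /(_ _)/= H.
apply: (@le_trans _ _ (\int[nu]_x ((32 * s ^+ 4)%:E * (expR (- (e * x ^+ 2)))%:E))%E).
  apply: ge0_le_integral => //.
  - by move=> x _; rewrite lee_fin -[4%N]/(2 * 2)%N exprM sqr_ge0.
  - by apply/measurable_EFinP; exact: measurable_funX.
  - apply: measurable_funeM; apply/measurable_EFinP; apply: measurableT_comp => //.
    by apply: measurableT_comp => //; apply: measurable_funM => //; exact: measurable_funX.
  - move=> x _; rewrite -EFinM lee_fin.
    pose y := - (e * x ^+ 2).
    have y0 : 0 <= y by rewrite /y /e mulNr opprK mulr_ge0 ?sqr_ge0// invr_ge0 mulr_ge0// ltW.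
    have := expR_ge1Dxn 1 y0; rewrite -/y => h.
    have -> : x ^+ 4 = 32 * s ^+ 4 * (y ^+ 2 / 2) by rewrite /y /e; field.
    apply: ler_wpM2l; first by rewrite mulr_ge0// exprn_ge0// ltW.
    by apply: le_trans h; rewrite ler_wpDl.
rewrite ge0_integralZl ?lee_fin ?mulr_ge0 ?exprn_ge0 ?(ltW s0)//; last first.
  apply/measurable_EFinP; apply: measurableT_comp => //.
  by apply: measurableT_comp => //; apply: measurable_funM => //; exact: measurable_funX.
rewrite H// -EFinM lee_fin [leRHS](_ : _ = 32 * s ^+ 4 * 2); last by ring.
apply: ler_wpM2l; first by rewrite mulr_ge0// exprn_ge0// ltW.
rewrite sqrtrV// invrK -[leRHS]ger0_norm// -sqrtr_sqr ler_wsqrtr//.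
by rewrite -natrX ler_nat.
Qed.

Let measurable_exp n : measurable_fun setT (fun x : R => (x ^+ n)%:E).
Proof. by apply/measurable_EFinP; exact: measurable_funX. Qed.

Lemma integrable_normal_expr n : (n <= 4)%N -> nu.-integrable setT (fun x => (x ^+ n)%:E).
Proof.
move=> n4; apply: (@le_integrable _ _ R nu setT measurableT _ (fun x => (1 + x ^+ 4)%:E)) => //.
  exact: measurable_exp.
  move=> x _; rewrite /= lee_fin normrX [leRHS]ger0_norm; last first.
    by rewrite addr_ge0// -[4%N]/(2 * 2)%N exprM sqr_ge0.
  have -> : 1 + x ^+ 4 = 1 + `|x| ^+ 4.
    by rewrite -normrX [in RHS]ger0_norm// -[4%N]/(2 * 2)%N exprM sqr_ge0.
  have [x1|x1] := leP `|x| 1.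
    by apply: (@le_trans _ _ 1); [exact: exprn_ile1|rewrite lerDl exprn_ge0].
  by rewrite ler_wpDl// ler_weXn2l// ltW.
under eq_fun do rewrite EFinD.
apply: integrableD => //; first by apply: finite_measure_integrable_cst.
apply/integrableP; split; first exact: measurable_exp.
have -> : (\int[nu]_x `|(x ^+ 4)%:E| = \int[nu]_x (x ^+ 4)%:E)%E.
  apply: eq_integral => x _; rewrite gee0_abs//.
  by rewrite lee_fin -[4%N]/(2 * 2)%N exprM sqr_ge0.
by apply: (le_lt_trans integral_normal_expr4); rewrite ltry.
Qed.

(** Instead of differentiating the Laplace transform at 0, both sides are expanded to second order
    in [e]: expectation gives [1 - e E] up to [e^2 E4], the closed form gives [1 - e s^2] up to
    [O(e^2)]. Division by [e] leaves [|E - s^2| <= e (64 s^4)] for every [e > 0]. *)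
Lemma integral_normal_sqr : (\int[nu]_x (x ^+ 2)%:E = (s ^+ 2)%:E)%E.
Proof.
have nuT : nu setT = 1%E by rewrite /normal_prob integral_normal_pdf.
have i2 := @integrable_normal_expr 2 isT; have i4 := @integrable_normal_expr 4 isT.
have := integrable_fin_num measurableT i2; have := integrable_fin_num measurableT i4.
have := integral_normal_expr4.
case I4 : (\int[nu]_x (x ^+ 4)%:E)%E => [E4||]//.
case I2 : (\int[nu]_x (x ^+ 2)%:E)%E => [E||]//.
rewrite lee_fin => E4s _ _; congr EFin.
have s2 : 0 < s ^+ 2 by rewrite exprn_gt0.
suff H e : 0 < e -> `|E - s ^+ 2| <= e * (64 * s ^+ 4).
  apply/eqP; rewrite -subr_eq0 -normr_le0; apply/ler_addgt0Pr => e e0; rewrite add0r.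
  have c0 : 0 < 64 * s ^+ 4 by rewrite mulr_gt0// exprn_gt0.
  by rewrite (le_trans (H (e / (64 * s ^+ 4)) _)) ?divr_gt0// divfK ?gt_eqF.
move=> e0.
pose y := 2 * e * s ^+ 2.
have y0 : 0 < y by rewrite !mulr_gt0.
have y1 : 0 < 1 + y by rewrite addr_gt0.
have HE := integral_normal_expR_sqr y1.
have ie : nu.-integrable setT (fun x => (expR (- (e * x ^+ 2)))%:E).
  apply/integrableP; split.
    apply/measurable_EFinP; apply: measurableT_comp => //; apply: measurableT_comp => //.
    by apply: measurable_funM => //; exact: measurable_funX.
  suff -> : (\int[nu]_x `|(expR (- (e * x ^+ 2)))%:E| =
      \int[nu]_x (expR (- (e * x ^+ 2)))%:E)%E by rewrite HE ltry.
  by apply: eq_integral => x _; rewrite gee0_abs// lee_fin expR_ge0.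
pose w := Num.sqrt (1 + y).
have w0 : 0 < w by rewrite sqrtr_gt0.
have w2 : w ^+ 2 = 1 + y by rewrite sqr_sqrtr// ltW.
have w1 : 1 <= w by rewrite -sqrtr1 ler_wsqrtr// lerDl ltW.
have i24 : nu.-integrable setT (fun x => (1 - e * x ^+ 2)%:E).
  under eq_fun do rewrite EFinB EFinM.
  apply: integrableB => //; last exact: integrableZl.
  exact: finite_measure_integrable_cst.
have I24 : (\int[nu]_x (1 - e * x ^+ 2)%:E)%E = (1 - e * E)%:E.
  under eq_integral do rewrite EFinB EFinM.
  rewrite integralB//=; last exact: integrableZl.
    rewrite integralZl// I2 integral_cst//.
    by rewrite [X in (1 * X - _)%E](_ : _ = 1%E) ?mule1//; exact: nuT.
  exact: finite_measure_integrable_cst.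
have e2i4 : nu.-integrable setT (fun x => (e ^+ 2 * x ^+ 4)%:E).
  by under eq_fun do rewrite (EFinM (e ^+ 2)); exact: integrableZl.
have I4' : (\int[nu]_x (e ^+ 2 * x ^+ 4)%:E)%E = (e ^+ 2 * E4)%:E.
  under eq_integral do rewrite (EFinM (e ^+ 2)).
  by rewrite integralZl// I4.
have lo : 1 - e * E <= w^-1.
  rewrite -lee_fin -HE -I24; apply: le_integral => //.
  by move=> x _; rewrite lee_fin; apply: le_trans (expR_ge1Dx _).
(* For [z >= 0], [expR (- z) <= 1 / (1 + z) <= 1 - z + z^2], the last step because
   [(1 - z + z^2) (1 + z) = 1 + z^3]. *)
have up : w^-1 <= 1 - e * E + e ^+ 2 * E4.
  rewrite -lee_fin -HE EFinD -I24 -I4' -integralD//; apply: le_integral => //.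
    exact: integrableD.
  move=> x _; rewrite -EFinD lee_fin.
  have z0 : 0 <= e * x ^+ 2 by rewrite mulr_ge0 ?sqr_ge0// ltW.
  have -> : e ^+ 2 * x ^+ 4 = (e * x ^+ 2) ^+ 2 by ring.
  move: (e * x ^+ 2) z0 => z z0; rewrite expRN.
  have h := expR_ge1Dx z; have z1 : 0 < 1 + z by rewrite ltr_pwDl.
  apply: (@le_trans _ _ (1 + z)^-1); first by rewrite lef_pV2 ?posrE ?expR_gt0.
  rewrite -div1r ler_pdivrMr//.
  have -> : (1 - z + z ^+ 2) * (1 + z) = 1 + z ^+ 3 by ring.
  by rewrite lerDl exprn_ge0.
(* Taylor expansion of [(1 + y)^(-1/2)] with its exact remainder, rational in [w = sqrt (1 + y)];
   since [y = (w - 1) (w + 1)], the remainder is of order [y^2]. *)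
have wE : w^-1 = 1 - y / 2 + (w - 1) ^+ 2 * (w + 2) / (2 * w).
  have -> : y = w ^+ 2 - 1 by rewrite w2 addrC addKr.
  by field; rewrite gt_eqF.
have wr : 0 <= (w - 1) ^+ 2 * (w + 2) / (2 * w) <= y ^+ 2 * 2.
  apply/andP; split.
    apply: divr_ge0; last by rewrite mulr_ge0// ltW.
    by apply: mulr_ge0; [exact: sqr_ge0|rewrite addr_ge0// ltW].
  rewrite ler_pdivrMr ?mulr_gt0//.
  have -> : y = (w - 1) * (w + 1) by rewrite -subr_sqr expr1n w2 addrC addKr.
  rewrite exprMn -!mulrA ler_wpM2l ?sqr_ge0//; nra.
have yE : y = 2 * e * s ^+ 2 by [].
have s4 : e ^+ 2 * E4 <= e ^+ 2 * (64 * s ^+ 4) by rewrite ler_wpM2l// sqr_ge0.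
have y2 : y ^+ 2 * 2 = 8 * (e ^+ 2 * s ^+ 4) by rewrite yE; ring.
have p0 : 0 <= e ^+ 2 * s ^+ 4 by rewrite mulr_ge0// exprn_ge0 ?ltW.
case/andP: wr => wr1 wr2; rewrite -(ler_pM2l e0) -[X in X * _](gtr0_norm e0) -normrM.
rewrite mulrBr ler_norml; apply/andP; split.
  have -> : - (e * (e * (64 * s ^+ 4))) = - 64 * (e ^+ 2 * s ^+ 4) by ring.
  move: up; rewrite wE yE => up.
  have : e * s ^+ 2 = 2 * e * s ^+ 2 / 2 by field.
  lra.
have -> : e * (e * (64 * s ^+ 4)) = 64 * (e ^+ 2 * s ^+ 4) by ring.
move: lo; rewrite wE yE => lo.
have : e * s ^+ 2 = 2 * e * s ^+ 2 / 2 by field.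
lra.
Qed.

End normal_moments.

Section normal_mean.
Context {R : realType}.

(** From [1 + t x <= expR (t x)], the mean [m] satisfies [1 + t m <= expR (t^2 s^2 / 2)]. For small
    [t] of either sign this yields [|m| <= |t| s^2], so [m = 0]. *)
Lemma integral_normal_id (s : R) : 0 < s ->
  (\int[normal_prob 0 s]_x x%:E = 0)%E.
Proof.
move=> s0; have i1 : (normal_prob 0 s).-integrable setT (EFin : R -> \bar R).
  by have := integrable_normal_expr s0 (isT : (1 <= 4)%N); under eq_fun do rewrite expr1.
have s2 : 0 < s ^+ 2 by rewrite exprn_gt0.
have nuT : normal_prob 0 s setT = 1%E by rewrite /normal_prob integral_normal_pdf.
have := integrable_fin_num measurableT i1.
case I1 : (\int[normal_prob 0 s]_x x%:E)%E => [m||]// _; congr EFin.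
have H (t : R) : 1 + t * m <= expR (t ^+ 2 * s ^+ 2 / 2).
  rewrite -lee_fin -integral_normal_expR//.
  have it : (normal_prob 0 s).-integrable setT (fun x : R => (t * x)%:E).
    by under eq_fun do rewrite EFinM; exact: integrableZl.
  have i1t : (normal_prob 0 s).-integrable setT (fun x : R => (1 + t * x)%:E).
    under eq_fun do rewrite EFinD; apply: integrableD => //.
    exact: finite_measure_integrable_cst.
  have <- : (\int[normal_prob 0 s]_x (1 + t * x)%:E)%E = (1 + t * m)%:E.
    under eq_integral do rewrite EFinD.
    rewrite integralD//=; last exact: finite_measure_integrable_cst.
    rewrite integral_cst//.
    rewrite [X in (1 * X + _)%E](_ : _ = 1%E) ?mule1; last exact: nuT.
    by under eq_integral do rewrite EFinM; rewrite integralZl// I1.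
  apply: le_integral => //.
    apply/integrableP; split.
      apply/measurable_EFinP; apply: measurableT_comp => //; exact: measurable_funM.
    suff -> : (\int[normal_prob 0 s]_x `|(expR (t * x))%:E| =
        \int[normal_prob 0 s]_x (expR (t * x))%:E)%E.
      by rewrite integral_normal_expR// ltry.
    by apply: eq_integral => x _; rewrite gee0_abs// lee_fin expR_ge0.
  by move=> x _; rewrite lee_fin expR_ge1Dx.
have H2 (t : R) : t ^+ 2 * s ^+ 2 <= 1 -> t * m <= t ^+ 2 * s ^+ 2.
  move=> t1; have := H t; set u := t ^+ 2 * s ^+ 2 / 2 => Ht.
  have u0 : 0 <= u by rewrite /u divr_ge0// mulr_ge0 ?sqr_ge0// ltW.
  have -> : t ^+ 2 * s ^+ 2 = 2 * u by rewrite /u; field.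
  have u1 : u <= 1 / 2 by rewrite /u ler_wpM2r.
  have : expR u <= 1 + 2 * u.
    have := expR_ge1Dx (- u); rewrite expRN => h.
    have u2 : 0 < 1 - u by lra.
    have : expR u <= (1 - u)^-1 by rewrite -[expR u]invrK lef_pV2 ?posrE ?invr_gt0 ?expR_gt0.
    move=> /le_trans; apply; rewrite -div1r ler_pdivrMr//; nra.
  lra.
have H3 (e : R) : 0 < e -> e * s <= 1 -> `|m| <= e * s ^+ 2.
  move=> e0 es; have e2 : e ^+ 2 * s ^+ 2 <= 1.
    by rewrite -exprMn exprn_ile1// mulr_ge0// ltW.
  rewrite ler_norml; apply/andP; split; rewrite -(ler_pM2l e0).
    have := H2 (- e); rewrite sqrrN => /(_ e2); lra.
  have := H2 e e2; lra.
apply/eqP; rewrite -normr_le0; apply/ler_addgt0Pr => e e0; rewrite add0r.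
pose d := Num.min (e / s ^+ 2) s^-1.
have d0 : 0 < d by rewrite lt_min divr_gt0//= invr_gt0.
have := H3 d d0 _; rewrite -ler_pdivlMr// div1r ge_min lexx orbT => /(_ isT) /le_trans; apply.
by rewrite -ler_pdivlMr// ge_min lexx.
Qed.

End normal_mean.

(** * Independence: from rectangles to products *)

Section independence.
Context d (T : measurableType d) {R : realType} (P : probability T R).

(** The sets [U @^-1] B [&] V @^-1[C] are closed under intersection, so [P] restricted to [A] and
    [P A] times [P] agree on the sigma-algebra they generate. It makes the past independent of any
    function of a pair of increments, in particular of their product. *)
Lemma indep_pair_extend (A : set T) (U V : T -> R) : measurable A ->
  measurable_fun setT U -> measurable_fun setT V ->
  (forall B C, measurable B -> measurable C ->
    P (A `&` (U @^-1` B `&` V @^-1` C)) = P A * P (U @^-1` B `&` V @^-1` C))%E ->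
  forall D : set (R * R), measurable D ->
    (P (A `&` (fun w => (U w, V w)) @^-1` D) =
     P A * P ((fun w => (U w, V w)) @^-1` D))%E.
Proof.
move=> mA mU mV AUV D mD.
pose G := [set E | exists B C, [/\ measurable B, measurable C &
  E = U @^-1` B `&` V @^-1` C]].
have mG E : G E -> measurable E.
  move=> [B [C [mB mC ->]]]; apply: measurableI; rewrite -[X in measurable X]setTI;
  [exact: mU|exact: mV].
have GI : setI_closed G.
  move=> _ _ [B [C [mB mC ->]]] [B' [C' [mB' mC' ->]]].
  exists (B `&` B'), (C `&` C'); split; [exact: measurableI|exact: measurableI|].
  by rewrite !preimage_setI setIACA.
have GT : G setT.
  by exists setT, setT; split => //; rewrite !preimage_setT setIT.
have PA0 : 0 <= fine (P A) by rewrite fine_ge0.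
have PAf : P A \is a fin_num by exact: fin_num_measure.
pose m1 := mrestr P mA; pose m2 := mscale (NngNum PA0) P.
have m2E E : m2 E = (P A * P E)%E by rewrite /m2 /mscale/= fineK.
have m12 E : G E -> m1 E = m2 E.
  by move=> [B [C [mB mC ->]]]; rewrite m2E /m1 /mrestr setIC AUV.
have : m1 ((fun w => (U w, V w)) @^-1` D) = m2 ((fun w => (U w, V w)) @^-1` D).
  apply: (g_sigma_algebra_measure_unique G _ (fun=> setT)) => //.
  - by rewrite bigcup_const.
  - by rewrite /= /mrestr setTI -ge0_fin_numE.
  - have mU' : measurable_fun setT (U : g_sigma_algebraType G -> R).
      move=> _ B mB; rewrite setTI; apply: sub_sigma_algebra.
      by exists B, setT; split => //; rewrite preimage_setT setIT.
    have mV' : measurable_fun setT (V : g_sigma_algebraType G -> R).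
      move=> _ B mB; rewrite setTI; apply: sub_sigma_algebra.
      by exists setT, B; split => //; rewrite preimage_setT setTI.
    by have := measurable_fun_pair mU' mV' measurableT mD; rewrite setTI.
by rewrite m2E /m1 /mrestr setIC.
Qed.

(** By uniqueness of product measures the joint law is the product of the marginals; Fubini then
    factors the expectation and shows that the product is integrable. *)
Lemma indep_integralM (X Y : T -> R) :
  measurable_fun setT X -> measurable_fun setT Y ->
  (forall A B, measurable A -> measurable B ->
    P (X @^-1` A `&` Y @^-1` B) = P (X @^-1` A) * P (Y @^-1` B))%E ->
  P.-integrable setT (EFin \o X) -> P.-integrable setT (EFin \o Y) ->
  P.-integrable setT (fun w => (X w * Y w)%:E) /\
  (\int[P]_w (X w * Y w)%:E = \int[P]_w (X w)%:E * \int[P]_w (Y w)%:E)%E.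
Proof.
move=> mX mY XY iX iY.
pose X' : {RV P >-> R} := HB.pack X (isMeasurableFun.Build _ _ _ _ X mX).
pose Y' : {RV P >-> R} := HB.pack Y (isMeasurableFun.Build _ _ _ _ Y mY).
pose Z w := (X w, Y w).
have mZ : measurable_fun setT Z by exact: measurable_fun_pair.
pose Z' : {RV P >-> (R * R)%type} := HB.pack Z (isMeasurableFun.Build _ _ _ _ Z mZ).
pose mu1 := distribution P X'; pose mu2 := distribution P Y'.
have joint (C : set (R * R)) : measurable C -> (mu1 \x mu2)%E C = distribution P Z' C.
  by move=> mC; apply: product_measure_unique => // A B mA mB; exact: XY.
pose f (z : R * R) := (z.1 * z.2)%:E.
have mf : measurable_fun setT f.
  by apply/measurable_EFinP; apply: measurable_funM.
have i1 : (mu1 : set R -> \bar R).-integrable setT EFin.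
  by apply: integrable_pushforward.
have i2 : (mu2 : set R -> \bar R).-integrable setT EFin.
  by apply: integrable_pushforward.
have E1 : (\int[mu1]_x x%:E = \int[P]_w (X w)%:E)%E by exact: integral_distribution.
have E2 : (\int[mu2]_x x%:E = \int[P]_w (Y w)%:E)%E by exact: integral_distribution.
have fin2 := integrable_fin_num measurableT i2.
have a2 : (\int[mu2]_y `|y%:E| \is a fin_num)%E.
  by have := integrable_fin_num measurableT (integrable_abse i2).
have jf : (mu1 \x mu2)%E.-integrable setT f.
  apply/integrable12ltyP => //.
  have -> : (\int[mu1]_x \int[mu2]_y `|f (x, y)| =
      \int[mu1]_x (`|x%:E| * \int[mu2]_y `|y%:E|))%E.
    apply: eq_integral => x _; rewrite -ge0_integralZl//; last first.
      exact: measurableT_comp.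
    by apply: eq_integral => y _; rewrite /f/= normrM EFinM.
  rewrite ge0_integralZr//; last 2 first.
    exact: measurableT_comp.
    by apply: integral_ge0.
  rewrite lte_mul_pinfty//; first by apply: integral_ge0.
    by have := integrable_fin_num measurableT (integrable_abse i1).
  by rewrite -ge0_fin_numE//; apply: integral_ge0.
have Ef : (\int[mu1 \x mu2]_z f z = \int[P]_w (X w)%:E * \int[P]_w (Y w)%:E)%E.
  rewrite -integral12_prod_meas1// -E1 -E2 /fubini_F.
  under eq_integral.
    move=> x _; rewrite /f/=.
    under eq_integral do rewrite EFinM.
    rewrite integralZl//; over.
  rewrite /=; have [c cE] : exists c, (\int[mu2]_y y%:E = c%:E)%E.
    by exists (fine (\int[mu2]_y y%:E)%E); rewrite fineK.
  by rewrite cE integralZr.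
have iXY : P.-integrable setT (f \o Z).
  apply/integrableP; split; first exact: measurableT_comp.
  have := ge0_integral_distribution Z' (f := abse \o f) => /(_ _ _)/= <-//.
    rewrite (eq_measure_integral (mu1 \x mu2)%E)//; last first.
      by move=> A mA _; rewrite -[RHS]/((mu1 \x mu2)%E A) joint.
    by case/integrableP : jf.
  exact: measurableT_comp.
split; first exact: iXY.
rewrite -Ef (eq_measure_integral (distribution P Z'))//; last first.
  by move=> A mA _; exact: joint.
by rewrite integral_distribution.
Qed.

End independence.

(** * Convergence to zero in probability *)

Section small_in_probability.
Context d (T : measurableType d) {R : realType} (P : probability T R).
Implicit Types (Z : nat -> T -> R).

(* Exceptional sets are required measurable, but not the variables themselves. *)
Definition small_op Z := forall e eta : R, 0 < e -> 0 < eta ->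
  \forall n \near \oo, exists E : set T,
    [/\ measurable E, (P E <= eta%:E)%E & forall w, ~ E w -> `|Z n w| <= e].

Lemma small_op_le Z Z' : small_op Z ->
  (\forall n \near \oo, forall w, `|Z' n w| <= `|Z n w|) -> small_op Z'.
Proof.
move=> oZ ZZ' e eta e0 eta0; near=> n.
have [E [mE PE EZ]] : exists E, [/\ measurable E, (P E <= eta%:E)%E &
  forall w, ~ E w -> `|Z n w| <= e] by near: n; exact: oZ.
exists E; split => // w /EZ; apply: le_trans; move: w; near: n; exact: ZZ'.
Unshelve. all: by end_near.
Qed.

Lemma small_opD Z Z' : small_op Z -> small_op Z' ->
  small_op (fun n w => Z n w + Z' n w).
Proof.
move=> oZ oZ' e eta e0 eta0.
have e20 : 0 < e / 2 by rewrite divr_gt0.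
have eta20 : 0 < eta / 2 by rewrite divr_gt0.
near=> n.
have [E [mE PE EZ]] : exists E, [/\ measurable E, (P E <= (eta / 2)%:E)%E &
  forall w, ~ E w -> `|Z n w| <= e / 2] by near: n; exact: oZ.
have [E' [mE' PE' EZ']] : exists E, [/\ measurable E, (P E <= (eta / 2)%:E)%E &
  forall w, ~ E w -> `|Z' n w| <= e / 2] by near: n; exact: oZ'.
exists (E `|` E'); split; first exact: measurableU.
  apply: (le_trans (measureU2 _ _ _)) => //.
  by rewrite [eta](splitr eta) EFinD leeD.
move=> w /not_orP[/EZ h /EZ' h']; apply: (le_trans (ler_normD _ _)).
by rewrite [leRHS]splitr lerD.
Unshelve. all: by end_near.
Qed.

Lemma small_op0 : small_op (fun _ _ => 0).
Proof.
by move=> e eta e0 eta0; near=> n; exists set0; split => //;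
  [rewrite measure0 lee_fin ltW|rewrite normr0 ltW].
Unshelve. all: by end_near.
Qed.

Lemma small_opZ Z c : small_op Z -> small_op (fun n w => c * Z n w).
Proof.
move=> oZ e eta e0 eta0; have c0 : 0 < `|c| + 1 by rewrite ltr_wpDl.
apply: filterS (oZ (e / (`|c| + 1)) eta (divr_gt0 e0 c0) eta0) => n [E [mE PE EZ]].
exists E; split => // w /EZ; rewrite ler_pdivlMr// => h; rewrite normrM.
by apply: le_trans h; rewrite mulrC ler_wpM2l// lerDl.
Qed.

Lemma small_op_sum (I : Type) (r : seq I) (Z : I -> nat -> T -> R) :
  (forall i, small_op (Z i)) -> small_op (fun n w => \sum_(i <- r) Z i n w).
Proof.
move=> oZ; elim: r => [|i r IH].
  by under eq_fun do under eq_fun do rewrite big_nil; exact: small_op0.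
by under eq_fun do under eq_fun do rewrite big_cons; exact: small_opD.
Qed.

(** Meant for Young's inequality: the term weighted by [e] is only bounded in probability, near [b],
    while [A] may blow up as [e] shrinks. Fixing [e] first and letting [n] grow afterwards is
    enough. *)
Lemma small_op_approx Z (b : R) :
  (forall e, 0 < e -> exists A B, [/\ small_op A, small_op B &
     \forall n \near \oo, forall w, `|Z n w| <= `|A n w| + e * (b + `|B n w|)]) ->
  small_op Z.
Proof.
move=> H e eta e0 eta0.
have b0 : 0 < `|b| + 1 by rewrite ltr_wpDl.
pose e' := e / 2 / (`|b| + 1).
have e'0 : 0 < e' by rewrite !divr_gt0.
have [A [B [oA oB ZAB]]] := H e' e'0.
have e20 : 0 < e / 2 by rewrite divr_gt0.
have eta20 : 0 < eta / 2 by rewrite divr_gt0.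
near=> n.
have [E [mE PE EZ]] : exists E, [/\ measurable E, (P E <= (eta / 2)%:E)%E &
  forall w, ~ E w -> `|A n w| <= e / 2] by near: n; exact: oA.
have [E' [mE' PE' EZ']] : exists E, [/\ measurable E, (P E <= (eta / 2)%:E)%E &
  forall w, ~ E w -> `|B n w| <= 1] by near: n; exact: oB.
exists (E `|` E'); split; first exact: measurableU.
  apply: (le_trans (measureU2 _ _ _)) => //.
  by rewrite [eta](splitr eta) EFinD leeD.
move=> w /not_orP[/EZ h /EZ' h'].
have hZ : `|Z n w| <= `|A n w| + e' * (b + `|B n w|) by move: w {h h'}; near: n.
apply: (le_trans hZ); rewrite [leRHS]splitr lerD//.
apply: (@le_trans _ _ (e' * (`|b| + 1))); last by rewrite divfK// gt_eqF.
by rewrite ler_wpM2l ?(ltW e'0)// lerD// ler_norm.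
Unshelve. all: by end_near.
Qed.

Lemma small_op_L1 Z (c : nat -> R) : (forall n, measurable_fun setT (Z n)) ->
  (forall n w, 0 <= Z n w) ->
  (\forall n \near \oo, \int[P]_w (Z n w)%:E <= (c n)%:E)%E ->
  c n @[n --> \oo] --> 0 -> small_op Z.
Proof.
move=> mZ Z0 Zc c0 e eta e0 eta0; near=> n.
have ZcN : (\int[P]_w (Z n w)%:E <= (c n)%:E)%E by near: n.
pose E := [set w | e < Z n w].
have mE : measurable E.
  have -> : E = Z n @^-1` `]e, +oo[%classic.
    by apply/seteqP; split => w /=; rewrite in_itv/= andbT.
  by rewrite -[X in measurable X]setTI; exact: mZ.
exists E; split => //; last first.
  by move=> w /negP; rewrite -leNgt ger0_norm.
have : (e%:E * P E <= (c n)%:E)%E.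
  rewrite -integral_cst//; apply: le_trans ZcN.
  apply: (@le_trans _ _ (\int[P]_(w in E) (Z n w)%:E)%E).
    apply: ge0_le_integral => //.
    - by move=> w _; rewrite lee_fin ltW.
    - exact/measurable_funTS/measurable_EFinP.
    - by move=> w /ltW; rewrite lee_fin.
  apply: ge0_subset_integral => //.
    exact/measurable_EFinP.
  by move=> w _; rewrite lee_fin.
move=> h; rewrite -(@lee_pmul2l _ e%:E)// ?lte_fin//; apply: (le_trans h).
rewrite -EFinM lee_fin.
have : `|0 - c n| <= e * eta.
  by near: n; move/cvgrPdist_le : c0; apply; rewrite mulr_gt0.
by rewrite sub0r normrN => /(le_trans (ler_norm _)).
Unshelve. all: by end_near.
Qed.

Lemma small_op_sqr Z : small_op (fun n w => Z n w ^+ 2) -> small_op Z.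
Proof.
move=> oZ e eta e0 eta0.
apply: filterS (oZ (e ^+ 2) eta (exprn_gt0 2 e0) eta0) => n [E [mE PE EZ]].
exists E; split => // w /EZ; rewrite normrX ler_sqr ?nnegrE// ltW//.
Qed.

(** The tail unions [D n] of the events [e < |Z k|], [k >= n], decrease to a set inside the
    exceptional null set, so their probabilities tend to 0; they serve as measurable exceptional
    sets. *)
Lemma small_op_ae Z : (forall n, measurable_fun setT (Z n)) ->
  {ae P, forall w, Z n w @[n --> \oo] --> 0} -> small_op Z.
Proof.
move=> mZ [N [mN PN HN]] e eta e0 eta0.
pose E n := [set w | e < `|Z n w|].
have mE n : measurable (E n).
  have -> : E n = (fun w => `|Z n w|) @^-1` `]e, +oo[%classic.
    by apply/seteqP; split => w /=; rewrite in_itv/= andbT.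
  by rewrite -[X in measurable X]setTI; apply: measurableT_comp.
pose D n := \bigcup_(k in [set k | (n <= k)%N]) E k.
have mD n : measurable (D n) by apply: bigcup_measurable.
have DN : \bigcap_n D n `<=` N.
  move=> w Dw; apply: HN => /= /cvgrPdist_le/(_ _ e0)[n _ Hn].
  have [k /= nk Ek] := Dw n I; have := Hn k nk.
  by rewrite sub0r normrN => /(lt_le_trans Ek); rewrite ltxx.
have : P (D n) @[n --> \oo] --> P (\bigcap_n D n).
  apply: nonincreasing_cvg_mu => //.
  - by rewrite -ge0_fin_numE//; exact: fin_num_measure.
  - exact: bigcap_measurable.
  - by move=> n m nm; apply/subsetPset => w [k /= mk Ek]; exists k => //=; exact: leq_trans mk.
have -> : P (\bigcap_n D n) = 0%E.
  apply/eqP; rewrite -measure_le0 -PN; apply: le_measure; rewrite ?inE//.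
  exact: bigcap_measurable.
move=> /fine_cvgP[_ /cvgrPdist_le/(_ _ eta0)]; apply: filterS => n.
rewrite sub0r normrN /= => h; exists (D n); split => //.
  rewrite -[P (D n)]fineK ?fin_num_measure// lee_fin.
  by apply: le_trans h; exact: ler_norm.
move=> w Dw; rewrite leNgt; apply/negP => Zw; apply: Dw; exists n => //=.
Unshelve. all: by end_near.
Qed.

Lemma small_op_tight (K : T -> R) (c : nat -> R) : measurable_fun setT K ->
  c n @[n --> \oo] --> 0 -> small_op (fun n w => c n * K w).
Proof.
move=> mK c0; apply: small_op_ae; first by move=> n; exact: measurable_funM.
apply: aeW => w; rewrite -[X in _ --> X](mul0r (K w)).
by apply: cvgM => //; exact: cvg_cst.
Qed.

End small_in_probability.

Section martingale_differences.
Context d (T : measurableType d) {R : realType} (P : probability T R).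

Lemma integrable_of_sqr (X : T -> R) : measurable_fun setT X ->
  P.-integrable setT (fun w => (X w ^+ 2)%:E) -> P.-integrable setT (EFin \o X).
Proof.
move=> mX iX; apply: (@le_integrable _ _ R P setT measurableT _
   (fun w => (1 + X w ^+ 2)%:E)) => //.
- exact/measurable_EFinP.
- move=> w _; rewrite /= lee_fin [leRHS]ger0_norm ?addr_ge0 ?sqr_ge0//.
  have := sqr_ge0 (`|X w| - 1); have := real_normK (num_real (X w)).
  have := sqr_ge0 (X w); rewrite sqrrB expr1n mulr1 => h1 -> h2.
  by move: h1 h2; rewrite mulr2n; have := normr_ge0 (X w); lra.
under eq_fun do rewrite EFinD.
by apply: integrableD => //; exact: finite_measure_integrable_cst.
Qed.

(** Each term is centred and independent of the sum of the earlier ones, so the cross term in the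
    square of the next partial sum has expectation 0 and second moments add up. *)
Lemma martingale_sqr (xi : nat -> T -> R) (c : R) :
  (forall m, measurable_fun setT (xi m)) ->
  (forall m, P.-integrable setT (fun w => (xi m w ^+ 2)%:E)) ->
  (forall m, \int[P]_w (xi m w ^+ 2)%:E <= c%:E)%E ->
  (forall m, \int[P]_w (xi m w)%:E = 0)%E ->
  (forall m (A B : set R), measurable A -> measurable B ->
    P ((fun w => \sum_(k < m) xi k w)%R @^-1` A `&` xi m @^-1` B) =
    P ((fun w => \sum_(k < m) xi k w)%R @^-1` A) * P (xi m @^-1` B))%E ->
  forall m, (\int[P]_w ((\sum_(k < m) xi k w) ^+ 2)%:E <= (m%:R * c)%:E)%E.
Proof.
move=> mxi i2 c2 i0 indep m.
pose S m w := \sum_(k < m) xi k w.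
have mS m' : measurable_fun setT (S m') by exact: measurable_sum.
have ixi m' : P.-integrable setT (EFin \o xi m') by exact: integrable_of_sqr.
suff : P.-integrable setT (fun w => (S m w ^+ 2)%:E) /\
    (\int[P]_w (S m w ^+ 2)%:E <= (m%:R * c)%:E)%E by case.
elim: m => [|m [IH1 IH2]].
  have -> : (fun w => (S 0 w ^+ 2)%:E) = cst 0%E.
    by apply/funext => w; rewrite /S big_ord0 expr0n.
  by rewrite integral0 mul0r lexx; split => //; exact: integrable0.
have iS : P.-integrable setT (EFin \o S m) by exact: integrable_of_sqr.
have [iSx ESx] := indep_integralM (mS m) (mxi m) (indep m) iS (ixi m).
have SE : (fun w => (S m.+1 w ^+ 2)%:E) =
    (fun w => (S m w ^+ 2)%:E + (2%:E * (S m w * xi m w)%:E + (xi m w ^+ 2)%:E))%E.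
  apply/funext => w; rewrite /S big_ord_recr/= -EFinM -!EFinD; congr EFin; ring.
have i2Sx : P.-integrable setT (fun w => 2%:E * (S m w * xi m w)%:E)%E.
  exact: integrableZl.
rewrite SE; split; first by apply: integrableD => //; exact: integrableD.
rewrite integralD//; last exact: integrableD.
rewrite integralD// integralZl// ESx i0 !mule0 add0e.
by rewrite -natr1 mulrDl mul1r EFinD leeD.
Qed.

End martingale_differences.

Section normal_law.
Context d (T : measurableType d) {R : realType} (P : probability T R).
Variables (X : T -> R) (s : R).
Hypotheses (mX : measurable_fun setT X) (s0 : 0 < s).
Hypothesis lawX : forall B, measurable B -> P (X @^-1` B) = normal_prob 0 s B.

Lemma normal_law_integral (f : R -> R) : measurable_fun setT f ->
  (normal_prob 0 s).-integrable setT (EFin \o f) ->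
  P.-integrable setT (fun w => (f (X w))%:E) /\
  (\int[P]_w (f (X w))%:E = \int[normal_prob 0 s]_x (f x)%:E)%E.
Proof.
move=> mf intf.
have mX' : measurable_fun setT (X : T -> measurableTypeR R) by exact: mX.
pose X' : {RV P >-> measurableTypeR R} :=
  HB.pack (X : T -> measurableTypeR R) (isMeasurableFun.Build _ _ _ _ _ mX').
have law B : measurable B -> distribution P X' B = normal_prob 0 s B by exact: lawX.
have mfE : measurable_fun setT (EFin \o f : measurableTypeR R -> \bar R).
  by exact: measurableT_comp mf.
have i1 : P.-integrable setT (fun w => (f (X w))%:E).
  apply/integrableP; split.
    by apply/measurable_EFinP; exact: measurableT_comp.
  have /integrableP[_] := intf.
  rewrite (eq_measure_integral (distribution P X')); last first.
    by move=> A mA _; exact/esym/law.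
  rewrite (ge0_integral_distribution X')//.
  exact: measurableT_comp.
split => //.
rewrite [RHS](eq_measure_integral (distribution P X')); last first.
  by move=> A mA _; exact/esym/law.
by rewrite (integral_distribution (X := X')).
Qed.

Lemma normal_law_expr n : (n <= 4)%N ->
  P.-integrable setT (fun w => (X w ^+ n)%:E) /\
  (\int[P]_w (X w ^+ n)%:E = \int[normal_prob 0 s]_x (x ^+ n)%:E)%E.
Proof.
move=> n4; apply: (@normal_law_integral (fun x => x ^+ n)).
  exact: measurable_funX.
exact: integrable_normal_expr.
Qed.

End normal_law.

Lemma cvg_invn {R : realType} : (n%:R^-1 : R) @[n --> \oo] --> 0.
Proof.
apply/gtr0_cvgV0; last exact: cvgr_idn.
by near=> n; rewrite ltr0n; near: n; exact: nbhs_infty_gt.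
Unshelve. all: by end_near.
Qed.

Lemma sqr_sum_le {R : realDomainType} (I : finType) (x : I -> R) :
  (\sum_i x i) ^+ 2 <= #|I|%:R * \sum_i x i ^+ 2.
Proof.
rewrite expr2 mulr_suml -(@ler_pM2l _ 2)//.
have -> : #|I|%:R * \sum_i x i ^+ 2 = \sum_i \sum_(j : I) x i ^+ 2.
  rewrite mulr_sumr; apply: eq_bigr => i _.
  by rewrite sumr_const -[RHS]mulr_natl.
have {1}-> : 2 = 1 + 1 :> R by [].
rewrite [leRHS]mulrDl mul1r {2}exchange_big/= -big_split/= mulr_sumr.
apply: ler_sum => i _; rewrite mulr_sumr mulr_sumr -big_split/=; apply: ler_sum => j _.
have := sqr_ge0 (x i - x j); rewrite sqrrB mulr2n; lra.
Qed.

(** * Quadratic variation and fourth powers of the driving noise *)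

Section noise.
Context d (T : measurableType d) {R : realType} (P : probability T R).
Variables (F : R -> set (set T)) (J : finType) (W : J -> R -> T -> R).
Hypotheses (hF : filtration F)
  (adW : forall a t, 0 <= t -> forall B, measurable B -> F t (W a t @^-1` B))
  (lawW : forall a s t, 0 <= s < t -> forall B, measurable B ->
    P ((fun w => W a t w - W a s w) @^-1` B) = normal_prob 0 (Num.sqrt (t - s)) B)
  (indF : forall a b s t, 0 <= s < t -> forall A B C, F s A ->
    measurable B -> measurable C ->
    let U := fun w => (W a t w - W a s w)%R in
    let V := fun w => (W b t w - W b s w)%R in
    (P (A `&` (U @^-1` B `&` V @^-1` C)) = P A * P (U @^-1` B `&` V @^-1` C))%E)
  (indW : forall a b s t, a != b -> 0 <= s < t -> forall B C,
    measurable B -> measurable C ->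
    let U := fun w => (W a t w - W a s w)%R in
    let V := fun w => (W b t w - W b s w)%R in
    (P (U @^-1` B `&` V @^-1` C) = P (U @^-1` B) * P (V @^-1` C))%E).
Variable horizon : R.
Hypothesis horizon0 : 0 < horizon.

Definition noise_incr a n k w :=
  W a (k.+1%:R * (horizon / n%:R)) w - W a (k%:R * (horizon / n%:R)) w.
Local Notation U := noise_incr.

Let grid_ge0 n k : 0 <= k%:R * (horizon / n%:R) :> R.
Proof. by rewrite mulr_ge0// divr_ge0// ltW. Qed.

Let grid_lt n k : (0 < n)%N ->
  0 <= k%:R * (horizon / n%:R) < k.+1%:R * (horizon / n%:R).
Proof.
by move=> n0; rewrite grid_ge0/= ltr_pM2r ?ltr_nat// divr_gt0// ltr0n.
Qed.

Let grid_step n k :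
  k.+1%:R * (horizon / n%:R) - k%:R * (horizon / n%:R) = horizon / n%:R :> R.
Proof. by rewrite -mulrBl -natr1 addrAC subrr add0r mul1r. Qed.

Let measurable_W a t : 0 <= t -> measurable_fun setT (W a t).
Proof.
move=> t0 _ B mB; rewrite setTI.
exact: (hF.1 t t0).2 (adW a t0 mB).
Qed.

Lemma measurable_noise_incr a n k : measurable_fun setT (U a n k).
Proof. by apply: measurable_funB; exact: measurable_W. Qed.

Let law_noise a n k : (0 < n)%N -> forall B, measurable B ->
  P (U a n k @^-1` B) = normal_prob 0 (Num.sqrt (horizon / n%:R)) B.
Proof. by move=> n0 B mB; have := lawW a (grid_lt k n0) mB; rewrite grid_step. Qed.

Let step_gt0 n : (0 < n)%N -> 0 < Num.sqrt (horizon / n%:R).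
Proof. by move=> n0; rewrite sqrtr_gt0 divr_gt0// ltr0n. Qed.

Let sqr_step n : (0 < n)%N -> Num.sqrt (horizon / n%:R) ^+ 2 = horizon / n%:R.
Proof. by move=> n0; rewrite sqr_sqrtr// divr_ge0// ltW. Qed.

Let noise_mean a n k : (0 < n)%N ->
  P.-integrable setT (EFin \o U a n k) /\ (\int[P]_w (U a n k w)%:E = 0)%E.
Proof.
move=> n0; set s := Num.sqrt (horizon / n%:R); have s0 := step_gt0 n0.
have i1 : (normal_prob 0 s).-integrable setT (EFin \o (fun x => x)).
  by have := integrable_normal_expr s0 (isT : (1 <= 4)%N); under eq_fun do rewrite expr1.
have [iU EU] := normal_law_integral (measurable_noise_incr a n k) (law_noise a k n0)
  (@measurable_id _ _ _) i1.
by split; [exact: iU|rewrite -[RHS](integral_normal_id s0); exact: EU].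
Qed.

Let noise_sqr a n k : (0 < n)%N ->
  P.-integrable setT (fun w => (U a n k w ^+ 2)%:E) /\
  (\int[P]_w (U a n k w ^+ 2)%:E = (horizon / n%:R)%:E)%E.
Proof.
move=> n0.
have [] := normal_law_expr (measurable_noise_incr a n k) (step_gt0 n0)
  (law_noise a k n0) (isT : (2 <= 4)%N).
by rewrite integral_normal_sqr ?step_gt0// sqr_step.
Qed.

Let noise_expr4 a n k : (0 < n)%N ->
  P.-integrable setT (fun w => (U a n k w ^+ 4)%:E) /\
  (\int[P]_w (U a n k w ^+ 4)%:E <= (64 * (horizon / n%:R) ^+ 2)%:E)%E.
Proof.
move=> n0.
have [i4 ->] := normal_law_expr (measurable_noise_incr a n k) (step_gt0 n0)
  (law_noise a k n0) (isT : (4 <= 4)%N).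
split => //; have := integral_normal_expr4 (step_gt0 n0).
by rewrite -[4%N]/(2 * 2)%N (exprM (Num.sqrt _)) sqr_step.
Qed.

Let prod4 (x y : R) : (x * y) ^+ 2 <= x ^+ 4 + y ^+ 4.
Proof.
have -> : x ^+ 4 = (x ^+ 2) ^+ 2 by rewrite -exprM.
have -> : y ^+ 4 = (y ^+ 2) ^+ 2 by rewrite -exprM.
rewrite exprMn; have := sqr_ge0 (x ^+ 2 - y ^+ 2).
have := sqr_ge0 (x ^+ 2 + y ^+ 2); rewrite sqrrB sqrrD.
move: (x ^+ 2) (y ^+ 2) => X Y; rewrite !mulr2n; lra.
Qed.

Let prod_sqr a b n k : (0 < n)%N ->
  P.-integrable setT (fun w => ((U a n k w * U b n k w) ^+ 2)%:E) /\
  (\int[P]_w ((U a n k w * U b n k w) ^+ 2)%:E <=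
    (128 * (horizon / n%:R) ^+ 2)%:E)%E.
Proof.
move=> n0; have [ia Ea] := noise_expr4 a k n0; have [ib Eb] := noise_expr4 b k n0.
have iab : P.-integrable setT (fun w => (U a n k w ^+ 4 + U b n k w ^+ 4)%:E).
  by under eq_fun do rewrite EFinD; exact: integrableD.
have mab : measurable_fun setT (fun w => ((U a n k w * U b n k w) ^+ 2)%:E).
  apply/measurable_EFinP; apply: measurable_funX; apply: measurable_funM;
  exact: measurable_noise_incr.
have i2 : P.-integrable setT (fun w => ((U a n k w * U b n k w) ^+ 2)%:E).
  apply: (le_integrable _ _ _ iab) => // w _; rewrite lee_fin ger0_norm ?sqr_ge0//.
  by rewrite (le_trans (prod4 _ _))// ler_norm.
split => //; apply: (@le_trans _ _ (\int[P]_w (U a n k w ^+ 4 + U b n k w ^+ 4)%:E)%E).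
  by apply: le_integral => // w _; rewrite lee_fin prod4.
under eq_integral do rewrite EFinD.
rewrite integralD// (le_trans (leeD Ea Eb))// -EFinD lee_fin; lra.
Qed.

Let prod_mean a b n k : (0 < n)%N ->
  P.-integrable setT (fun w => (U a n k w * U b n k w)%:E) /\
  (\int[P]_w (U a n k w * U b n k w)%:E = (horizon / n%:R * (a == b)%:R)%:E)%E.
Proof.
move=> n0; have [<-|ab] := eqVneq a b.
  rewrite mulr1 (_ : (fun w => (U a n k w * U a n k w)%:E) =
    (fun w => (U a n k w ^+ 2)%:E)); first exact: noise_sqr.
  by apply/funext => w; rewrite expr2.
rewrite mulr0; have [ia Ea] := noise_mean a k n0; have [ib Eb] := noise_mean b k n0.
have [] := indep_integralM (measurable_noise_incr a n k)
  (measurable_noise_incr b n k) _ ia ib.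
  by move=> B C mB mC; exact: (indW ab (grid_lt k n0)).
by rewrite Ea mul0e.
Qed.

(** The terms [xi] are centred martingale differences with second moments of order [h^2]; summing
    [n] of them with [n h] fixed gives a second moment of order [1 / n]. *)
Lemma noise_lln a b : small_op P (fun n w =>
  \sum_(k < n) U a n k w * U b n k w - horizon * (a == b)%:R).
Proof.
pose xi n m w := U a n m w * U b n m w - horizon / n%:R * (a == b)%:R.
have mxi n m : measurable_fun setT (xi n m).
  by apply: measurable_funB => //; apply: measurable_funM; exact: measurable_noise_incr.
have SE n w : (0 < n)%N -> \sum_(k < n) U a n k w * U b n k w - horizon * (a == b)%:R =
    \sum_(k < n) xi n k w.
  move=> n0; rewrite sumrB; congr (_ - _); rewrite sumr_const card_ord -mulrnAl.
  by rewrite -[_ / _ *+ n]mulr_natr divfK// pnatr_eq0 -lt0n.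
suff H : small_op P (fun n w => \sum_(k < n) xi n k w).
  apply: small_op_le H _; near=> n => w; rewrite SE//; near: n; exact: nbhs_infty_gt.
apply: small_op_sqr; apply: (@small_op_L1 _ _ _ _ _
  (* [258 = 2 * 128 + 2]: [xi^2] is at most twice the squared product, of expectation at most
     [128 h^2], plus [2 h^2]. *)
  (fun n => 258 * horizon ^+ 2 * n%:R^-1)).
- by move=> n; apply: measurable_funX; exact: measurable_sum.
- by move=> n w; exact: sqr_ge0.
- near=> n; have n0 : (0 < n)%N by near: n; exact: nbhs_infty_gt.
  pose h := horizon / n%:R; pose dab : R := (a == b)%:R.
  have dab2 : dab ^+ 2 <= 1 by rewrite /dab; case: (a == b); rewrite ?expr1n ?expr0n.
  have bnd m w : xi n m w ^+ 2 <= 2 * (U a n m w * U b n m w) ^+ 2 + 2 * h ^+ 2.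
    rewrite /xi -/h -/dab; have := sqr_ge0 (U a n m w * U b n m w + h * dab).
    have : (h * dab) ^+ 2 <= h ^+ 2 by rewrite exprMn ler_piMr// sqr_ge0.
    rewrite sqrrD sqrrB !mulr2n; lra.
  have ibnd m : P.-integrable setT (fun w =>
      (2 * (U a n m w * U b n m w) ^+ 2 + 2 * h ^+ 2)%:E).
    under eq_fun do rewrite EFinD EFinM; apply: integrableD => //.
      by apply: integrableZl => //; exact: (prod_sqr a b m n0).1.
    exact: finite_measure_integrable_cst.
  have i2 m : P.-integrable setT (fun w => (xi n m w ^+ 2)%:E).
    apply: (le_integrable _ _ _ (ibnd m)) => //.
      by apply/measurable_EFinP; exact: measurable_funX.
    move=> w _; rewrite lee_fin ger0_norm ?sqr_ge0// (le_trans (bnd _ _))//.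
    exact: ler_norm.
  have -> : 258 * horizon ^+ 2 * n%:R^-1 = n%:R * (258 * h ^+ 2).
    by rewrite /h; field; rewrite pnatr_eq0 -lt0n.
  apply: martingale_sqr => // m.
  + apply: (@le_trans _ _ (\int[P]_w
      (2 * (U a n m w * U b n m w) ^+ 2 + 2 * h ^+ 2)%:E)%E).
      by apply: le_integral => // w _; rewrite lee_fin.
    under eq_integral do rewrite EFinD EFinM.
    rewrite integralD//; last 2 first.
      by apply: integrableZl => //; exact: (prod_sqr a b m n0).1.
      exact: finite_measure_integrable_cst.
    rewrite integralZl//; last exact: (prod_sqr a b m n0).1.
    rewrite integral_cst//.
    rewrite [X in (_ + _ * X)%E](_ : _ = 1%E) ?mule1; last exact: probability_setT.
    have [_ h1] := prod_sqr a b m n0.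
    apply: (@le_trans _ _ (2%:E * (128 * h ^+ 2)%:E + (2 * h ^+ 2)%:E)%E).
      by rewrite leeD2r// lee_pmul2l// lte_fin.
    by rewrite -EFinM -EFinD lee_fin; lra.
  + have [iab Eab] := prod_mean a b m n0.
    rewrite /xi; under eq_integral do rewrite EFinB.
    rewrite integralB//; last exact: finite_measure_integrable_cst.
    rewrite Eab integral_cst//.
    by rewrite [X in (_ - _ * X)%E](_ : _ = 1%E) ?mule1 ?subee//; exact: probability_setT.
  (* The partial sum involves the noise up to the time [t] of grid point [m] only, so its events lie
     in [F t]; [xi m] is a function of the two increments after [t]. *)
  + move=> A B mA mB.
    have t0 := grid_ge0 n m; set t := m%:R * _ in t0.
    pose G := g_sigma_algebraType (F t).
    have sF : <<s F t >> = F t by apply: sigma_algebra_id; exact: (hF.1 t t0).1.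
    have FS : F t ((fun w => \sum_(k < m) xi n k w) @^-1` A).
      have mW c (s : R) : 0 <= s -> s <= t -> measurable_fun setT (W c s : G -> R).
        move=> s0 st _ C mC; rewrite setTI /measurable/= sF.
        by apply: (hF.2 s t); [rewrite s0|exact: adW].
      have gle k : (k <= m)%N -> k%:R * (horizon / n%:R) <= t.
        by move=> km; rewrite ler_wpM2r ?ler_nat// divr_ge0// ltW.
      have mS : measurable_fun setT ((fun w => \sum_(k < m) xi n k w) : G -> R).
        apply: measurable_sum => k; apply: measurable_funB => //.
        by apply: measurable_funM; apply: measurable_funB; apply: mW => //;
          apply: gle; rewrite ?ltn_ord// ltnW.
      have := mS measurableT A mA; rewrite setTI.
      by rewrite /measurable/= sF.
    have mFS := (hF.1 t t0).2 _ FS.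
    pose D : set (R * R) := (fun z : R * R => z.1 * z.2 - horizon / n%:R * (a == b)%:R)
       @^-1` B.
    have mD : measurable D.
      rewrite -[X in measurable X]setTI.
      have mz : measurable_fun setT
          (fun z : R * R => z.1 * z.2 - horizon / n%:R * (a == b)%:R).
        by apply: measurable_funB => //; apply: measurable_funM.
      exact: mz.
    have := indep_pair_extend mFS (measurable_noise_incr a n m)
      (measurable_noise_incr b n m) _ mD.
    apply => B' C' mB' mC'.
    exact: (@indF a b _ _ (grid_lt m n0) _ _ _ FS mB' mC').
rewrite -[X in _ --> X](mulr0 (258 * horizon ^+ 2)).
apply: cvgM; first exact: cvg_cst.
exact: cvg_invn.
Unshelve. all: by end_near.
Qed.

(** Each fourth power has expectation of order [h^2], so the sum has order [h]. With [c] the inverse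
    squared truncation level this bounds what truncation removes from the Gaussian part, a
    Lindeberg-type estimate. *)
Lemma noise_fourth (c : nat -> R) : (forall n, 0 <= c n) ->
  c n * (horizon / n%:R) @[n --> \oo] --> 0 ->
  small_op P (fun n w => c n * \sum_(k < n) (\sum_a U a n k w ^+ 2) ^+ 2).
Proof.
move=> c0 ch; pose C := #|J|%:R ^+ 2 * 64 * horizon : R.
apply: (@small_op_L1 _ _ _ _ _ (fun n => C * (c n * (horizon / n%:R)))).
- move=> n; apply: measurable_funM => //; apply: measurable_sum => k.
  apply: measurable_funX; apply: measurable_sum => a; apply: measurable_funX.
  exact: measurable_noise_incr.
- move=> n w; rewrite mulr_ge0//; apply: sumr_ge0 => k _; exact: sqr_ge0.
- near=> n; have n0 : (0 < n)%N by near: n; exact: nbhs_infty_gt.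
  pose h := horizon / n%:R.
  have mU4 (a : J) (k : 'I_n) : measurable_fun setT (fun w => (U a n k w ^+ 4)%:E).
    by apply/measurable_EFinP; apply: measurable_funX; exact: measurable_noise_incr.
  have U40 (a : J) (k : 'I_n) w : (0 <= (U a n k w ^+ 4)%:E)%E.
    by rewrite lee_fin -[4%N]/(2 * 2)%N exprM sqr_ge0.
  apply: (@le_trans _ _ (\int[P]_w
     ((c n * #|J|%:R)%:E * \sum_(k < n) \sum_a (U a n k w ^+ 4)%:E))%E).
    apply: ge0_le_integral => //.
    + move=> w _; rewrite lee_fin mulr_ge0//; apply: sumr_ge0 => k _; exact: sqr_ge0.
    + apply/measurable_EFinP; apply: measurable_funM => //; apply: measurable_sum => k.
      apply: measurable_funX; apply: measurable_sum => a; apply: measurable_funX.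
      exact: measurable_noise_incr.
    + apply: measurable_funeM; apply: emeasurable_sum => k; apply: emeasurable_sum => a.
      exact: mU4.
    + move=> w _.
      have -> : (\sum_(k < n) \sum_a (U a n k w ^+ 4)%:E =
          (\sum_(k < n) \sum_a U a n k w ^+ 4)%:E)%E.
        by rewrite -sumEFin; apply: eq_bigr => k _; rewrite sumEFin.
      rewrite -EFinM lee_fin -mulrA ler_wpM2l// mulr_sumr.
      apply: ler_sum => k _; apply: (le_trans (sqr_sum_le _)).
      rewrite ler_wpM2l// ler_sum// => a _.
      by rewrite -exprM.
  rewrite ge0_integralZl; [|exact: measurableT|..]; last 3 first.
  + by apply: emeasurable_sum => k; apply: emeasurable_sum => a; exact: mU4.
  + by move=> w _; apply: sume_ge0 => k _; apply: sume_ge0 => a _; exact: U40.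
  + by rewrite lee_fin mulr_ge0.
  apply: (@le_trans _ _ ((c n * #|J|%:R)%:E *
      (\sum_(k < n) \sum_(a : J) (64 * h ^+ 2)%:E))%E).
    apply: lee_wpmul2l; first by rewrite lee_fin mulr_ge0.
    rewrite ge0_integral_sum//; last 2 first.
    + by move=> k; apply: emeasurable_sum => a; exact: mU4.
    + by move=> k w _; apply: sume_ge0 => a _; exact: U40.
    apply: lee_sum => k _; rewrite ge0_integral_sum//.
    by apply: lee_sum => a _; exact: (noise_expr4 a k n0).2.
  have -> : (\sum_(k < n) \sum_(a : J) (64 * h ^+ 2)%:E =
      (n%:R * (#|J|%:R * (64 * h ^+ 2)))%:E)%E.
    rewrite (eq_bigr (fun=> (#|J|%:R * (64 * h ^+ 2))%:E)) => [|k _].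
      by rewrite sumEFin sumr_const card_ord -[X in X%:E = _]mulr_natl.
    by rewrite sumEFin sumr_const -[X in X%:E = _]mulr_natl.
  rewrite -EFinM lee_fin.
  rewrite le_eqVlt; apply/orP; left; apply/eqP; rewrite /C /h; field.
  by rewrite pnatr_eq0 -lt0n.
rewrite -[X in _ --> X](mulr0 C); apply: cvgM => //; exact: cvg_cst.
Unshelve. all: by end_near.
Qed.

End noise.

(** * Truncated covariation *)

Section truncation.
Context {R : realType} {p : nat}.
Implicit Types (m b : 'cV[R]_p).

Lemma fnorm_sqr m : fnorm m ^+ 2 = \sum_i m i ord0 ^+ 2.
Proof.
have E : \tr (m *m m^T) = \sum_i m i ord0 ^+ 2.
  rewrite /mxtrace; apply: eq_bigr => i _.
  by rewrite mxE big_ord_recl big_ord0 addr0 mxE expr2.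
by rewrite /fnorm E sqr_sqrtr// sumr_ge0// => i _; exact: sqr_ge0.
Qed.

Lemma fnorm_ge0 m : 0 <= fnorm m. Proof. exact: sqrtr_ge0. Qed.

Lemma entry_fnorm m i : m i ord0 ^+ 2 <= fnorm m ^+ 2.
Proof.
rewrite fnorm_sqr (bigD1 i)//= lerDl; apply: sumr_ge0 => j _; exact: sqr_ge0.
Qed.

Lemma entry_mul_fnorm m i j : `|m i ord0 * m j ord0| <= fnorm m ^+ 2.
Proof.
have := entry_fnorm m i; have := entry_fnorm m j.
set x := m i ord0; set y := m j ord0 => hy hx.
rewrite ler_norml; apply/andP; split.
  have := sqr_ge0 (x + y); rewrite sqrrD mulr2n; lra.
by have := sqr_ge0 (x - y); rewrite sqrrB mulr2n; lra.
Qed.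

Lemma fnormD_sqr m b : fnorm (m + b) ^+ 2 <= 2 * fnorm m ^+ 2 + 2 * fnorm b ^+ 2.
Proof.
rewrite !fnorm_sqr !mulr_sumr -big_split/=; apply: ler_sum => i _; rewrite mxE.
have := sqr_ge0 (m i ord0 - b i ord0); rewrite sqrrB sqrrD !mulr2n; lra.
Qed.

Lemma young (e x y : R) : 0 < e -> `|x * y| <= e / 2 * x ^+ 2 + (2 * e)^-1 * y ^+ 2.
Proof.
move=> e0; rewrite normrM -(real_normK (num_real x)) -(real_normK (num_real y)).
move: `|x| `|y| => {}x {}y.
rewrite -subr_ge0 (_ : _ - _ = (2 * e)^-1 * (e * x - y) ^+ 2).
  by rewrite mulr_ge0 ?sqr_ge0// invr_ge0 mulr_ge0// ltW.
by field; rewrite gt_eqF.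
Qed.

(* One observed increment m + b: m is its Gaussian part, b the rest, J tells whether
   a latent process jumps and t is the truncation level. *)
Lemma truncated_product m b (J : bool) (t e : R) i j : 0 < t -> 0 < e ->
  `|(m + b) i ord0 * (m + b) j ord0 * (fnorm (m + b) <= t)%R%:R - m i ord0 * m j ord0|
  <= 2 * t ^+ 2 * J%:R + 4 * (t ^+ 2)^-1 * (fnorm m ^+ 2) ^+ 2 +
     (~~ J)%:R * (1 + e^-1) * fnorm b ^+ 2 + e * fnorm m ^+ 2.
Proof.
move=> t0 e0; have t2 : 0 < t ^+ 2 by rewrite exprn_gt0.
have M0 : 0 <= fnorm m ^+ 2 by exact: sqr_ge0.
have B0 : 0 <= fnorm b ^+ 2 by exact: sqr_ge0.
have eM : 0 <= e * fnorm m ^+ 2 by rewrite mulr_ge0// ltW.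
have eB : 0 <= e^-1 * fnorm b ^+ 2 by rewrite mulr_ge0// invr_ge0 ltW.
have mm := entry_mul_fnorm m i j.
(* Where [|m|^2] is at least a fixed fraction of [t^2], it is dominated by its own square divided by
   [t^2]; this is how exceedances become fourth powers. *)
have MM (c : R) : 0 < c -> t ^+ 2 <= c * fnorm m ^+ 2 ->
    fnorm m ^+ 2 <= c * ((t ^+ 2)^-1 * (fnorm m ^+ 2) ^+ 2).
  move=> c0 h.
  rewrite [leRHS](_ : _ = c * fnorm m ^+ 2 * fnorm m ^+ 2 / t ^+ 2); last by ring.
  by rewrite ler_pdivlMr// [leLHS]mulrC; apply: ler_wpM2r.
have P0 : 0 <= (t ^+ 2)^-1 * (fnorm m ^+ 2) ^+ 2.
  by rewrite mulr_ge0 ?sqr_ge0// invr_ge0 ltW.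
rewrite -(mulrA 4) [_ * _ * fnorm b ^+ 2]mulrAC mulrDr mulr1.
set P := (t ^+ 2)^-1 * _ in MM P0 *.
(* With a jump, the truncated product is at most [t^2], and [|m|^2] is either at most [t^2] or at
   most [P]. *)
case: J => /=; rewrite ?mulr1n ?mulr0n ?mulr1 ?mulr0 ?mul0r ?mul1r ?addr0 ?add0r.
  apply: (@le_trans _ _ (t ^+ 2 + fnorm m ^+ 2)).
    apply: (le_trans (ler_normB _ _)); apply: lerD => //.
    case: (leP (fnorm (m + b)) t) => xt /=; last by rewrite mulr0n mulr0 normr0 ltW.
    rewrite mulr1n mulr1; apply: (le_trans (entry_mul_fnorm _ _ _)).
    by rewrite ler_sqr ?nnegrE ?fnorm_ge0// ltW.
  have [h|h] := leP (fnorm m ^+ 2) (t ^+ 2); first lra.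
  have := MM 1 ltr01; rewrite !mul1r => /(_ (ltW h)); lra.
(* No jump and the increment is kept: the cross terms of [m] and [b] are split by Young's inequality
   with weight [e]. *)
case: (leP (fnorm (m + b)) t) => xt /=; rewrite ?mulr1n ?mulr0n ?mulr1 ?mulr0 ?sub0r ?normrN.
  apply: (@le_trans _ _ (e * fnorm m ^+ 2 + e^-1 * fnorm b ^+ 2 + fnorm b ^+ 2)); last lra.
  rewrite !mxE.
  have -> : (m i ord0 + b i ord0) * (m j ord0 + b j ord0) - m i ord0 * m j ord0 =
     m i ord0 * b j ord0 + m j ord0 * b i ord0 + b i ord0 * b j ord0 by ring.
  apply: (le_trans (ler_normD _ _)); apply: lerD; last exact: entry_mul_fnorm.
  apply: (le_trans (ler_normD _ _)).
  have y1 := young (m i ord0) (b j ord0) e0; have y2 := young (m j ord0) (b i ord0) e0.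
  have e2 : 0 <= e / 2 by rewrite divr_ge0// ltW.
  have e3 : 0 <= (2 * e)^-1 by rewrite invr_ge0 mulr_ge0// ltW.
  have := ler_wpM2l e2 (entry_fnorm m i); have := ler_wpM2l e2 (entry_fnorm m j).
  have := ler_wpM2l e3 (entry_fnorm b i); have := ler_wpM2l e3 (entry_fnorm b j).
  have -> : e^-1 * fnorm b ^+ 2 = 2 * ((2 * e)^-1 * fnorm b ^+ 2) by field; rewrite gt_eqF.
  have -> : e * fnorm m ^+ 2 = 2 * (e / 2 * fnorm m ^+ 2) by field.
  lra.
(* No jump but the increment is cut: either [b] dominates and [|m|^2 <= |b|^2], or [t^2 <= 4 |m|^2]
   and the fourth power takes over. *)
have xt2 : t ^+ 2 < 2 * fnorm m ^+ 2 + 2 * fnorm b ^+ 2.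
  by apply: lt_le_trans (fnormD_sqr _ _); rewrite ltr_sqr ?nnegrE ?fnorm_ge0// ltW.
apply: (le_trans mm).
have [h|h] := leP (fnorm b ^+ 2) (fnorm m ^+ 2); last lra.
have : fnorm m ^+ 2 <= 4 * P by apply: MM => //; lra.
lra.
Qed.

(** Chebyshev's argument: a cut increment without a jump has [t^2 <= |m + b|^2], which is at most
    [2 |m|^2 + 2 |b|^2]. *)
Lemma truncated_count m b (J : bool) (t : R) : 0 < t ->
  `|(fnorm (m + b) <= t)%R%:R - 1| <= J%:R +
    (t ^+ 2)^-1 * (2 * fnorm m ^+ 2 + 2 * ((~~ J)%:R * fnorm b ^+ 2)).
Proof.
move=> t0; have t2 : 0 < t ^+ 2 by rewrite exprn_gt0.
have M0 : 0 <= fnorm m ^+ 2 by exact: sqr_ge0.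
have B0 : 0 <= fnorm b ^+ 2 by exact: sqr_ge0.
have ti : 0 <= (t ^+ 2)^-1 by rewrite invr_ge0 ltW.
case: (leP (fnorm (m + b)) t) => xt /=; rewrite ?mulr1n ?mulr0n ?subrr ?normr0.
  by rewrite addr_ge0// mulr_ge0// addr_ge0// mulr_ge0// mulr_ge0.
rewrite sub0r normrN normr1; case: J => /=; rewrite ?mulr1n ?mulr0n.
  by rewrite mul0r mulr0 addr0 lerDl mulr_ge0// mulr_ge0.
rewrite add0r mul1r mulrC ler_pdivlMr// mul1r.
by apply: le_trans (fnormD_sqr _ _); rewrite ler_sqr ?nnegrE ?fnorm_ge0// ltW.
Qed.

End truncation.

Section truncated_sums.
Context d (T : measurableType d) {R : realType} (P : probability T R).
Context {p : nat} {J : finType}.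
Variables (U : J -> nat -> nat -> T -> R) (L : 'I_p -> J -> R) (horizon : R).
Variables (dx : nat -> nat -> T -> 'cV[R]_p) (jump : nat -> nat -> T -> bool).
Variable tau : nat -> R.

Definition gaussian_part n k w : 'cV[R]_p := \col_i \sum_a L i a * U a n k w.
Local Notation G := gaussian_part.
Definition drift_part n k w : 'cV[R]_p := dx n k w - G n k w.

Hypotheses (horizon0 : 0 < horizon)
  (lln : forall a b, small_op P (fun n w =>
    \sum_(k < n) U a n k w * U b n k w - horizon * (a == b)%:R))
  (fourth : small_op P (fun n w =>
    (tau n ^+ 2)^-1 * \sum_(k < n) (\sum_a U a n k w ^+ 2) ^+ 2))
  (jumps : forall c : nat -> R, c n @[n --> \oo] --> 0 ->
    small_op P (fun n w => c n * \sum_(k < n) (jump n k w)%:R))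
  (drift : small_op P (fun n w =>
    \sum_(k < n) (~~ jump n k w)%:R * fnorm (drift_part n k w) ^+ 2))
  (tau_gt0 : \forall n \near \oo, 0 < tau n)
  (tau_cvg0 : tau n ^+ 2 @[n --> \oo] --> 0)
  (step_tau : (n%:R * tau n ^+ 2)^-1 @[n --> \oo] --> 0).

Let CL := #|J|%:R * \sum_i \sum_a L i a ^+ 2.

Let CL0 : 0 <= CL.
Proof.
by rewrite mulr_ge0//; apply: sumr_ge0 => i _; apply: sumr_ge0 => a _; exact: sqr_ge0.
Qed.

Let s n k w := \sum_a U a n k w ^+ 2.

Let s0 n k w : 0 <= s n k w.
Proof. by apply: sumr_ge0 => a _; exact: sqr_ge0. Qed.

Let gaussian_le n k w : fnorm (G n k w) ^+ 2 <= CL * s n k w.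
Proof.
rewrite fnorm_sqr /CL -mulrA mulr_suml mulr_sumr; apply: ler_sum => i _.
rewrite mxE; apply: (le_trans (sqr_sum_le _)); rewrite ler_wpM2l//.
rewrite mulr_suml; apply: ler_sum => a _; rewrite exprMn ler_wpM2l ?sqr_ge0//.
rewrite /s (bigD1 a)//= lerDl; apply: sumr_ge0 => b _; exact: sqr_ge0.
Qed.

Let sum_s : small_op P (fun n w => \sum_(k < n) s n k w - #|J|%:R * horizon).
Proof.
apply: (small_op_le (@small_op_sum _ _ _ P _ (index_enum J) _ (fun a => lln a a))).
near=> n => w.
have -> : \sum_(k < n) s n k w - #|J|%:R * horizon =
  \sum_a (\sum_(k < n) U a n k w * U a n k w - horizon * (a == a)%:R).
  rewrite sumrB exchange_big/=; congr (_ - _).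
  under eq_bigr do rewrite eqxx mulr1.
  by rewrite sumr_const -[RHS]mulr_natl.
by [].
Unshelve. all: by end_near.
Qed.

(** Summing [truncated_product] gives four sums: a bounded jump count times [tau^2], fourth powers
    over [tau^2], squared drift, and [e] times the quadratic variation. What is left is the
    covariation of the Gaussian part, a combination of the limits in [lln]. *)
Lemma truncated_covariation i j : small_op P (fun n w =>
  \sum_(k < n) dx n k w i ord0 * dx n k w j ord0 * (fnorm (dx n k w) <= tau n)%R%:R
  - horizon * \sum_a L i a * L j a).
Proof.
have main : small_op P (fun n w => \sum_(k < n)
    (dx n k w i ord0 * dx n k w j ord0 * (fnorm (dx n k w) <= tau n)%R%:R
     - G n k w i ord0 * G n k w j ord0)).
  (* The constant is the limit of the bound [CL * \sum_k s n k] on the Gaussian quadratic variation,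
     the term multiplied by [e]. *)
  apply: (@small_op_approx _ _ _ _ _ (CL * (#|J|%:R * horizon))) => e e0.
  exists (fun n w => (2 * tau n ^+ 2 * \sum_(k < n) (jump n k w)%:R +
    4 * CL ^+ 2 * ((tau n ^+ 2)^-1 * \sum_(k < n) (s n k w) ^+ 2)) +
    (1 + e^-1) * \sum_(k < n) (~~ jump n k w)%:R * fnorm (drift_part n k w) ^+ 2).
  exists (fun n w => CL * (\sum_(k < n) s n k w - #|J|%:R * horizon)).
  split.
  - apply: small_opD; last exact: small_opZ.
    apply: small_opD; last exact: small_opZ.
    apply: jumps; rewrite -[X in _ --> X](mulr0 2).
    by apply: cvgM => //; exact: cvg_cst.
  - exact: small_opZ.
  near=> n => w; have t0 : 0 < tau n by near: n.
  have t2 : 0 <= (tau n ^+ 2)^-1 by rewrite invr_ge0 sqr_ge0.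
  apply: (le_trans (ler_norm_sum _ _ _)).
  apply: (@le_trans _ _ (\sum_(k < n) (2 * tau n ^+ 2 * (jump n k w)%:R +
     4 * CL ^+ 2 * ((tau n ^+ 2)^-1 * s n k w ^+ 2) +
     (1 + e^-1) * ((~~ jump n k w)%:R * fnorm (drift_part n k w) ^+ 2) +
     e * (CL * s n k w)))).
    apply: ler_sum => k _.
    have := truncated_product (G n k w) (drift_part n k w) (jump n k w) i j t0 e0.
    rewrite (_ : G n k w + drift_part n k w = dx n k w); last by rewrite addrC subrK.
    move=> /le_trans; apply.
    have g := gaussian_le n k w; have g0 : 0 <= fnorm (G n k w) ^+ 2 by exact: sqr_ge0.
    apply: lerD; last by rewrite ler_wpM2l// ltW.
    apply: lerD; last by rewrite [leRHS]mulrCA mulrA.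
    apply: lerD => //.
    rewrite [leRHS](_ : _ = 4 * (tau n ^+ 2)^-1 * (CL * s n k w) ^+ 2); last by ring.
    apply: ler_wpM2l; first by rewrite mulr_ge0.
    by rewrite ler_sqr ?nnegrE// mulr_ge0.
  rewrite !big_split/= -!mulr_sumr; apply: lerD; first exact: ler_norm.
  rewrite ler_wpM2l ?(ltW e0)//.
  have := ler_norm (CL * (\sum_(k < n) s n k w - #|J|%:R * horizon)).
  by rewrite mulrBr; lra.
have gauss : small_op P (fun n w => \sum_a \sum_b L i a * L j b *
    (\sum_(k < n) U a n k w * U b n k w - horizon * (a == b)%:R)).
  by apply: small_op_sum => a; apply: small_op_sum => b; exact: small_opZ.
apply: small_op_le (small_opD main gauss) _; near=> n => w.
rewrite le_eqVlt; apply/orP; left; apply/eqP; congr (`|_|).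
rewrite sumrB -addrA; congr (_ + _).
have -> : \sum_a \sum_b L i a * L j b *
    (\sum_(k < n) U a n k w * U b n k w - horizon * (a == b)%:R) =
   \sum_(k < n) G n k w i ord0 * G n k w j ord0 - horizon * \sum_a L i a * L j a.
  under eq_bigr => a _.
    under eq_bigr do rewrite mulrBr; rewrite sumrB; over.
  rewrite sumrB; congr (_ - _); last first.
    rewrite mulr_sumr; apply: eq_bigr => a _.
    rewrite (bigD1 a)//= eqxx mulr1 big1 ?addr0; last first.
      by move=> b; rewrite eq_sym => /negbTE ->; rewrite !mulr0.
    by rewrite mulrC.
  under eq_bigr => a _ do under eq_bigr do rewrite mulr_sumr.
  under eq_bigr => a _ do rewrite exchange_big/=.
  rewrite exchange_big/=; apply: eq_bigr => k _.
  rewrite !mxE mulr_suml; apply: eq_bigr => a _.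
  by rewrite mulr_sumr; apply: eq_bigr => b _; ring.
by rewrite addrA addNr add0r.
Unshelve. all: by end_near.
Qed.

(** After division by [n], the quadratic variation and squared drift in [truncated_count] carry the
    factor [1 / (n tau^2)], which tends to 0 while the sums themselves stay bounded in
    probability. *)
Lemma truncated_number : small_op P (fun n w =>
  n%:R^-1 * \sum_(k < n) (fnorm (dx n k w) <= tau n)%R%:R - 1).
Proof.
have oS := small_opD sum_s drift.
pose c n := (n%:R * tau n ^+ 2)^-1.
have oc (Z : nat -> T -> R) : small_op P Z -> small_op P (fun n w => c n * Z n w).
  move=> oZ; apply: (small_op_le oZ).
  have : \forall n \near \oo, `|0 - c n| <= 1 by move/cvgrPdist_le : step_tau; exact.
  apply: filterS => n; rewrite sub0r normrN => cn w.
  by rewrite normrM ler_piMl.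
have occ (b : R) : small_op P (fun n (w : T) => c n * b).
  exact: (@small_op_tight _ _ _ P (fun=> b) c (@measurable_cst _ _ _ _ setT b) step_tau).
have H := small_opD (jumps cvg_invn)
  (small_opD (small_opZ (2 * CL) (oc _ sum_s))
    (small_opD (occ (2 * CL * (#|J|%:R * horizon))) (small_opZ 2 (oc _ drift)))).
apply: (small_op_le H); near=> n => w.
have t0 : 0 < tau n by near: n.
have n0 : 0 < n%:R :> R by rewrite ltr0n; near: n; exact: nbhs_infty_gt.
apply: le_trans (ler_norm _).
have -> : n%:R^-1 * \sum_(k < n) (fnorm (dx n k w) <= tau n)%R%:R - 1 =
   n%:R^-1 * \sum_(k < n) ((fnorm (dx n k w) <= tau n)%R%:R - 1) :> R.
  rewrite big_split/= sumr_const card_ord mulrDr; congr (_ + _).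
  by rewrite -[X in _ = _ * X]mulr_natl mulKf// gt_eqF.
rewrite normrM (ger0_norm (ltW (_ : 0 < n%:R^-1))) ?invr_gt0//.
apply: (@le_trans _ _ (n%:R^-1 * \sum_(k < n) ((jump n k w)%:R +
  (tau n ^+ 2)^-1 * (2 * (CL * s n k w) +
     2 * ((~~ jump n k w)%:R * fnorm (drift_part n k w) ^+ 2))))).
  rewrite ler_wpM2l ?invr_ge0 ?(ltW n0)//; apply: (le_trans (ler_norm_sum _ _ _)).
  apply: ler_sum => k _.
  have := truncated_count (G n k w) (drift_part n k w) (jump n k w) t0.
  rewrite (_ : G n k w + drift_part n k w = dx n k w); last by rewrite addrC subrK.
    move=> /le_trans; apply.
  rewrite lerD2l ler_wpM2l ?invr_ge0 ?sqr_ge0// lerD2r ler_wpM2l//.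
rewrite big_split/= mulrDr lerD2l -mulr_sumr big_split/= -!mulr_sumr.
rewrite [leLHS]mulrA -invfM -/(c n) le_eqVlt; apply/orP; left; apply/eqP; ring.
Unshelve. all: by end_near.
Qed.

End truncated_sums.

(** * Jump diffusions observed on a grid *)

Section integral_increments.
Context {R : realType}.
Local Notation mu := (@lebesgue_measure R).

Lemma Rintegral_oc_split (f : R -> R) (s t : R) : 0 <= s <= t ->
  mu.-integrable `]0, t] (EFin \o f) ->
  \int[mu]_(x in `]0, t]) f x =
  \int[mu]_(x in `]0, s]) f x + \int[mu]_(x in `]s, t]) f x.
Proof.
move=> /andP[s0 st] intf.
have := @Rintegral_itvB R f _ _ s intf; rewrite !bnd_simp => /(_ s0 st) <-.
by rewrite addrC subrK.
Qed.

Lemma sum_Rintegral_grid (f : R -> R) (h : R) (m : nat) : 0 <= h ->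
  mu.-integrable `]0, (m%:R * h)] (EFin \o f) ->
  \sum_(k < m) \int[mu]_(x in `](k%:R * h), (k.+1%:R * h)]) f x =
  \int[mu]_(x in `]0, (m%:R * h)]) f x.
Proof.
move=> h0; elim: m => [|m IH] intf.
  rewrite big_ord0 mul0r; have -> : `]0, 0]%classic = set0 :> set R.
    by apply/seteqP; split => x //=; rewrite in_itv/= => /andP[a b];
      move: (lt_le_trans a b); rewrite ltxx.
  by rewrite Rintegral_set0.
have mm : m%:R * h <= m.+1%:R * h by rewrite ler_wpM2r// ler_nat.
rewrite big_ord_recr/= IH; last first.
  apply: integrableS intf => // x /=; rewrite !in_itv/= => /andP[-> xm]/=.
  exact: le_trans mm.
by rewrite -Rintegral_oc_split// mm andbT mulr_ge0.
Qed.

(** Absolute continuity makes the integral of [|f|] over every short interval at most [e']; one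
    factor of each square is bounded by [e'] and the other factors add up to the integral of [|f|]
    over []0, T]]. Integrability of [f] suffices, without a bound. *)
Lemma sum_sqr_integral_grid (f : R -> R) (T : R) : 0 < T ->
  mu.-integrable `]0, T] (EFin \o f) ->
  \sum_(k < n) (\int[mu]_(x in `](k%:R * (T / n%:R)), (k.+1%:R * (T / n%:R))]) f x) ^+ 2
   @[n --> \oo] --> (0 : R).
Proof.
move=> T0 intf.
have intn : mu.-integrable `]0, T] (EFin \o (fun x => `|f x|)).
  by have := integrable_abse intf.
pose I := \int[mu]_(x in `]0, T]) `|f x|.
have I0 : 0 <= I by apply: Rintegral_ge0.
pose g := f \_ `]0, T].
have intg : mu.-integrable setT (EFin \o g).
  by have /(integrable_mkcond _ _).1 := intf; rewrite /g restrict_EFin; exact.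
apply/cvgrPdist_le => e e0.
pose e' := e / (I + 1).
have e'0 : 0 < e' by rewrite divr_gt0// ltr_wpDl.
have [d [d0 Hd]] := integral_normr_continuous intg e'0.
near=> n.
have n0 : 0 < n%:R :> R by rewrite ltr0n; near: n; exact: nbhs_infty_gt.
have nT : n%:R * (T / n%:R) = T by rewrite mulrC divfK// gt_eqF.
have h0 : 0 < T / n%:R by rewrite divr_gt0.
pose A (k : nat) : set R := `](k%:R * (T / n%:R)), (k.+1%:R * (T / n%:R))]%classic.
have AT (k : 'I_n) : A k `<=` `]0, T].
  move=> x /=; rewrite /A/= !in_itv/= => /andP[kx xk]; apply/andP; split.
    by apply: le_lt_trans kx; rewrite mulr_ge0// ltW.
  by apply: (le_trans xk); rewrite -[leRHS]nT ler_wpM2r ?(ltW h0)// ler_nat.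
have intA (k : 'I_n) : mu.-integrable (A k) (EFin \o f).
  by apply: integrableS intf => //; exact: measurable_itv.
have small (k : 'I_n) : \int[mu]_(x in A k) `|f x| <= e'.
  have -> : \int[mu]_(x in A k) `|f x| = \int[mu]_(x in A k) `|g x|.
    by apply: eq_Rintegral => x; rewrite inE => /AT xT; rewrite /g patchE mem_set.
  apply/ltW/Hd; first exact: measurable_itv.
  rewrite [X in (X < _)%E](_ : _ = (T / n%:R)%:E); last first.
    apply: eq_trans (lebesgue_measure_itv _) _ => /=.
    rewrite lte_fin ltr_pM2r// ltr_nat ltnS leqnn -EFinB -mulrBl.
    by rewrite -natr1 addrAC subrr add0r mul1r.
  rewrite lte_fin.
  rewrite ltr_pdivrMr// mulrC -ltr_pdivrMr//; near: n; exact: nbhs_infty_gtr.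
rewrite sub0r normrN ger0_norm; last by apply: sumr_ge0 => k _; exact: sqr_ge0.
apply: (@le_trans _ _ (\sum_(k < n) e' * \int[mu]_(x in A k) `|f x|)).
  apply: ler_sum => k _; rewrite -(real_normK (num_real _)) expr2.
  have h : `|\int[mu]_(x in A k) f x| <= \int[mu]_(x in A k) `|f x|.
    by apply: le_normr_Rintegral => //; exact: measurable_itv.
  by apply: ler_pM => //; exact: le_trans (small k).
rewrite -mulr_sumr /A sum_Rintegral_grid ?(ltW h0) ?nT//.
rewrite -/I /e' mulrAC ler_pdivrMr ?ltr_wpDl// ler_wpM2l ?(ltW e0)//.
by rewrite lerDl.
Unshelve. all: by end_near.
Qed.

End integral_increments.

Section poisson_finite.
Context {R : realType} d (Omega : measurableType d) (P : probability Omega R).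

Lemma measurable_punctured n : measurable (@punctured R n).
Proof.
apply: open_measurable_mx; rewrite /punctured.
rewrite (_ : [set z | z != 0] = ~` [set 0]); last first.
  by apply/seteqP; split => z /= /eqP.
by rewrite openC; exact/accessible_closed_set1/hausdorff_accessible/norm_hausdorff.
Qed.

(** The Poisson weights sum to 1 by the exponential series, so the disjoint events of integer values
    exhaust the probability space and infinity has probability 0. *)
Lemma poisson_law_finite (K : Omega -> \bar R) (l : R) : measurable_fun setT K ->
  (forall k : nat, P [set w | K w = k%:R%:E] = (expR (- l) * l ^+ k / k`!%:R)%:E) ->
  {ae P, forall w, exists k : nat, K w = k%:R%:E}.
Proof.
move=> mK PK.
pose A k := [set w | K w = k%:R%:E].
have mA k : measurable (A k).
  have -> : A k = K @^-1` [set k%:R%:E] by [].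
  by rewrite -[X in measurable X]setTI; exact: mK.
have tA : trivIset setT A.
  apply/trivIsetP => i j _ _ ij; apply/seteqP; split => // w [].
  by rewrite /A/= => -> [] /eqP; rewrite eqr_nat (negbTE ij).
have mU : measurable (\bigcup_k A k) by exact: bigcupT_measurable.
have PU : P (\bigcup_k A k) = 1%E.
  rewrite measure_bigcup//=.
  apply/cvg_lim => //.
  have -> : (fun n => \sum_(0 <= k < n | (k \in setT)) P (A k))%E =
      EFin \o (fun n => expR (- l) * series (exp_coeff l) n).
    apply/funext => n /=; rewrite /series/= mulr_sumr -sumEFin.
    rewrite (eq_bigl predT); last by move=> k; exact/mem_set.
    by apply: eq_bigr => k _; rewrite PK /exp_coeff/= mulrA.
  apply: cvg_EFin; first by near=> n.
  rewrite -[X in _ --> X](_ : expR (- l) * expR l = 1); last by rewrite expRN mulVf// expR_eq0.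
  apply: cvgM; first exact: cvg_cst.
  exact: is_cvg_series_exp_coeff.
exists (~` \bigcup_k A k); split; first exact: measurableC.
  by rewrite probability_setC// PU subee.
by move=> w /= h; apply: contra_not h => -[k _ Ak]; exists k.
Unshelve. all: by end_near.
Qed.

End poisson_finite.

Section mutual_independence_lemmas.
Context d (T : measurableType d) {R : realType} (P : probability T R).
Variables (I : finType) (G : I -> set (set T)).
Hypothesis indG : mutual_independence P G.

Lemma mutual_independence2 (x y : I) (A B : set T) : x != y -> G x A -> G y B ->
  (P (A `&` B) = P A * P B)%E.
Proof.
move=> xy GA GB; pose E i := if i == x then A else B.
have := indG (J := [set x; y]%SET) (E := E) => /(_ _).
rewrite big_setU1/= ?inE// big_set1 /E eqxx eq_sym (negbTE xy) => <-.
  congr (P _); apply/seteqP; split => [w [Aw Bw] i /=|w h].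
    by rewrite !inE; case: ifP => // _ /=.
  split; first by have := h x; rewrite /= !inE !eqxx => /(_ isT).
  by have := h y; rewrite /= !inE eqxx orbT eq_sym (negbTE xy) => /(_ isT).
by move=> i; rewrite !inE => /orP[/eqP ->|/eqP ->]; rewrite ?eqxx// eq_sym (negbTE xy).
Qed.

Lemma mutual_independence3 (x y z : I) (A B C : set T) :
  x != y -> x != z -> y != z -> G x A -> G y B -> G z C ->
  (P (A `&` (B `&` C)) = P A * (P B * P C))%E.
Proof.
move=> xy xz yz GA GB GC; pose E i := if i == x then A else if i == y then B else C.
have yx : (y == x) = false by rewrite eq_sym (negbTE xy).
have zx : (z == x) = false by rewrite eq_sym (negbTE xz).
have zy : (z == y) = false by rewrite eq_sym (negbTE yz).
have := indG (J := [set x; y; z]%SET) (E := E) => /(_ _).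
rewrite -finset.setUA big_setU1/= ?inE ?negb_or ?xy// big_setU1/= ?inE// big_set1.
rewrite /E !eqxx yx zx zy => <-.
  congr (P _); apply/seteqP; split => [w [Aw [Bw Cw]] i /=|w h].
    by case: ifP => //; case: ifP.
  split; [|split].
  - by have := h x; rewrite /= !inE !eqxx => /(_ isT).
  - by have := h y; rewrite /= !inE eqxx orbT yx => /(_ isT).
  - by have := h z; rewrite /= !inE eqxx !orbT zx zy => /(_ isT).
move=> i; rewrite !inE => /or3P[/eqP ->|/eqP ->|/eqP ->];
  by rewrite ?eqxx ?yx ?zx ?zy.
Qed.

End mutual_independence_lemmas.

(** * Coordinates of the Wiener processes as one family *)

Section wiener_noise.
Context d (Omega : measurableType d) {R : realType} (P : probability Omega R).
Variables (F : R -> set (set Omega)) (I : finType) (n_ r_ : I -> nat).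
Variables (W : forall i, R -> Omega -> 'cV[R]_(r_ i))
  (mu : forall i, R.-ker Omega ~> (R * 'cV[R]_(n_ i))%type).
Hypotheses (hF : filtration F) (hW : forall i, wiener_process P F (W i))
  (hindep : forall t, 0 <= t -> mutual_independence P (driving_sigma F W mu t)).

Let J := {i : I & 'I_(r_ i)}.

(** The Wiener processes have different dimensions; pairing a process index with a coordinate gives
    one finite family of real noises, the form used in the law of large numbers. *)
Definition scalar_noise (a : J) (t : R) (w : Omega) : R :=
  W (tag a) t w (tagged a) ord0.
Local Notation N := scalar_noise.
Local Notation tag_ j := (Tagged (fun i => 'I_(r_ i)) j).

Lemma scalar_noise_adapted a t : 0 <= t -> forall B, measurable B -> F t (N a t @^-1` B).
Proof.
move=> t0 B mB; apply: (wiener_adapted (hW (tag a)) t0).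
exists ((fun A : 'cV[R]_(r_ (tag a)) => A (tagged a) ord0) @^-1` B).
  by rewrite -[X in measurable X]setTI; exact: measurable_mx_entry.
by rewrite setTI.
Qed.

Let incr_sigma a s t B : 0 <= s < t -> measurable B ->
  driving_sigma F W mu s (Some (inl (tag a))) ((fun w => N a t w - N a s w) @^-1` B).
Proof.
move=> /andP[s0 st] mB; apply: sub_sigma_algebra; exists t; first exact: ltW.
exists ((fun A : 'cV[R]_(r_ (tag a)) => A (tagged a) ord0) @^-1` B).
  by rewrite -[X in measurable X]setTI; exact: measurable_mx_entry.
by rewrite setTI; apply/seteqP; split => w /=; rewrite !mxE.
Qed.

(** One formula for equal and distinct coordinates: each coordinate receives the constraints
    addressed to it and [setT] otherwise, so [j = j'] yields an intersection in a single factor. *)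
Let same_family i (j j' : 'I_(r_ i)) s t A B C : 0 <= s < t -> F s A ->
  measurable B -> measurable C ->
  (P (A `&` ((fun w => N (tag_ j) t w - N (tag_ j) s w)%R @^-1` B `&`
             (fun w => N (tag_ j') t w - N (tag_ j') s w)%R @^-1` C)) =
  P A * \prod_(l < r_ i) normal_prob 0%R (Num.sqrt (t - s)%R)
    ((if l == j then B else setT) `&` (if l == j' then C else setT)))%E.
Proof.
move=> st FA mB mC.
rewrite -(wiener_increment (hW i) st FA); last first.
  by move=> l; apply: measurableI; case: ifP.
congr (P (_ `&` _)); apply/seteqP; split => w /=.
  move=> [Bw Cw] l; rewrite !mxE; split.
    by case: eqP => // ->.
  by case: eqP => // ->.
move=> h; split.
  by have [+ _] := h j; rewrite eqxx !mxE.
by have [_ +] := h j'; rewrite eqxx !mxE.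
Qed.

Let FT s : 0 <= s -> F s setT.
Proof. by move=> s0; have [[F0 FC _] _] := hF.1 s s0; rewrite -(setD0 setT); exact: FC. Qed.

Let normalT (s : R) : normal_prob 0 s setT = 1%E.
Proof. by rewrite /normal_prob integral_normal_pdf. Qed.

Lemma scalar_noise_law a s t : 0 <= s < t -> forall B, measurable B ->
  P ((fun w => N a t w - N a s w) @^-1` B) = normal_prob 0 (Num.sqrt (t - s)) B.
Proof.
case: a => i j st B mB; have s0 : 0 <= s by case/andP: st.
have := same_family j j st (FT s0) mB measurableT.
rewrite setTI preimage_setT setIT => ->; rewrite probability_setT mul1e.
rewrite (bigD1 j)//= eqxx setIT big1 ?mule1// => l lj.
by rewrite (negbTE lj) setTI.
Qed.

Lemma scalar_noise_indep a b s t : a != b -> 0 <= s < t -> forall B C,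
  measurable B -> measurable C ->
  let U := fun w => (N a t w - N a s w)%R in
  let V := fun w => (N b t w - N b s w)%R in
  (P (U @^-1` B `&` V @^-1` C) = P (U @^-1` B) * P (V @^-1` C))%E.
Proof.
move=> ab st B C mB mC /=; have s0 : 0 <= s by case/andP: st.
rewrite !scalar_noise_law//.
case: a b ab => i j [i' j'] ab; have [ii'|ii'] := eqVneq i i'; last first.
  rewrite -(scalar_noise_law (tag_ j) st mB).
  rewrite -(scalar_noise_law (tag_ j') st mC).
  have ii : Some (inl i) != Some (inl i') :> option (I + I) by [].
  apply: (mutual_independence2 (hindep s0) ii).
  - exact: (@incr_sigma (tag_ j) _ _ _ st mB).
  - exact: (@incr_sigma (tag_ j') _ _ _ st mC).
case: _ / ii' j' ab => j' ab.
have jj' : j != j' by apply: contraNN ab => /eqP ->.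
have := same_family j j' st (FT s0) mB mC; rewrite setTI => ->.
rewrite probability_setT mul1e (bigD1 j)//= eqxx (negbTE jj') setIT.
rewrite (bigD1 j')//= ?eqxx; last by rewrite eq_sym.
rewrite eq_sym (negbTE jj') setTI big1 ?mule1// => l /andP[lj lj'].
by rewrite (negbTE lj) (negbTE lj') setTI.
Qed.

(** Within one process the independence from [F s] is part of the increment law; for two processes
    it comes from the mutual independence of [F s] and both noise sigma-algebras. *)
Lemma scalar_noise_indepF a b s t : 0 <= s < t -> forall A B C, F s A ->
  measurable B -> measurable C ->
  let U := fun w => (N a t w - N a s w)%R in
  let V := fun w => (N b t w - N b s w)%R in
  (P (A `&` (U @^-1` B `&` V @^-1` C)) = P A * P (U @^-1` B `&` V @^-1` C))%E.
Proof.
move=> st A B C FA mB mC /=; have s0 : 0 <= s by case/andP: st.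
case: a b => i j [i' j']; have [ii'|ii'] := eqVneq i i'.
  case: _ / ii' j' => j'; rewrite same_family//.
  have := same_family j j' st (FT s0) mB mC; rewrite setTI => ->.
  by rewrite probability_setT mul1e.
have ii : Some (inl i) != Some (inl i') :> option (I + I) by [].
have sB := @incr_sigma (tag_ j) _ _ _ st mB.
have sC := @incr_sigma (tag_ j') _ _ _ st mC.
rewrite (mutual_independence2 (hindep s0) ii sB sC).
exact: (mutual_independence3 (hindep s0) (x := None) _ _ ii FA sB sC).
Qed.

End wiener_noise.

Section sde_increment.
Context d (Omega : measurableType d) {R : realType} (P : probability Omega R).
Context {n r : nat}.
Variables (a : 'cV[R]_n -> 'cV[R]_n) (S : 'M[R]_(n, r))
  (c : 'cV[R]_n -> 'cV[R]_n -> 'cV[R]_n) (x0 : 'cV[R]_n)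
  (W : R -> Omega -> 'cV[R]_r) (mu : R.-ker Omega ~> (R * 'cV[R]_n)%type)
  (Y : R -> Omega -> 'cV[R]_n).
Hypothesis sde : solves_jump_sde P a S c x0 W mu Y.

Local Notation slab s t := (`]s%R, t%R]%classic `*` @punctured R n).

Lemma measurable_slab (s t : R) : measurable (slab s t).
Proof. by apply: measurableX; [exact: measurable_itv|exact: measurable_punctured]. Qed.

Lemma slabD (s t : R) : 0 <= s <= t -> slab 0 t `\` slab s t = slab 0 s.
Proof.
move=> /andP[s0 st]; apply/seteqP; split => -[x z] /=; rewrite !in_itv/=.
  move=> [[/andP[xp xt] Ez] h]; split => //; rewrite xp/= leNgt; apply/negP => sx.
  by apply: h; rewrite sx xt.
move=> [/andP[xp xs] Ez]; split; first by rewrite xp (le_trans xs).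
by move=> [/andP[/(le_lt_trans xs)]]; rewrite ltxx.
Qed.

Lemma slab_split (s t : R) : 0 <= s <= t -> slab 0 t = slab 0 s `|` slab s t.
Proof.
move=> st; rewrite -(slabD st) setUC setDUK// => -[x z] /= []; rewrite !in_itv/=.
by move=> /andP[sx ->] Ez; case/andP: st => s0 _; rewrite (le_lt_trans s0 sx).
Qed.

(** The jump integrals over []0, t]] and []0, s]] differ by a slab of measure zero, so they cancel
    and only the drift remains. The exceptional null set is common to all [s] and [t]. *)
Lemma sde_no_jump : {ae P, forall w, forall s t, 0 <= s <= t ->
  mu w (slab s t) = 0%E -> forall j : 'I_n,
  Y t w j ord0 - Y s w j ord0 - ((S *m W t w) j ord0 - (S *m W s w) j ord0) =
  \int[lebesgue_measure]_(u in `]s, t]) a (left_limit (Y ^~ w) u) j ord0}.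
Proof.
apply: filterS2 (sde_integrable sde) (sde_equation sde) => w iw ew s t /andP[s0 st] m0 j.
have t0 : 0 <= t by exact: le_trans st.
have [ia ic] := iw t t0 j.
rewrite (ew t t0 j) (ew s s0 j).
have -> : \int[lebesgue_measure]_(u in `]0, t]) a (left_limit (Y ^~ w) u) j ord0 =
   \int[lebesgue_measure]_(u in `]0, s]) a (left_limit (Y ^~ w) u) j ord0 +
   \int[lebesgue_measure]_(u in `]s, t]) a (left_limit (Y ^~ w) u) j ord0.
  by rewrite -Rintegral_oc_split// s0.
have -> : \int[mu w]_(sz in slab 0 t) c (left_limit (Y ^~ w) sz.1) sz.2 j ord0 =
   \int[mu w]_(sz in slab 0 s) c (left_limit (Y ^~ w) sz.1) sz.2 j ord0.
  by rewrite /Rintegral (negligible_integral (measurable_slab s t) (measurable_slab 0 t) ic m0)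
    slabD ?s0.
ring.
Qed.

End sde_increment.

Section jump_count.
Context d (Omega : measurableType d) {R : realType} (P : probability Omega R).
Context {n : nat}.
Variables (mu : R.-ker Omega ~> (R * 'cV[R]_n)%type) (f : 'cV[R]_n -> R) (T : R).
Hypotheses (hmu : poisson_random_measure P mu f) (T0 : 0 < T)
  (hint : (intensity f (`]0%R, T]%classic `*` @punctured R n) < +oo)%E).

Local Notation slab s t := (`]s%R, t%R]%classic `*` @punctured R n).

(** The measure takes integer or infinite values, so every slab with nonzero mass has mass at least
    1. Their number is thus at most the total mass over []0, T]], which is almost surely finite and
    does not depend on [m]. *)
Lemma jump_count_finite : {ae P, forall w, exists K : R, forall m, (0 < m)%N ->
  \sum_(k < m) (mu w (slab (k%:R * (T / m%:R)) (k.+1%:R * (T / m%:R))) != 0%E)%:R <= K}.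
Proof.
have mS := @measurable_slab R n.
have := poisson_law_finite (measurable_kernel mu _ (mS 0 T))
  (prm_law hmu (mS 0 T) hint).
apply: filterS => w [K KE]; exists K%:R => m m0.
pose h := T / m%:R; have h0 : 0 <= h by rewrite divr_ge0// ltW.
have key (x : \bar R) : x = +oo%E \/ (exists k : nat, x = k%:R%:E) ->
    ((x != 0%E)%:R%:E <= x)%E.
  move=> [->|[l ->]]; first by rewrite leey.
  by case: l => [|l]; rewrite ?eqxx// lee_fin; case: (_ != _) => //; rewrite ler1n.
have H k : (\sum_(i < k) (mu w (slab (i%:R * h) (i.+1%:R * h)) != 0%E)%:R%:E <=
    mu w (slab 0 (k%:R * h)))%E.
  elim: k => [|k IH]; first by rewrite big_ord0.
  have kk : 0 <= k%:R * h <= k.+1%:R * h.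
    by rewrite mulr_ge0// ler_wpM2r// ler_nat.
  rewrite big_ord_recr/= (slab_split kk) measureU//; last 1 first.
    by rewrite -(slabD kk) setDKI.
  apply: leeD => //.
  apply: key; exact: (prm_integer hmu w (mS (k%:R * h) (k.+1%:R * h))).
have mh : m%:R * h = T by rewrite mulrC divfK// pnatr_eq0 -lt0n.
by have := H m; rewrite mh KE sumEFin lee_fin.
Qed.

End jump_count.

Lemma cvgr_powR0 {R : realType} (u : nat -> R) (s : R) : 0 < s ->
  (forall n, 0 <= u n) -> u n @[n --> \oo] --> 0 -> u n `^ s @[n --> \oo] --> (0 : R).
Proof.
move=> s0 u0 cu; apply/cvgrPdist_le => e e0.
have d0 : 0 < e `^ s^-1 by rewrite powR_gt0.
move/cvgrPdist_le : cu => /(_ _ d0); apply: filterS => n.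
rewrite !sub0r !normrN !ger0_norm ?powR_ge0// => un.
rewrite [leRHS](_ : e = (e `^ s^-1) `^ s); last first.
  by rewrite -powRrM mulVf ?gt_eqF// powRr1// ltW.
by apply: ge0_ler_powR; rewrite ?nnegrE ?powR_ge0// ltW.
Qed.

(** * A linear observation of the latent jump diffusions *)

Section linear_observation.
Context d (Omega : measurableType d) {R : realType} (P : probability Omega R).
Variables (F : R -> set (set Omega)) (I : finType) (n_ r_ : I -> nat) (p : nat).
Variables (W : forall i, R -> Omega -> 'cV[R]_(r_ i))
  (mu : forall i, R.-ker Omega ~> (R * 'cV[R]_(n_ i))%type)
  (f : forall i, 'cV[R]_(n_ i) -> R)
  (a : forall i, 'cV[R]_(n_ i) -> 'cV[R]_(n_ i))
  (c : forall i, 'cV[R]_(n_ i) -> 'cV[R]_(n_ i) -> 'cV[R]_(n_ i))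
  (x0 : forall i, 'cV[R]_(n_ i)) (S : forall i, 'M[R]_(n_ i, r_ i))
  (Y : forall i, R -> Omega -> 'cV[R]_(n_ i))
  (C : forall i, 'M[R]_(p, n_ i)) (X : R -> Omega -> 'cV[R]_p).
Variables (T D rho : R).
Hypotheses (hF : filtration F) (hW : forall i, wiener_process P F (W i))
  (hmu : forall i, poisson_random_measure P (mu i) (@f i))
  (hindep : forall t, 0 <= t -> mutual_independence P (driving_sigma F W mu t))
  (hY : forall i, adapted F (Y i))
  (hsde : forall i, solves_jump_sde P (@a i) (S i) (@c i) (x0 i) (W i) (mu i) (Y i))
  (hX : forall t w, 0 <= t -> X t w = \sum_i C i *m Y i t w)
  (T0 : 0 < T) (D0 : 0 < D) (hrho : 0 < rho < 2^-1)
  (hint : forall i, (intensity (@f i) (`]0%R, T]%classic `*` punctured) < +oo)%E).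

Let J := {i : I & 'I_(r_ i)}.
Let U : J -> nat -> nat -> Omega -> R := noise_incr (scalar_noise W) T.
Let L (x : 'I_p) (b : J) : R := (C (tag b) *m S (tag b)) x (tagged b).
Let dx n k w := increment T (X ^~ w) n k.
Let h n : R := T / n%:R.
Let tau n := D * h n `^ rho.
Let slab n k i := (`](k%:R * h n)%R, (k.+1%:R * h n)%R]%classic `*` @punctured R (n_ i)).
Let jump n k w := [exists i, mu i w (@slab n k i) != 0%E].
Let grid_ge0 n k : 0 <= k%:R * h n. Proof. by rewrite mulr_ge0// divr_ge0// ltW. Qed.

Lemma gaussian_part_sum n k w : gaussian_part U L n k w =
  \sum_i C i *m (S i *m (W i (k.+1%:R * h n) w - W i (k%:R * h n) w)).
Proof.
apply/colP => x; rewrite mxE summxE.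
rewrite -(@sig_big_dep _ _ _ I (fun i => 'I_(r_ i)) predT (fun=> predT)
  (fun i (j : 'I_(r_ i)) => (C i *m S i) x j *
     (W i (k.+1%:R * h n) w j ord0 - W i (k%:R * h n) w j ord0)))/=.
apply: eq_bigr => i _; rewrite mulmxA mxE; apply: eq_bigr => j _.
by rewrite !mxE.
Qed.

Let v n k w i := Y i (k.+1%:R * h n) w - Y i (k%:R * h n) w -
  S i *m (W i (k.+1%:R * h n) w - W i (k%:R * h n) w).

Lemma drift_part_sum n k w : drift_part U L dx n k w = \sum_i C i *m v n k w i.
Proof.
rewrite /drift_part gaussian_part_sum /dx /increment !hX ?grid_ge0//.
rewrite -sumrB -sumrB; apply: eq_bigr => i _.
by rewrite /v !mulmxBr.
Qed.

Let Kc := #|{: {i : I & 'I_(n_ i)}}|%:R *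
  \sum_(x < p) \sum_(b : {i : I & 'I_(n_ i)}) C (tag b) x (tagged b) ^+ 2.

Lemma drift_part_le n k w : fnorm (drift_part U L dx n k w) ^+ 2 <=
  Kc * \sum_(b : {i : I & 'I_(n_ i)}) v n k w (tag b) (tagged b) ord0 ^+ 2.
Proof.
rewrite drift_part_sum fnorm_sqr /Kc -mulrA mulr_suml mulr_sumr; apply: ler_sum => x _.
have -> : (\sum_i C i *m v n k w i) x ord0 = \sum_(b : {i : I & 'I_(n_ i)})
    C (tag b) x (tagged b) * v n k w (tag b) (tagged b) ord0.
  rewrite summxE -(@sig_big_dep _ _ _ I (fun i => 'I_(n_ i)) predT (fun=> predT)
    (fun i (j : 'I_(n_ i)) => C i x j * v n k w i j ord0))/=.
  by apply: eq_bigr => i _; rewrite mxE.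
apply: (le_trans (sqr_sum_le _)); rewrite ler_wpM2l// mulr_suml.
apply: ler_sum => b _; rewrite exprMn ler_wpM2l ?sqr_ge0//.
rewrite (bigD1 b)//= lerDl; apply: sumr_ge0 => b' _; exact: sqr_ge0.
Qed.

Let measurable_Y i t j : 0 <= t -> measurable_fun setT (fun w => Y i t w j ord0).
Proof.
move=> t0 _ B mB; rewrite setTI; apply: (hF.1 t t0).2; apply: (hY t0).
exists ((fun A : 'cV[R]_(n_ i) => A j ord0) @^-1` B); last by rewrite setTI.
by rewrite -[X in measurable X]setTI; exact: measurable_mx_entry.
Qed.

Lemma measurable_observation t x : 0 <= t -> measurable_fun setT (fun w => X t w x ord0).
Proof.
move=> t0; have -> : (fun w => X t w x ord0) =
    (fun w => \sum_i \sum_j C i x j * Y i t w j ord0).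
  by apply/funext => w; rewrite hX// summxE; apply: eq_bigr => i _; rewrite mxE.
apply: measurable_sum => i; apply: measurable_sum => j.
by apply: measurable_funM => //; exact: measurable_Y.
Qed.

Lemma measurable_increment n k x : measurable_fun setT (fun w => dx n k w x ord0).
Proof.
rewrite /dx /increment; under eq_fun do rewrite !mxE.
by apply: measurable_funB; apply: measurable_observation; exact: grid_ge0.
Qed.

Let measurable_jump n k : measurable_fun setT (fun w => (jump n k w)%:R : R).
Proof.
pose E := \bigcup_i [set w | mu i w (@slab n k i) != 0%E].
have mE : measurable E.
  apply: fin_bigcup_measurable => // i _.
  have -> : [set w | mu i w (@slab n k i) != 0%E] =
      (fun w => mu i w (@slab n k i)) @^-1` (~` [set 0%E]).
    by apply/seteqP; split => w /= /eqP.
  rewrite -[X in measurable X]setTI; apply: measurable_kernel => //.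
    exact: measurable_slab.
  exact: measurableC.
have -> : (fun w => (jump n k w)%:R : R) = \1_E.
  apply/funext => w; rewrite indicE; suff -> : jump n k w = (w \in E) by [].
  apply/existsP/idP; first by move=> [i hi]; rewrite inE; exists i.
  by rewrite inE => -[i _ hi]; exists i.
exact: measurable_indic.
Qed.

(** Argued path by path: on an interval without jumps the drift part is a linear image of time
    integrals of the coefficients [a], and these integrands are integrable on []0, T]] for almost
    every path. *)
Let drift_small : small_op P (fun n w =>
  \sum_(k < n) (~~ jump n k w)%:R * fnorm (drift_part U L dx n k w) ^+ 2).
Proof.
apply: small_op_ae.
  move=> n; apply: measurable_sum => k; apply: measurable_funM.
    have -> : (fun w => (~~ jump n k w)%:R : R) = (fun w => 1 - (jump n k w)%:R).
      by apply/funext => w; case: (jump _ _ _); rewrite ?subrr ?subr0.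
    exact: measurable_funB.
  under eq_fun do rewrite fnorm_sqr.
  apply: measurable_sum => x; apply: measurable_funX.
  have -> : (fun w => drift_part U L dx n k w x ord0) =
      (fun w => dx n k w x ord0 - \sum_b L x b * U b n k w).
    apply/funext => w; rewrite /drift_part [LHS]mxE; congr (_ + _).
    by rewrite mxE; congr (- _); rewrite mxE.
  apply: measurable_funB; first exact: measurable_increment.
  apply: measurable_sum => b; apply: measurable_funM => //.
  apply: (measurable_noise_incr hF _ T0).
  exact: scalar_noise_adapted.
have ae1 : {ae P, forall w, forall i, forall s t, 0 <= s <= t ->
    mu i w (`]s, t]%classic `*` punctured) = 0%E -> forall j,
    Y i t w j ord0 - Y i s w j ord0 - ((S i *m W i t w) j ord0 - (S i *m W i s w) j ord0) =
    \int[lebesgue_measure]_(u in `]s, t]) @a i (left_limit (Y i ^~ w) u) j ord0}.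
  by apply: filter_forall => i; exact: sde_no_jump.
have ae2 : {ae P, forall w, forall i, forall t, 0 <= t -> forall j,
    lebesgue_measure.-integrable `]0, t]
      (fun s => (@a i (left_limit (Y i ^~ w) s) j ord0)%:E)}.
  apply: filter_forall => i; apply: filterS (sde_integrable (hsde i)) => w hw t t0 j.
  by have [] := hw t t0 j.
apply: filterS2 ae1 ae2 => w e1 e2.
pose B n k (b : {i : I & 'I_(n_ i)}) :=
  \int[lebesgue_measure]_(u in `](k%:R * h n), (k.+1%:R * h n)])
    @a (tag b) (left_limit (Y (tag b) ^~ w) u) (tagged b) ord0.
apply: (@squeeze_cvgr _ _ _ _ (cst 0) (fun n => Kc *
   \sum_(b : {i : I & 'I_(n_ i)}) \sum_(k < n) B n k b ^+ 2)).
- near=> n; rewrite sumr_ge0/=; last by move=> k _; rewrite mulr_ge0 ?sqr_ge0.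
  rewrite exchange_big/= mulr_sumr; apply: ler_sum => k _.
  have [jw|jw] := boolP (jump n k w).
    rewrite mul0r mulr_ge0//.
      rewrite mulr_ge0//; apply: sumr_ge0 => x _; apply: sumr_ge0 => b _; exact: sqr_ge0.
    by apply: sumr_ge0 => b _; exact: sqr_ge0.
  rewrite mul1r; apply: (le_trans (drift_part_le _ _ _)).
  rewrite le_eqVlt; apply/orP; left; apply/eqP; congr (_ * _).
  apply: eq_bigr => -[i j] _; congr (_ ^+ 2); rewrite /B/= -e1//.
  + by rewrite /v mulmxBr !mxE.
  + by rewrite grid_ge0/= ler_wpM2r ?ler_nat// divr_ge0// ltW.
  + by apply/eqP; move: jw; rewrite negb_exists => /forallP/(_ i); rewrite negbK.
- exact: cvg_cst.
- rewrite -[X in _ --> X](mulr0 Kc); apply: cvgM; first exact: cvg_cst.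
  rewrite -[X in _ --> X](_ : \sum_(b : {i : I & 'I_(n_ i)}) 0 = 0 :> R); last by rewrite big1.
  apply: cvg_sumr => b; apply: sum_sqr_integral_grid => //.
  exact: (e2 (tag b) T (ltW T0) (tagged b)).
Unshelve. all: by end_near.
Qed.

Let jumps_small (u : nat -> R) : u n @[n --> \oo] --> 0 ->
  small_op P (fun n w => u n * \sum_(k < n) (jump n k w)%:R).
Proof.
move=> u0; apply: small_op_ae.
  by move=> n; apply: measurable_funM => //; exact: measurable_sum.
have ae1 : {ae P, forall w, forall i, exists K : R, forall m, (0 < m)%N ->
    \sum_(k < m) (mu i w (@slab m k i) != 0%E)%:R <= K}.
  by apply: filter_forall => i; exact: (jump_count_finite (hmu i) T0 (hint i)).
apply: filterS ae1 => w /choice[K HK].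
have JK n : (0 < n)%N -> \sum_(k < n) (jump n k w)%:R <= \sum_i K i.
  move=> n0; apply: (@le_trans _ _ (\sum_i \sum_(k < n) (mu i w (@slab n k i) != 0%E)%:R)).
    rewrite exchange_big/=; apply: ler_sum => k _; have [/existsP[i hi]|_] := boolP (jump n k w).
      by rewrite (bigD1 i)//= hi lerDl sumr_ge0.
    by apply: sumr_ge0.
  by apply: ler_sum => i _; exact: HK.
apply/cvgrPdist_le => e e0.
have K0 : 0 < `|\sum_i K i| + 1 by rewrite ltr_wpDl.
near=> n; have n0 : (0 < n)%N by near: n; exact: nbhs_infty_gt.
rewrite sub0r normrN normrM.
have un : `|u n| <= e / (`|\sum_i K i| + 1).
  rewrite -[leLHS]normrN -sub0r; near: n.
  by move/cvgrPdist_le : u0; apply; rewrite divr_gt0.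
rewrite -[leRHS](@divfK _ (`|\sum_i K i| + 1)) ?gt_eqF//.
apply: ler_pM => //; rewrite ger0_norm ?sumr_ge0//.
apply: (le_trans (JK n n0)); apply: (le_trans (ler_norm _)); by rewrite lerDl.
Unshelve. all: by end_near.
Qed.

Let h_ge0 n : 0 <= h n. Proof. by rewrite divr_ge0// ltW. Qed.

Let h_cvg0 : h n @[n --> \oo] --> (0 : R).
Proof. rewrite -(mulr0 T); apply: cvgM; first exact: cvg_cst.
exact: cvg_invn. Qed.

Let tau_sqr n : tau n ^+ 2 = D ^+ 2 * h n `^ (2 * rho).
Proof. by rewrite exprMn -[X in _ * X]powR_mulrn ?powR_ge0// -powRrM mulrC [rho * _]mulrC mulrC. Qed.

Let tau_gt0 : \forall n \near \oo, 0 < tau n.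
Proof.
near=> n; rewrite mulr_gt0// powR_gt0// divr_gt0// ltr0n; near: n; exact: nbhs_infty_gt.
Unshelve. all: by end_near.
Qed.

Let tau_cvg0 : tau n ^+ 2 @[n --> \oo] --> (0 : R).
Proof.
have -> : (fun n => tau n ^+ 2) = (fun n => D ^+ 2 * h n `^ (2 * rho)).
  by apply/funext => n; exact: tau_sqr.
rewrite -(mulr0 (D ^+ 2)).
apply: cvgM; first exact: cvg_cst.
by apply: cvgr_powR0 => //; case/andP: hrho => r0 _; rewrite mulr_gt0.
Qed.

(** The quotient is [h ^ (1 - 2 rho) / D^2]; its exponent is positive because [rho < 1/2]. *)
Let step_tau_cvg0 : (tau n ^+ 2)^-1 * h n @[n --> \oo] --> (0 : R).
Proof.
have c0 : (D ^+ 2)^-1 * h n `^ (1 - 2 * rho) @[n --> \oo] --> (0 : R).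
  rewrite -(mulr0 (D ^+ 2)^-1); apply: cvgM; first exact: cvg_cst.
  by apply: cvgr_powR0 => //; case/andP: hrho => _ r2; lra.
apply: cvg_trans c0; apply: near_eq_cvg; near=> n.
have hn : 0 < h n by rewrite divr_gt0// ltr0n; near: n; exact: nbhs_infty_gt.
rewrite tau_sqr (invfM (D ^+ 2)) -mulrA powRB ?(gt_eqF hn) ?implybT// powRr1//.
by congr (_ * _); rewrite mulrC.
Unshelve. all: by end_near.
Qed.

Let inv_tau_cvg0 : (n%:R * tau n ^+ 2)^-1 @[n --> \oo] --> (0 : R).
Proof.
have c0 : T^-1 * ((tau n ^+ 2)^-1 * h n) @[n --> \oo] --> (0 : R).
  by rewrite -(mulr0 T^-1); apply: cvgM; [exact: cvg_cst|exact: step_tau_cvg0].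
apply: cvg_trans c0; apply: near_eq_cvg; apply: nearW => n.
by rewrite (invfM n%:R) /h [RHS]mulrC [LHS]mulrCA mulKf ?gt_eqF.
Qed.

Let lln b b' : small_op P (fun n w =>
  \sum_(k < n) U b n k w * U b' n k w - T * (b == b')%:R).
Proof.
apply: (noise_lln hF) => //.
- exact: scalar_noise_adapted.
- exact: (scalar_noise_law hF hW).
- exact: (scalar_noise_indepF hF hW hindep).
- exact: (scalar_noise_indep hF hW hindep).
Qed.

Let fourth : small_op P (fun n w =>
  (tau n ^+ 2)^-1 * \sum_(k < n) (\sum_b U b n k w ^+ 2) ^+ 2).
Proof.
apply: (noise_fourth hF) => //.
- exact: scalar_noise_adapted.
- exact: (scalar_noise_law hF hW).
- by move=> n; rewrite invr_ge0 sqr_ge0.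
Qed.

Lemma observation_covariation x y : small_op P (fun n w =>
  \sum_(k < n) dx n k w x ord0 * dx n k w y ord0 * (fnorm (dx n k w) <= tau n)%R%:R -
  T * (\sum_i (C i *m S i) *m (C i *m S i)^T) x y).
Proof.
have -> : (\sum_i (C i *m S i) *m (C i *m S i)^T) x y = \sum_b L x b * L y b.
  rewrite summxE -(@sig_big_dep _ _ _ I (fun i => 'I_(r_ i)) predT (fun=> predT)
    (fun i (j : 'I_(r_ i)) => (C i *m S i) x j * (C i *m S i) y j))/=.
  by apply: eq_bigr => i _; rewrite mxE; apply: eq_bigr => j _; congr (_ * _); rewrite mxE.
exact: (truncated_covariation lln fourth jumps_small drift_small tau_gt0 tau_cvg0).
Qed.

Lemma observation_number : small_op P (fun n w =>
  n%:R^-1 * \sum_(k < n) (fnorm (dx n k w) <= tau n)%R%:R - 1).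
Proof. exact: (truncated_number lln jumps_small drift_small tau_gt0 inv_tau_cvg0). Qed.

End linear_observation.

(** * The quasi-posterior *)

(** Rows are added greedily while some element of [S] lies outside the span; each one raises the
    rank, which is at most [N]. The rows are themselves elements of [S], so regularity known for the
    elements holds for the spanning family. *)
Lemma exists_spanning_rows {F : fieldType} {N : nat} (S : set 'rV[F]_N) :
  exists K (B : 'M[F]_(K, N)),
    (forall k, S (row k B)) /\ forall s, S s -> (s <= B)%MS.
Proof.
suff H m : forall K (B : 'M[F]_(K, N)), (forall k, S (row k B)) ->
    (N - \rank B <= m)%N -> exists K (B : 'M[F]_(K, N)),
    (forall k, S (row k B)) /\ forall s, S s -> (s <= B)%MS.
  by apply: (H N 0%N 0) => [[]//|]; exact: leq_subr.
elim: m => [|m IH] K B SB rB.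
  exists K, B; split=> // s _; apply: submx_full.
  by rewrite /row_full eqn_leq rank_leq_col -subn_eq0 -leqn0.
have [h|/existsNP[s /not_implyP[Ss sB]]] := pselect (forall s, S s -> (s <= B)%MS).
  by exists K, B.
apply: (IH (1 + K)%N (col_mx s B)).
  by move=> k; case: (split_ordP k) => j ->; rewrite ?rowKu ?rowKd ?row_id.
have : (\rank B < \rank (col_mx s B))%N.
  apply: rank_ltmx; rewrite /ltmx -addsmxE addsmxSr/= col_mx_sub negb_and.
  by case: (s <= B)%MS sB => // /(_ isT).
move=> h; rewrite -ltnS (leq_trans _ rB)// ltn_sub2l//.
by rewrite (leq_trans h) ?rank_leq_col.
Qed.

Lemma lipschitz_mx_continuous {R : realType} {m n : nat} (f : 'M[R]_(m, n) -> R) (L : R) :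
  0 <= L -> (forall c c', f c <= f c' + `|c - c'| * L) -> continuous f.
Proof.
move=> L0 fL c; apply/(@cvgrPdist_le R R^o _ (nbhs c)) => e e0.
have d0 : 0 < e / (L + 1) by rewrite divr_gt0// ltr_wpDl.
apply/nbhs_ballP; exists (e / (L + 1)) => // c'; rewrite mx_norm_ball /ball_/= => cc'.
have h : `|c - c'| * L <= e.
  apply: (@le_trans _ _ (`|c - c'| * (L + 1))); first by rewrite ler_wpM2l// lerDl.
  by rewrite -ler_pdivlMr ?ltr_wpDl// ltW.
have := fL c c'; have := fL c' c; rewrite [`|c' - c|]distrC => h1 h2.
by rewrite ler_norml; apply/andP; split; lra.
Qed.

Section quasi_posterior.
Context d (Omega : measurableType d) {R : realType} (P : probability Omega R).
Context {q N : nat}.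
Variables (Theta : set 'cV[R]_q) (s : nat -> Omega -> 'rV[R]_N) (s_oo : 'rV[R]_N)
  (l : 'I_N -> 'cV[R]_q -> R).
Definition linear_loglik (x : 'rV[R]_N) t := \sum_i x ord0 i * l i t.
Hypotheses (oT : open Theta) (bT : bounded_set Theta).
Hypotheses (ms : forall n i, measurable_fun setT (fun w => s n w ord0 i))
  (s_cvg : forall i, small_op P (fun n w => n%:R^-1 * s n w ord0 i - s_oo ord0 i))
  (smooth : forall n w, (0 < n)%N -> Ck_closure Theta 3 (linear_loglik (s n w))).
Variables (thetahat : nat -> Omega -> 'cV[R]_q).
Hypothesis hthetahat : forall n w, (0 < n)%N -> closure Theta (thetahat n w) /\
  linear_loglik (s n w) (thetahat n w) =
    sup [set linear_loglik (s n w) t | t in closure Theta].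
Variables (t0 : 'cV[R]_q) (chi : R) (prior : 'cV[R]_q -> R).
Hypotheses (T0 : Theta t0) (chi0 : 0 < chi)
  (ident : forall t, Theta t ->
     linear_loglik s_oo t - linear_loglik s_oo t0 <= - chi * `|t - t0| ^+ 2)
  (prior_density : prob_density Theta prior)
  (prior_continuous : {within closure Theta, continuous prior})
  (prior_bounded : exists C, forall t, closure Theta t -> `|prior t| <= C)
  (prior0 : 0 < prior t0).

(** An exceptional set of probability at most 1/2 misses some point, where [|x| <= e] holds for the
    constant. This turns an identity in the limit in probability into a genuine one. *)
Lemma small_op_cst (x : R) : small_op P (fun _ _ => x) -> x = 0.
Proof.
move=> ox; apply/eqP; rewrite -normr_eq0 eq_le normr_ge0 andbT.
apply/ler_addgt0Pl => e e0; rewrite addr0.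
have /(_ e 2^-1 e0)[] := ox; first by rewrite invr_gt0.
move=> n _ /(_ n (leqnn n))[E [mE PE h]].
have [w Ew] : exists w, ~ E w.
  apply: contrapT => /forallNP ET; have ET' : E = setT.
    by apply/seteqP; split => // w _; apply: contrapT; exact: ET.
  move: PE; rewrite ET' probability_setT lee_fin; apply/negP; rewrite -ltNge; lra.
exact: h Ew.
Qed.

Lemma small_op_linear (a : 'I_N -> R) : small_op P (fun n w =>
  n%:R^-1 * (\sum_i s n w ord0 i * a i) - \sum_i s_oo ord0 i * a i).
Proof.
apply: (small_op_le (small_op_sum (index_enum 'I_N) (fun i => small_opZ (a i) (s_cvg i)))).
apply: nearW => n w; rewrite le_eqVlt; apply/orP; left; apply/eqP; congr (`|_|).
rewrite mulr_sumr -sumrB; apply: eq_bigr => i _; ring.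
Qed.

(* The error is a Lipschitz function of the coefficients of the statistic, hence
   measurable: P is not monotone on arbitrary sets. *)
Lemma linear_loglik_posterior : bounded_in_probability P
  (fun n w => n%:R^-1 * ln (\int[lebesgue_col q]_(t in Theta)
                       (expR (linear_loglik (s n w) t) * prior t))
       - (n%:R^-1 * linear_loglik (s n w) (thetahat n w) - q%:R / (2 * n%:R) * ln n%:R))
  (fun n => n%:R^-1).
Proof.
have [K [B [SB sB]]] := exists_spanning_rows
  [set x | exists n w, (0 < n)%N /\ x = s n w].
pose g k t := linear_loglik (row k B) t.
pose c (x : 'rV[R]_N) (k : 'I_K) := (x *m pinvmx B) ord0 k.
have mixE x t : (x <= B)%MS -> linear_loglik x t = mix g (c x) t.
  move=> xB; rewrite /linear_loglik -{1}(mulmxKpV xB) /mix.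
  under eq_bigr do rewrite mxE mulr_suml.
  rewrite exchange_big/=; apply: eq_bigr => k _; rewrite /g /linear_loglik mulr_sumr.
  by apply: eq_bigr => i _; rewrite [row k B _ _]mxE mulrA.
have sBn n w : (0 < n)%N -> (s n w <= B)%MS by move=> n0; apply: sB; exists n, w.
(* The limit of the statistic need not be a realisation. Its cokernel coordinates are limits in
   probability of those of [s n w], which vanish identically, so it remains in the row space. *)
have sooB : (s_oo <= B)%MS.
  rewrite submxE; apply/eqP/rowP => j; rewrite !mxE; apply: small_op_cst.
  apply: (small_op_le (small_opZ (-1) (small_op_linear (fun i => cokermx B i j)))).
  near=> n => w; have n0 : (0 < n)%N by near: n; exact: nbhs_infty_gt.
  have := sBn n w n0; rewrite submxE => /eqP/rowP/(_ j); rewrite !mxE => ->.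
  rewrite mulr0 sub0r mulN1r opprK. by [].
have gCk k : Ck_closure Theta 3 (g k).
  by have [n [w [n0 e]]] := SB k; rewrite /g e; exact: smooth.
have gC2 k : Ck_on Theta 2 (g k).
  have [h _ _] := gCk k => r x Tx; have [h1 h2] := h r x Tx; split => hr.
    by apply: h1; exact: leq_trans hr _.
  by apply: h2; exact: leq_trans hr _.
have gC k : {within closure Theta, continuous (g k)} by have [] := gCk k.
have idK t : Theta t -> mix g (c s_oo) t - mix g (c s_oo) t0 <= - chi * `|t - t0| ^+ 2.
  by move=> /ident; rewrite -!mixE.
have [delta delta0 [M M0 HM]] := laplace_expansion oT bT gC2 gC T0 chi0 idK
  prior_density prior_continuous prior_bounded prior0.
have [L1 L10 HL1] := log_integral_lipschitz oT bT gC2 gC prior_density.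
have [G gG] := closure_bounded bT gC.
have ub u : has_ubound [set mix g u t | t in closure Theta].
  exists (\sum_k `|u k| * G) => _ [t ct <-]; apply: (le_trans (ler_norm _)).
  apply: (le_trans (ler_norm_sum _ _ _)); apply: ler_sum => k _.
  by rewrite normrM ler_wpM2l// gG.
pose c' n w : 'rV[R]_K := s n w *m pinvmx B.
pose G1 (x : 'rV[R]_K) := ln (\int[lebesgue_col q]_(t in Theta)
  (expR (mix g (x ord0) t) * prior t)).
(* Replaces the value at [thetahat]: by the maximum property they agree, and the supremum is
   Lipschitz in the coefficients. *)
pose G2 (x : 'rV[R]_K) := sup [set mix g (x ord0) t | t in closure Theta].
have cG1 : continuous G1.
  apply: (lipschitz_mx_continuous L10) => x y; apply: HL1 => k.
  by rewrite -[leLHS](_ : `|(x - y) ord0 k| = _) ?norm_mx_entry// !mxE.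
have cG2 : continuous G2.
  have G0 : 0 <= K%:R * `|G| by rewrite mulr_ge0.
  apply: (lipschitz_mx_continuous G0) => x y.
  have ct0 : closure Theta t0 by exact: subset_closure.
  apply: ge_sup; first by exists (mix g (x ord0) t0), t0.
  move=> _ [t ct <-].
  have h : `|mix g (x ord0) t - mix g (y ord0) t| <= `|x - y| * (K%:R * `|G|).
    apply: mix_near => k; first exact: le_trans (gG k t ct) (ler_norm _).
    by rewrite -[leLHS](_ : `|(x - y) ord0 k| = _) ?norm_mx_entry// !mxE.
  have := ler_norm (mix g (x ord0) t - mix g (y ord0) t).
  have : mix g (y ord0) t <= G2 y by apply: ub_le_sup => //; exists t.
  lra.
have mc n : measurable_fun setT (c' n).
  apply: measurable_fun_mxP => i k; rewrite (ord1 i).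
  under eq_fun do rewrite mxE.
  by apply: measurable_sum => j; apply: measurable_funM => //; exact: ms.
have o : small_op P (fun n w => \sum_k `|n%:R^-1 * c (s n w) k - c s_oo k|).
    apply: small_op_sum => k; apply: (small_op_le (small_op_linear (fun i => pinvmx B i k))).
    by apply: nearW => m w; rewrite normr_id /c !mxE.
move=> eps eps0; exists M => //; near=> n.
have n0 : (0 < n)%N by near: n; exact: nbhs_infty_gt.
have nR : 0 < n%:R :> R by rewrite ltr0n.
have nV : 0 <= n%:R^-1 :> R by rewrite invr_ge0 ltW.
pose Z w := n%:R^-1 * G1 (c' n w) -
  (n%:R^-1 * G2 (c' n w) - q%:R / (2 * n%:R) * ln n%:R).
have mG : measurable_fun setT Z.
  apply: measurable_funB; first apply: measurable_funM => //.
    apply: (@measurableT_comp _ _ _ _ _ _ G1) => //.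
    by apply: open_continuous_measurable_mx => //; exact: openT.
  apply: measurable_funB => //; apply: measurable_funM => //.
  apply: (@measurableT_comp _ _ _ _ _ _ G2) => //.
  by apply: open_continuous_measurable_mx => //; exact: openT.
have HE w : linear_loglik (s n w) = mix g (c (s n w)).
  by apply/funext => t; exact: mixE (sBn _ _ n0).
have [E [mE PE EZ]] : exists E, [/\ measurable E, (P E <= eps%:E)%E & forall w, ~ E w ->
    `|\sum_k `|n%:R^-1 * c (s n w) k - c s_oo k| | <= delta].
  by near: n; exact: o.
apply: (le_trans _ PE); apply: le_measure; rewrite ?inE//.
  have -> : [set w | M * `|n%:R^-1| < `|n%:R^-1 *
      ln (\int[lebesgue_col q]_(t in Theta) (expR (linear_loglik (s n w) t) * prior t)) -
      (n%:R^-1 * linear_loglik (s n w) (thetahat n w) - q%:R / (2 * n%:R) * ln n%:R)|] =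
      (fun w => `|Z w|) @^-1` `](M * `|n%:R^-1|), +oo[%classic.
    apply/seteqP; split => w /=; rewrite in_itv/= andbT;
      by rewrite (hthetahat w n0).2 HE.
  rewrite -[X in measurable X]setTI; apply: measurableT_comp => //.
move=> w /=; apply: contraPP => Ew; apply/negP; rewrite -leNgt.
have [cth hth] := hthetahat w n0.
(* Coefficients divided by [n]: the likelihood becomes [n%:R * mix g u], with [u] close to its limit
   outside [E], as the deterministic expansion requires. *)
pose u k := n%:R^-1 * c (s n w) k.
have HEu : linear_loglik (s n w) = (fun t => n%:R * mix g u t).
  apply/funext => t; rewrite HE /mix mulr_sumr; apply: eq_bigr => k _.
  by rewrite /u mulrA mulVKf ?gt_eqF.
have uv k : `|u k - c s_oo k| <= delta.
  apply: le_trans (EZ w Ew); rewrite [leRHS]ger0_norm ?sumr_ge0// (bigD1 k)//= lerDl.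
  exact: sumr_ge0.
have umax t : closure Theta t -> mix g u t <= mix g u (thetahat n w).
  move=> ct; rewrite -(ler_pM2l nR).
  have <- : linear_loglik (s n w) t = n%:R * mix g u t by rewrite HEu.
  have <- : linear_loglik (s n w) (thetahat n w) = n%:R * mix g u (thetahat n w) by rewrite HEu.
  rewrite hth HE; apply: ub_le_sup; first exact: ub.
  by exists t.
rewrite (ger0_norm nV).
rewrite HEu; move: (u) uv (thetahat n w) cth umax.
by near: n.
Unshelve. all: by end_near.
Qed.

End quasi_posterior.

Section intensity.
Context {R : realType}.

(** By Tonelli the mass is [c] times the length of []0, t]], since [g] has total mass 1. *)
Lemma intensity_finite n (g : 'cV[R]_n -> R) (c t : R) :
  0 <= c -> prob_density punctured g ->
  (intensity (fun z => c * g z)%R (`]0%R, t]%classic `*` punctured) < +oo)%E.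
Proof.
move=> c0 [mg g0 g1].
have mE := @measurable_punctured R n.
pose k (z : 'cV[R]_n) := (g \_ punctured) z.
have mk : measurable_fun setT k by apply/(measurable_restrictT _ _).1.
have k0 z : 0 <= k z by rewrite /k patchE; case: ifPn => // /[!inE]; exact: g0.
have mI : measurable_fun setT (\1_(`]0, t]%classic) : measurableTypeR R -> R).
  by apply: measurable_indic; exact: measurable_itv.
have mIE : measurable_fun setT (EFin \o (\1_(`]0, t]%classic) : measurableTypeR R -> R)).
  by apply/measurable_EFinP; exact: mI.
pose F (tz : measurableTypeR R * 'cV[R]_n) : \bar R :=
  ((\1_(`]0, t]%classic) tz.1 : R) * (c * k tz.2))%:E.
have mF : measurable_fun setT F.
  apply/measurable_EFinP; apply: measurable_funM.
    exact: (measurableT_comp mI measurable_fst).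
  by apply: measurable_funM => //; exact: measurableT_comp mk measurable_snd.
have F0 tz : (0 <= F tz)%E by rewrite lee_fin !mulr_ge0.
have -> : intensity (fun z => c * g z) (`]0%R, t]%classic `*` punctured) =
    (\int[lebesgue_measure \x lebesgue_col n]_tz F tz)%E.
  rewrite /intensity integral_mkcond; apply: eq_integral => -[s z] _.
  rewrite patchE /F /k /= indicE patchE.
  have -> : ((s, z) \in `]0%R, t]%classic `*` @punctured R n `&`
      `[0%R, +oo[%classic `*` punctured) = (s \in `]0%R, t]%classic) && (z \in punctured).
    apply/idP/andP; rewrite !inE/=; first by move=> [[? ?] _].
    by move=> [st z0]; split=> //; split => //; move: st; rewrite !in_itv/= andbT => /andP[/ltW].
  by case: (s \in _); case: (z \in _); rewrite /= ?mulr1n ?mulr0n ?mul1r ?mul0r ?mulr0.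
rewrite fubini_tonelli1//.
have FE s : fubini_F (lebesgue_col n) F s = ((\1_(`]0, t]%classic) s : R) * c)%:E.
  rewrite /fubini_F /F/=; under eq_integral do rewrite mulrA EFinM.
  rewrite ge0_integralZl//=; last 2 first.
  - by move=> z _; rewrite lee_fin.
  - by rewrite lee_fin mulr_ge0.
  - have -> : (\int[lebesgue_col n]_z (k z)%:E = 1)%E.
      rewrite -g1 [RHS]integral_mkcond; apply: eq_integral => z _.
      by rewrite /k !patchE; case: ifP.
    by rewrite mule1.
  exact/measurable_EFinP.
rewrite (_ : fubini_F _ F = (fun s : measurableTypeR R =>
  (c%:E * (\1_(`]0, t]%classic) s : R)%:E)%E)); last first.
  by apply/funext => s; rewrite FE mulrC EFinM.
rewrite ge0_integralZl ?lee_fin//=.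
rewrite integral_indic ?setIT//.
rewrite lte_mul_pinfty ?lee_fin//.
rewrite [X in (X < _)%E](_ : _ = ((if 0 < t then t else 0)%R)%:E) ?ltry//.
apply: eq_trans (lebesgue_measure_itv _) _ => /=.
by rewrite lte_fin; case: ifP => // _; rewrite -EFinB subr0.
Qed.

End intensity.

(** * The structural equation model *)

Lemma sum_ord4 {V : nmodType} (F : 'I_4 -> V) :
  \sum_i F i = F latent_xi + (F latent_delta + (F latent_eps + F latent_zeta)).
Proof.
rewrite !big_ord_recl big_ord0 addr0; congr (F _ + (F _ + (F _ + F _))); exact: val_inj.
Qed.

Section structural_equations.
Context {R : realType} {k1 p1 p2 k2 : nat}.
Variables (L1 : 'M[R]_(p1, k1)) (L2 : 'M[R]_(p2, k2)) (G : 'M[R]_(k2, k1)) (B : 'M[R]_k2).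
Let Pi := invmx (1%:M - B).

(** Solving the structural equation for [eta] makes the observation linear in the four latent
    variables, the form treated above. *)
Lemma structural_observation (xi : 'cV[R]_k1) (delta : 'cV[R]_p1) (eps : 'cV[R]_p2)
    (zeta eta : 'cV[R]_k2) :
  1%:M - B \in unitmx -> eta = B *m eta + G *m xi + zeta ->
  col_mx (L1 *m xi + delta) (L2 *m eta + eps) =
  col_mx L1 (L2 *m Pi *m G) *m xi + (col_mx 1%:M 0 *m delta +
    (col_mx 0 1%:M *m eps + col_mx 0 (L2 *m Pi) *m zeta)).
Proof.
move=> uB etaE.
have -> : eta = Pi *m (G *m xi + zeta).
  rewrite -[LHS](mulKmx uB); congr (_ *m _).
  by apply/eqP; rewrite mulmxBl mul1mx subr_eq addrC addrA -etaE.
rewrite !mul_col_mx !mul1mx !mul0mx !add_col_mx !add0r !addr0.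
by rewrite !mulmxDr !mulmxA -addrA (addrC eps).
Qed.

(** Block multiplication; the symmetry of [Vxi] is what makes the lower left block the transpose of
    the upper right one. *)
Lemma structural_covariance (Vxi : 'M[R]_k1) (Vdelta : 'M[R]_p1) (Veps : 'M[R]_p2)
    (Vzeta : 'M[R]_k2) : Vxi^T = Vxi ->
  let C1 := col_mx L1 (L2 *m Pi *m G) in
  let C2 : 'M[R]_(p1 + p2, p1) := col_mx 1%:M 0 in
  let C3 : 'M[R]_(p1 + p2, p2) := col_mx 0 1%:M in
  let C4 : 'M[R]_(p1 + p2, k2) := col_mx 0 (L2 *m Pi) in
  let S12 := L1 *m Vxi *m G^T *m Pi^T *m L2^T in
  C1 *m Vxi *m C1^T + (C2 *m Vdelta *m C2^T + (C3 *m Veps *m C3^T + C4 *m Vzeta *m C4^T)) =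
  block_mx (L1 *m Vxi *m L1^T + Vdelta) S12 S12^T
    (L2 *m Pi *m (G *m Vxi *m G^T + Vzeta) *m Pi^T *m L2^T + Veps).
Proof.
move=> Vs; rewrite /= !tr_col_mx (mul_col_mx _ _ Vxi) (mul_col_mx _ _ Vdelta)
  (mul_col_mx _ _ Veps) (mul_col_mx _ _ Vzeta) !mul_col_row !add_block_mx.
rewrite !trmx_mul !trmxK !trmx0 !trmx1 !mul1mx !mulmx1 !mul0mx !mulmx0 !addr0 !add0r.
congr block_mx; rewrite ?mulmxA ?Vs//.
by rewrite !mulmxDr !mulmxDl !mulmxA (addrC Veps) addrA.
Qed.

End structural_equations.

Section latent_loadings.
Context {R : realType} {k1 p1 p2 k2 : nat} {r : 'I_4 -> nat}.
Variable M : sem_matrices R k1 p1 p2 k2 r.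

(* X_t is the sum over i of sem_loading i *m Y_i,t *)
Definition sem_loading (i : 'I_4) : 'M[R]_(p1 + p2, latent_dim k1 p1 p2 k2 i) :=
  let L2Pi := sem_Lambda2 M *m invmx (sem_Psi M) in
  match i return 'M[R]_(p1 + p2, latent_dim k1 p1 p2 k2 i) with
  | Ordinal m _ =>
    match m return 'M[R]_(p1 + p2, nth 0%N [:: k1; p1; p2; k2] m) with
    | 0 => col_mx (sem_Lambda1 M) (L2Pi *m sem_Gamma M)
    | 1 => col_mx 1%:M 0
    | 2 => col_mx 0 1%:M
    | 3 => col_mx 0 L2Pi
    | _ => 0
    end
  end.

Lemma sem_loading_observation (y : forall i, 'cV[R]_(latent_dim k1 p1 p2 k2 i))
    (eta : 'cV[R]_k2) :
  sem_admissible M ->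
  eta = sem_B M *m eta + sem_Gamma M *m y latent_xi + y latent_zeta ->
  col_mx (sem_Lambda1 M *m y latent_xi + y latent_delta)
    (sem_Lambda2 M *m eta + y latent_eps) = \sum_i sem_loading i *m y i.
Proof.
move=> [_ _ _ uPsi] etaE; rewrite sum_ord4.
exact: (structural_observation (sem_Lambda1 M) (sem_Lambda2 M) (y latent_delta)
  (y latent_eps) uPsi etaE).
Qed.

Lemma sem_loading_covariance :
  \sum_i (sem_loading i *m sem_S M i) *m (sem_loading i *m sem_S M i)^T = sem_Sigma M.
Proof.
under eq_bigr => i _.
  rewrite trmx_mul mulmxA -[X in X *m _]mulmxA -/(sem_vol M i); over.
rewrite sum_ord4.
apply: (structural_covariance (sem_Lambda1 M) (sem_Lambda2 M) (sem_Gamma M) (sem_B M)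
  (Vxi := sem_vol M latent_xi)).
by rewrite /sem_vol trmx_mul trmxK.
Qed.

End latent_loadings.

Lemma mxvec_dot {R : comPzRingType} {m n : nat} (A B : 'M[R]_(m, n)) :
  (mxvec A *m (mxvec B)^T) ord0 ord0 = \sum_i \sum_j A i j * B i j.
Proof.
rewrite mxE (reindex _ (curry_mxvec_bij _ _))/= pair_bigA/=.
by apply: eq_bigr => -[i j] _ /=; rewrite [X in _ * X]mxE !mxvecE.
Qed.

(** * The quasi-likelihood as a linear form in the data *)

Section quasi_likelihood_statistic.
Context {R : realType} {p q : nat}.
Variables (T D rho : R) (Sigma : 'cV[R]_q -> 'M[R]_p).

(** A matrix and a number flattened into one row, so that rank arguments on row spaces apply to the
    data. *)
Definition loglik_statistic (A : 'M[R]_p) (N : R) : 'rV[R]_(p * p + 1) :=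
  row_mx (mxvec A) N%:M.

Definition loglik_coef (i : 'I_(p * p + 1)) (t : 'cV[R]_q) : R :=
  row_mx (mxvec (- 2^-1 *: invmx (Sigma t))) (- 2^-1 * ln (\det (Sigma t)))%:M ord0 i.

Lemma loglik_statisticE A N t : linear_loglik loglik_coef (loglik_statistic A N) t =
  - 2^-1 * (\sum_i \sum_j A i j * invmx (Sigma t) i j) - 2^-1 * (N * ln (\det (Sigma t))).
Proof.
rewrite /linear_loglik /loglik_coef /loglik_statistic big_split_ord/=.
congr (_ + _); last first.
  by rewrite big_ord_recl big_ord0 addr0 !row_mxEr !mxE eqxx !mulr1n; ring.
under eq_bigr do rewrite !row_mxEl.
transitivity ((mxvec A *m (mxvec (- 2^-1 *: invmx (Sigma t)))^T) ord0 ord0).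
  by rewrite [RHS]mxE; apply: eq_bigr => i _; congr (_ * _); rewrite mxE.
rewrite mxvec_dot mulr_sumr; apply: eq_bigr => i _.
by rewrite mulr_sumr; apply: eq_bigr => j _; rewrite !mxE; ring.
Qed.

(** The limit is the same linear form evaluated at [(Sigma t0, 1)]. Symmetry turns the trace of a
    product into the entrywise sum. *)
Lemma limit_loglikE t0 t : (Sigma t0)^T = Sigma t0 ->
  limit_loglik Sigma t0 t = linear_loglik loglik_coef (loglik_statistic (Sigma t0) 1) t.
Proof.
move=> S0; rewrite loglik_statisticE mul1r /limit_loglik; congr (_ * _ - _).
rewrite /mxtrace; apply: eq_bigr => i _; rewrite mxE; apply: eq_bigr => j _.
by rewrite -{1}S0 mxE mulrC.
Qed.

Variable x : R -> 'cV[R]_p.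
Let small n k : R := (fnorm (increment T x n k) <= D * (T / n%:R) `^ rho)%R%:R.

Definition truncated_variation n : 'M[R]_p := \matrix_(i, j)
  \sum_(k < n) increment T x n k i ord0 * increment T x n k j ord0 * small n k.

Definition small_number n : R := \sum_(k < n) small n k.

Lemma small_incrementE n k :
  small_increment D rho (T / n%:R) (increment T x n k) = small n k.
Proof.
rewrite /small_increment indicE /small; case: leP => h; first by rewrite mem_set.
by rewrite memNset//=; apply/negP; rewrite -ltNge.
Qed.

Lemma quasi_loglikE n t : quasi_loglik D rho T Sigma x n t =
  linear_loglik loglik_coef
    (loglik_statistic ((T / n%:R)^-1 *: truncated_variation n) (small_number n)) t.
Proof.
rewrite loglik_statisticE /quasi_loglik; congr (_ - _ * _); last first.
  rewrite /small_number mulr_suml; apply: eq_bigr => k _.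
  by rewrite small_incrementE mulrC.
rewrite invfM !mulNr -mulrA; congr (- (_ * _)); rewrite mulr_sumr.
transitivity (\sum_(k < n) \sum_i \sum_j (T / n%:R)^-1 *
    (increment T x n k i ord0 * increment T x n k j ord0 * small n k *
     invmx (Sigma t) i j)).
  apply: eq_bigr => k _; rewrite small_incrementE mxE exchange_big/= mulr_suml mulr_sumr.
  apply: eq_bigr => j _; rewrite mxE !mulr_suml mulr_sumr; apply: eq_bigr => i _.
  by rewrite mxE; ring.
rewrite exchange_big/=; apply: eq_bigr => i _.
rewrite exchange_big/=; apply: eq_bigr => j _.
by rewrite !mxE -mulrA mulr_suml mulr_sumr.
Qed.

End quasi_likelihood_statistic.

Lemma measurable_small_increment d (Omega : measurableType d) {R : realType} {p : nat}
    (x : Omega -> 'cV[R]_p) (e : R) :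
  (forall i, measurable_fun setT (fun w => x w i ord0)) ->
  measurable_fun setT (fun w => (fnorm (x w) <= e)%R%:R : R).
Proof.
move=> mx.
have mn : measurable_fun setT (fun w => fnorm (x w)).
  have -> : (fun w => fnorm (x w)) = (fun w => Num.sqrt (\sum_i x w i ord0 ^+ 2)).
    by apply/funext => w; rewrite -fnorm_sqr sqrtr_sqr ger0_norm ?fnorm_ge0.
  have mq : measurable_fun setT (@Num.sqrt R).
    by apply: continuous_measurable_fun; exact: sqrt_continuous.
  apply: measurableT_comp mq _.
  by apply: measurable_sum => i; exact: measurable_funX.
have -> : (fun w => (fnorm (x w) <= e)%R%:R : R) =
    \1_((fun w => fnorm (x w)) @^-1` `]-oo, e]%classic).
  apply/funext => w; rewrite indicE; case: leP => h.
    by rewrite mem_set//= in_itv/=.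
  by rewrite memNset//= in_itv/=; apply/negP; rewrite -ltNge.
apply: measurable_indic; rewrite -[X in measurable X]setTI; exact: mn.
Qed.

Theorem theorem1
  (R : realType) (d : measure_display) (Omega : measurableType d)
  (P : probability Omega R) (F : R -> set (set Omega))
  (* dimensions *)
  (k1 p1 p2 k2 : nat) (r : 'I_4 -> nat)
  (hk1 : (0 < k1 <= p1)%N) (hk2 : (0 < k2 <= p2)%N)
  (hr : forall i, (0 < r i)%N)
  (* true model: driving noises and latent processes *)
  (W : forall i : 'I_4, R -> Omega -> 'cV[R]_(r i))
  (mu : forall i : 'I_4,
     R.-ker Omega ~> (R * 'cV[R]_(latent_dim k1 p1 p2 k2 i))%type)
  (lambda0 : 'I_4 -> R)
  (jump_pdf : forall i : 'I_4, 'cV[R]_(latent_dim k1 p1 p2 k2 i) -> R)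
  (a : forall i : 'I_4, 'cV[R]_(latent_dim k1 p1 p2 k2 i) ->
     'cV[R]_(latent_dim k1 p1 p2 k2 i))
  (c : forall i : 'I_4, 'cV[R]_(latent_dim k1 p1 p2 k2 i) ->
     'cV[R]_(latent_dim k1 p1 p2 k2 i) -> 'cV[R]_(latent_dim k1 p1 p2 k2 i))
  (x0 : forall i : 'I_4, 'cV[R]_(latent_dim k1 p1 p2 k2 i))
  (Y : forall i : 'I_4, R -> Omega -> 'cV[R]_(latent_dim k1 p1 p2 k2 i))
  (M0 : sem_matrices R k1 p1 p2 k2 r)
  (hF : filtration F)
  (hW : forall i, wiener_process P F (W i))
  (hlambda0 : forall i, 0 < lambda0 i)
  (hpdf : forall i, prob_density punctured (jump_pdf i))
  (hmu : forall i,
     poisson_random_measure P (mu i) (fun z => lambda0 i * jump_pdf i z))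
  (hindep : forall t, 0 <= t -> mutual_independence P (driving_sigma F W mu t))
  (ha : forall i, measurable_fun setT (a i))
  (hc : forall i, measurable_fun (setT `*` punctured)
     (fun xz : 'cV[R]_(latent_dim k1 p1 p2 k2 i) *
               'cV[R]_(latent_dim k1 p1 p2 k2 i) => c i xz.1 xz.2))
  (hYadapted : forall i, adapted F (Y i))
  (hYcadlag : forall i, {ae P, forall w, cadlag (Y i ^~ w)})
  (hYsde : forall i,
     solves_jump_sde P (a i) (sem_S M0 i) (c i) (x0 i) (W i) (mu i) (Y i))
  (* true model: observed process *)
  (eta : R -> Omega -> 'cV[R]_k2) (X : R -> Omega -> 'cV[R]_(p1 + p2))
  (hM0 : sem_admissible M0)
  (heta : forall t w, 0 <= t ->
     eta t w = sem_B M0 *m eta t w + sem_Gamma M0 *m Y latent_xi t w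
               + Y latent_zeta t w)
  (hX : forall t w, 0 <= t ->
     X t w = col_mx (sem_Lambda1 M0 *m Y latent_xi t w + Y latent_delta t w)
                    (sem_Lambda2 M0 *m eta t w + Y latent_eps t w))
  (hSigma0 : posdefmx (sem_Sigma M0))
  (T D rho : R) (hT : 0 < T) (hD : 0 < D) (hrho : 3^-1 <= rho < 2^-1)
  (* parametric model *)
  (q : nat) (Theta : set 'cV[R]_q)
  (hTheta_bounded : bounded_set Theta) (hTheta_open : open Theta)
  (hTheta_convex : convex_set Theta)
  (M : 'cV[R]_q -> sem_matrices R k1 p1 p2 k2 r)
  (hM : forall theta, Theta theta -> sem_admissible (M theta))
  (hSigma : forall theta, closure Theta theta -> posdefmx (sem_Sigma (M theta)))
  (theta0 : 'cV[R]_q) (htheta0 : Theta theta0)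
  (hSigma0M : sem_Sigma M0 = sem_Sigma (M theta0))
  (* quasi-likelihood and estimator *)
  (H : nat -> Omega -> 'cV[R]_q -> R)
  (hH : forall n w theta, H n w theta =
     quasi_loglik D rho T (fun th => sem_Sigma (M th)) (X ^~ w) n theta)
  (hHsmooth : forall n w, (0 < n)%N -> Ck_closure Theta 3 (H n w))
  (thetahat : nat -> Omega -> 'cV[R]_q)
  (hthetahat : forall n w, (0 < n)%N -> closure Theta (thetahat n w) /\
     H n w (thetahat n w) = sup [set H n w theta | theta in closure Theta])
  (* coefficients and jump densities *)
  (hcond : forall i,
     jump_diffusion_conditions (a i) (c i) (fun z => lambda0 i * jump_pdf i z))
  (* prior *)
  (prior : 'cV[R]_q -> R) (hprior : prob_density Theta prior)
  (hprior_continuous : {within closure Theta, continuous prior})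
  (hprior_bounded : exists C : R, forall theta, closure Theta theta ->
     `|prior theta| <= C)
  (hprior0 : 0 < prior theta0)
  (* identifiability *)
  (hident : exists2 chi : R, 0 < chi & forall theta, Theta theta ->
     limit_loglik (fun th => sem_Sigma (M th)) theta0 theta
     - limit_loglik (fun th => sem_Sigma (M th)) theta0 theta0
       <= - chi * fnorm (theta - theta0) ^+ 2) :
  bounded_in_probability P
    (fun n w =>
       n%:R^-1 * ln (\int[lebesgue_col q]_(theta in Theta)
                       (expR (H n w theta) * prior theta))
       - (n%:R^-1 * H n w (thetahat n w) - q%:R / (2 * n%:R) * ln n%:R))
    (fun n => n%:R^-1).
Proof.
have [chi chi0 ident] := hident.
pose C i := sem_loading M0 i.
have hX' t w : 0 <= t -> X t w = \sum_i C i *m Y i t w.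
  move=> t0; rewrite hX//.
  exact: (sem_loading_observation (y := fun i => Y i t w) hM0 (heta _ _ t0)).
have hint i : (intensity (fun z => lambda0 i * @jump_pdf i z)%R
    (`]0%R, T]%classic `*` punctured) < +oo)%E.
  by apply: intensity_finite => //; exact: ltW.
have hrho' : 0 < rho < 2^-1.
  by case/andP: hrho => r1 ->; rewrite (lt_le_trans _ r1)// invr_gt0.
pose Sg th := sem_Sigma (M th).
have cov x y := observation_covariation hF hW hmu hindep hYadapted hYsde hX' hT hD hrho' hint x y.
have num := observation_number hF hW hmu hindep hYadapted hYsde hX' hT hD hrho' hint.
have mdx n k x := measurable_increment hF hYadapted hX' hT n k x.
pose s n w := loglik_statistic ((T / n%:R)^-1 *: truncated_variation T D rho (X ^~ w) n)
  (small_number T D rho (X ^~ w) n).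
have HE : H = fun n w => linear_loglik (loglik_coef Sg) (s n w).
  by apply/funext => n; apply/funext => w; apply/funext => th; rewrite hH quasi_loglikE.
have S0E th : limit_loglik Sg theta0 th =
    linear_loglik (loglik_coef Sg) (loglik_statistic (Sg theta0) 1) th.
  by apply: limit_loglikE; rewrite -[Sg theta0]hSigma0M; case: hSigma0.
have msmall n k : measurable_fun setT (fun w =>
   (fnorm (increment T (X ^~ w) n k) <= D * (T / n%:R) `^ rho)%R%:R : R).
  by apply: measurable_small_increment => i; exact: mdx.
subst H.
apply: (linear_loglik_posterior (s_oo := loglik_statistic (Sg theta0) 1)
  hTheta_open hTheta_bounded _ _ hHsmooth hthetahat htheta0 chi0 _ hprior
  hprior_continuous hprior_bounded hprior0).
- move=> n i; case: (split_ordP i) => j ->; last first.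
    have -> : (fun w => s n w ord0 (rshift _ j)) =
        (fun w => small_number T D rho (X ^~ w) n).
      by apply/funext => w; rewrite /s row_mxEr mxE (ord1 j) eqxx mulr1n.
    by apply: measurable_sum => k; exact: msmall.
  case/mxvec_indexP: j => x y.
  have -> : (fun w => s n w ord0 (lshift 1 (mxvec_index x y))) =
      (fun w => (T / n%:R)^-1 * truncated_variation T D rho (X ^~ w) n x y).
    by apply/funext => w; rewrite row_mxEl mxvecE mxE.
  apply: measurable_funM => //; under eq_fun do rewrite mxE.
  apply: measurable_sum => k; apply: measurable_funM; last exact: msmall.
  by apply: measurable_funM; exact: mdx.
- move=> i; case: (split_ordP i) => j ->; last first.
    apply: (small_op_le num); apply: nearW => n w.
    by rewrite !row_mxEr !mxE (ord1 j) eqxx !mulr1n.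
  case/mxvec_indexP: j => x y.
  (* The truncated variation tends to [T] times the covariance; the normalisation by [1 / n] and
     [n / T] amounts to the factor [1 / T]. *)
  apply: (small_op_le (small_opZ T^-1 (cov x y))); near=> n => w.
  have n0 : n%:R != 0 :> R by rewrite pnatr_eq0 -lt0n; near: n; exact: nbhs_infty_gt.
  rewrite /C sem_loading_covariance hSigma0M -/(Sg theta0) /s !row_mxEl !mxvecE.
  have -> : ((T / n%:R)^-1 *: truncated_variation T D rho (X ^~ w) n) x y =
      (T / n%:R)^-1 * truncated_variation T D rho (X ^~ w) n x y by rewrite mxE.
  rewrite [truncated_variation _ _ _ _ _ x y]mxE.
  rewrite le_eqVlt; apply/orP; left; apply/eqP; congr (`|_|).
  by rewrite mulrBr mulKf ?gt_eqF// invf_div mulrA mulrA mulVf// mul1r.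
move=> th Tth; rewrite -!S0E; apply: (le_trans (ident th Tth)).
(* Identifiability is given in the Euclidean norm and used in the maximum norm, which is smaller, so
   the bound weakens in the right direction. *)
rewrite !mulNr lerN2 ler_wpM2l ?(ltW chi0)//.
rewrite ler_sqr ?nnegrE ?fnorm_ge0//; apply: mx_norm_le; first exact: fnorm_ge0.
move=> i j; rewrite (ord1 j) -(ler_sqr (normr_ge0 _) (fnorm_ge0 _)) real_normK ?num_real//.
exact: entry_fnorm.
Unshelve. all: by end_near.
Qed.
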